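(* Let $f:\underline M\to\underline M'$ be an isogeny between pure Anderson motives over a field $L\supset\mathbb F_q$. Then the ideal $\deg(f)\subset A$ annihilates $\mathrm{coker}\,f$.
   Context: Setting. $C$ is a smooth projective geometrically irreducible curve over the finite field $\mathbb F_q$, $\infty\in C(\mathbb F_q)$ a fixed point, $A=\Gamma(C\setminus\{\infty\},\mathcal O_C)$. For a maximal ideal $v$ of $A$, $A_v$ is the completion of $A$ at $v$ and $\mathbb F_v$ the residue field. For a field $L\supset\mathbb F_q$: $C_L=C\times_{\mathbb F_q}L$, $A_L=A\otimes_{\mathbb F_q}L$, $\sigma^*$ the endomorphism $a\otimes b\mapsto a\otimes b^q$ of $A_L$ (also the corresponding pullback on $C_L$), $\sigma^*M=M\otimes_{A_L,\sigma^*}A_L$. Pure Anderson motives. Fix an $\mathbb F_q$-homomorphism $c^*:A\to L$ and let $J=(a\otimes1-1\otimes c^*(a):a\in A)\subset A_L$. A pure Anderson motive $\underline M=(M,\tau)$ of rank $r$, dimension $d$ and characteristic $c^*$ over $L$ is a locally free $A_L$-module $M$ of rank $r$ with an injective $A_L$-homomorphism $\tau:\sigma^*M\to M$ such that $\mathrm{coker}\,\tau$ has $L$-dimension $d$ and is annihilated by $J^d$, and $M$ extends to a locally free sheaf $\mathcal M$ of rank $r$ on $C_L$ such that for some integers $k,l>0$ the map $\tau^l=\tau\circ\sigma^*\tau\circ\cdots\circ(\sigma^* )^{l-1}\tau$ induces an isomorphism of stalks $(\sigma^* )^l\mathcal M_\infty\to\mathcal M(k\cdot\infty)_\infty$. Morphisms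 (same $c^*$) are $A_L$-homomorphisms $f:M\to M'$ with $f\circ\tau=\tau'\circ\sigma^*f$; an isogeny is an injective morphism with torsion cokernel. Degree. For an isogeny $f$, $\mathrm{coker}\,f$ is a finite-dimensional $L$-vector space annihilated by a non-zero element of $A$, hence $\mathrm{coker}\,f=\bigoplus_vK_v$ with $K_v=\mathrm{coker}\,f\otimes_AA_v$, over finitely many maximal ideals $v$ of $A$. Each $\dim_LK_v$ is divisible by $[\mathbb F_v:\mathbb F_q]$, and $\deg(f):=\prod_vv^{(\dim_LK_v)/[\mathbb F_v:\mathbb F_q]}$, an ideal of $A$. *)

(* Defs.v *)
From HB Require Import structures.
From mathcomp Require Import all_boot all_order all_algebra all_field.
From mathcomp Require finset pgroup abelian.
From mathcomp Require Import all_classical.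

Set Implicit Arguments.
Unset Strict Implicit.
Unset Printing Implicit Defensive.

Import GRing.Theory.

Local Open Scope classical_set_scope.
Local Open Scope ring_scope.
Local Open Scope quotient_scope.

Record submodule (R : comPzRingType) (M : lmodType R) := Submodule {
  smod_set :> set M;
  smod0 : smod_set 0;
  smodD : forall x y, smod_set x -> smod_set y -> smod_set (x + y);
  smodZ : forall a x, smod_set x -> smod_set (a *: x)
}.

Identity Coercion set_to_pred : set >-> Funclass.

HB.instance Definition _ (R : comPzRingType) (M : lmodType R) :=
  gen_eqMixin (submodule M).
HB.instance Definition _ (R : comPzRingType) (M : lmodType R) :=
  gen_choiceMixin (submodule M).

Section Submodules.
Variables (R : comPzRingType) (M : lmodType R).

Lemma smodN (N : submodule M) x : N x -> N (- x).
Proof. by move=> Nx; rewrite -scaleN1r; exact: smodZ. Qed.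

Definition smodT : submodule M :=
  @Submodule R M setT I (fun _ _ _ _ => I) (fun _ _ _ => I).

Definition span_set (S : set M) : set M :=
  [set x | forall N : submodule M, S `<=` N -> N x].

Fact span_set0 S : span_set S 0.
Proof. by move=> N _; exact: smod0. Qed.
Fact span_setD S x y : span_set S x -> span_set S y -> span_set S (x + y).
Proof. by move=> Sx Sy N SN; apply: smodD; [exact: Sx | exact: Sy]. Qed.
Fact span_setZ S a x : span_set S x -> span_set S (a *: x).
Proof. by move=> Sx N SN; apply: smodZ; exact: Sx. Qed.

Definition span (S : set M) : submodule M :=
  Submodule (@span_set0 S) (@span_setD S) (@span_setZ S).

End Submodules.
Arguments smodT {R M}.

Definition ideal (R : comPzRingType) := submodule (R^o : lmodType R).

Section Ideals.
Variable R : comPzRingType.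

Definition ideal_mul (I J : ideal R) : ideal R :=
  span [set z : R^o | exists x y : R, [/\ I x, J y & z = x * y]].

Definition ideal_exp (I : ideal R) (n : nat) : ideal R :=
  iter n (ideal_mul I) smodT.

Definition maximal_ideal (I : ideal R) : Prop :=
  I <> smodT /\ forall J : ideal R, I `<=` J -> J = I \/ J = smodT.

End Ideals.

Section QuotientModule.
Variables (R : comPzRingType) (M : lmodType R) (N : submodule M).

Definition qmod_eq (x y : M) : bool := `[< N (x - y) >].

Fact qmod_eq_refl : reflexive qmod_eq.
Proof. by move=> x; apply/asboolP; rewrite subrr; exact: smod0. Qed.
Fact qmod_eq_sym : symmetric qmod_eq.
Proof.
suff H x y : qmod_eq x y -> qmod_eq y x by move=> x y; apply/idP/idP; exact: H.
move=> /asboolP Nxy; apply/asboolP; rewrite -opprB.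
exact: smodN.
Qed.
Fact qmod_eq_trans : transitive qmod_eq.
Proof.
move=> y x z /asboolP Nxy /asboolP Nyz; apply/asboolP.
by rewrite -(subrKA y); exact: smodD.
Qed.

Canonical qmod_equiv := EquivRel qmod_eq qmod_eq_refl qmod_eq_sym qmod_eq_trans.

Definition qmod : Type := {eq_quot qmod_equiv}.
HB.instance Definition _ := Choice.on qmod.

Definition qclass (x : M) : qmod := \pi_{eq_quot qmod_equiv} x.

Lemma qclassP x y : qclass x = qclass y <-> N (x - y).
Proof. by split=> [/eqmodP/asboolP //|Nxy]; apply/eqmodP/asboolP. Qed.

Definition qrepr (x : qmod) : M := repr (x : {eq_quot qmod_equiv}).

Lemma qreprK x : qclass (qrepr x) = x.
Proof. exact: reprK. Qed.

Definition qadd (x y : qmod) := qclass (qrepr x + qrepr y).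
Definition qopp (x : qmod) := qclass (- qrepr x).
Definition qscale (a : R) (x : qmod) := qclass (a *: qrepr x).

Lemma qrepr_class x : N (qrepr (qclass x) - x).
Proof. by apply/qclassP; rewrite qreprK. Qed.

Lemma qaddE x y : qadd (qclass x) (qclass y) = qclass (x + y).
Proof.
by apply/qclassP; rewrite opprD addrACA; apply: smodD; exact: qrepr_class.
Qed.
Lemma qoppE x : qopp (qclass x) = qclass (- x).
Proof.
by apply/qclassP; rewrite -opprD; apply/smodN/qrepr_class.
Qed.
Lemma qscaleE a x : qscale a (qclass x) = qclass (a *: x).
Proof. by apply/qclassP; rewrite -scalerBr; apply/smodZ/qrepr_class. Qed.

Fact qaddA : associative qadd.
Proof.
move=> x y z; rewrite -(qreprK x) -(qreprK y) -(qreprK z) !qaddE.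
by rewrite addrA.
Qed.
Fact qaddC : commutative qadd.
Proof. by move=> x y; rewrite -(qreprK x) -(qreprK y) !qaddE addrC. Qed.
Fact qadd0 : left_id (qclass 0) qadd.
Proof. by move=> x; rewrite -(qreprK x) qaddE add0r. Qed.
Fact qaddN : left_inverse (qclass 0) qopp qadd.
Proof. by move=> x; rewrite -(qreprK x) qoppE qaddE addNr. Qed.
HB.instance Definition _ := GRing.isZmodule.Build qmod qaddA qaddC qadd0 qaddN.

Fact qscaleA a b x : qscale a (qscale b x) = qscale (a * b) x.
Proof. by rewrite -(qreprK x) !qscaleE scalerA. Qed.
Fact qscale1 : left_id 1 qscale.
Proof. by move=> x; rewrite -(qreprK x) qscaleE scale1r. Qed.
Fact qscaleDr : right_distributive qscale +%R.
Proof.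
move=> a x y; rewrite -(qreprK x) -(qreprK y).
by rewrite /GRing.add /= !(qaddE, qscaleE) scalerDr.
Qed.
Fact qscaleDl x : {morph qscale^~ x : a b / a + b}.
Proof.
move=> a b; rewrite -(qreprK x).
by rewrite [in RHS]/GRing.add /= !(qaddE, qscaleE) scalerDl.
Qed.
HB.instance Definition _ :=
  GRing.Zmodule_isLmodule.Build R qmod qscaleA qscale1 qscaleDr qscaleDl.

Fact qclass_is_linear : linear qclass.
Proof.
move=> a x y; rewrite /GRing.scale /GRing.add /=.
by rewrite !(qaddE, qscaleE).
Qed.
HB.instance Definition _ :=
  GRing.isLinear.Build R M qmod *:%R qclass qclass_is_linear.

End QuotientModule.

Section Cokernel.
Variables (R : comPzRingType) (M N : lmodType R) (f : {linear M -> N}).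

Fact im_set0 : range f 0.
Proof. by exists 0 => //; rewrite linear0. Qed.
Fact im_setD x y : range f x -> range f y -> range f (x + y).
Proof. by move=> [u _ <-] [v _ <-]; exists (u + v) => //; rewrite linearD. Qed.
Fact im_setZ a x : range f x -> range f (a *: x).
Proof. by move=> [u _ <-]; exists (a *: u) => //; rewrite linearZ. Qed.

Definition imm : submodule N := Submodule im_set0 im_setD im_setZ.

Definition coker : lmodType R := qmod imm.

End Cokernel.

Section Restrict.
Variables (R S : comPzRingType) (phi : {rmorphism R -> S}) (M : lmodType S).

Definition restrict of {rmorphism R -> S} : Type := M.
Local Notation rM := (restrict phi).
HB.instance Definition _ := GRing.Zmodule.on rM.

Definition rscale (a : R) (x : rM) : rM := phi a *: (x : M).

Fact rscaleA a b x : rscale a (rscale b x) = rscale (a * b) x.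
Proof. by rewrite /rscale scalerA rmorphM. Qed.
Fact rscale1 : left_id 1 rscale.
Proof. by move=> x; rewrite /rscale rmorph1 scale1r. Qed.
Fact rscaleDr : right_distributive rscale +%R.
Proof. by move=> a x y; rewrite /rscale -scalerDr. Qed.
Fact rscaleDl x : {morph rscale^~ x : a b / a + b}.
Proof. by move=> a b; rewrite /rscale rmorphD scalerDl. Qed.
HB.instance Definition _ :=
  GRing.Zmodule_isLmodule.Build R rM rscaleA rscale1 rscaleDr rscaleDl.

End Restrict.

Definition res (R S : comPzRingType) (phi : {rmorphism R -> S})
  (M : lmodType S) : lmodType R := restrict M phi.

Definition is_basis (R : comPzRingType) (V : lmodType R) n (e : 'I_n -> V) :=
  forall v, exists! a : {ffun 'I_n -> R}, v = \sum_i a i *: e i.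

Definition has_dim (F : fieldType) (V : lmodType F) (n : nat) : Prop :=
  exists e : 'I_n -> V, is_basis e.

(* Junk value 0 for infinite-dimensional spaces. *)
Definition dimension (F : fieldType) (V : lmodType F) : nat :=
  xget 0%N [set n | has_dim V n].

(* For phi : R -> S, an S-module M and an R-module N, [tens phi M N] is the
   S-module M (x)_R N, where R acts on M through phi.  Its elements are finite
   formal sums of pairs (m, n); two sums are identified when no R-balanced
   biadditive map into an abelian group separates them.  The universal
   property is [tliftE] together with [tens_ind]. *)
Section Tensor.
Variables (R S : comPzRingType) (phi : {rmorphism R -> S}).
Variables (M : lmodType S) (N : lmodType R).

Definition balanced (P : zmodType) (B : M -> N -> P) : Prop :=
  [/\ forall m m' n, B (m + m') n = B m n + B m' n,
      forall m n n', B m (n + n') = B m n + B m n' &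
      forall r m n, B (phi r *: m) n = B m (r *: n)].

Definition fsum (P : zmodType) (B : M -> N -> P) (s : seq (M * N)) : P :=
  \sum_(p <- s) B p.1 p.2.

Definition tens_eq (s t : seq (M * N)) : bool :=
  `[< forall (P : zmodType) (B : M -> N -> P), balanced B ->
        fsum B s = fsum B t >].

Fact tens_eq_refl : reflexive tens_eq.
Proof. by move=> s; apply/asboolP. Qed.
Fact tens_eq_sym : symmetric tens_eq.
Proof.
suff H s t : tens_eq s t -> tens_eq t s by move=> s t; apply/idP/idP; exact: H.
by move=> /asboolP st; apply/asboolP => P B bB; rewrite st.
Qed.
Fact tens_eq_trans : transitive tens_eq.
Proof.
move=> t s u /asboolP st /asboolP tu; apply/asboolP => P B bB.
by rewrite st // tu.
Qed.

Canonical tens_equiv := EquivRel tens_eq tens_eq_refl tens_eq_sym tens_eq_trans.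

Definition tens : Type := {eq_quot tens_equiv}.
HB.instance Definition _ := Choice.on tens.

Definition tclass (s : seq (M * N)) : tens := \pi_{eq_quot tens_equiv} s.
Definition trepr (x : tens) : seq (M * N) := repr (x : {eq_quot tens_equiv}).
Definition tpure (m : M) (n : N) : tens := tclass [:: (m, n)].

(* the homomorphism induced by a balanced map B *)
Definition tlift (P : zmodType) (B : M -> N -> P) (x : tens) : P :=
  fsum B (trepr x).

Lemma treprK x : tclass (trepr x) = x.
Proof. exact: reprK. Qed.

Lemma tclassP s t : tclass s = tclass t <->
  forall (P : zmodType) (B : M -> N -> P), balanced B -> fsum B s = fsum B t.
Proof. by split=> [/eqmodP/asboolP //|st]; apply/eqmodP/asboolP. Qed.

Lemma tlift_class (P : zmodType) (B : M -> N -> P) s :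
  balanced B -> tlift B (tclass s) = fsum B s.
Proof. by move=> bB; apply: (tclassP _ _).1 bB; rewrite treprK. Qed.

Lemma fsum_cat (P : zmodType) (B : M -> N -> P) s t :
  fsum B (s ++ t) = fsum B s + fsum B t.
Proof. exact: big_cat. Qed.

Lemma fsum_map (P : zmodType) (B : M -> N -> P) (g : M * N -> M * N) s :
  fsum B (map g s) = \sum_(p <- s) B (g p).1 (g p).2.
Proof. exact: big_map. Qed.

Definition tadd (x y : tens) : tens := tclass (trepr x ++ trepr y).
Definition topp (x : tens) : tens := tclass [seq (- p.1, p.2) | p <- trepr x].
Definition tscale (a : S) (x : tens) : tens :=
  tclass [seq (a *: p.1, p.2) | p <- trepr x].

Lemma balancedN (P : zmodType) (B : M -> N -> P) m n :
  balanced B -> B (- m) n = - B m n.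
Proof.
move=> [BD _ _]; have B0 : B 0 n = 0.
  by apply: (addrI (B 0 n)); rewrite -BD !addr0.
by apply: (addrI (B m n)); rewrite -BD !subrr.
Qed.

Lemma balancedZ (P : zmodType) (B : M -> N -> P) a :
  balanced B -> balanced (fun m n => B (a *: m) n).
Proof.
move=> [B1 B2 B3]; split=> [m m' n|m n n'|r m n].
- by rewrite scalerDr B1.
- by rewrite B2.
- by rewrite scalerA mulrC -scalerA B3.
Qed.

Lemma fsumN (P : zmodType) (B : M -> N -> P) s : balanced B ->
  fsum B [seq (- p.1, p.2) | p <- s] = - fsum B s.
Proof.
move=> bB; rewrite fsum_map -sumrN; apply: eq_bigr => p _.
exact: balancedN.
Qed.

Lemma fsumZ (P : zmodType) (B : M -> N -> P) a s :
  fsum B [seq (a *: p.1, p.2) | p <- s] = fsum (fun m n => B (a *: m) n) s.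
Proof. exact: fsum_map. Qed.

Lemma taddE s t : tadd (tclass s) (tclass t) = tclass (s ++ t).
Proof.
by apply/tclassP => P B bB; rewrite !fsum_cat -!/(tlift B _) !tlift_class.
Qed.
Lemma toppE s : topp (tclass s) = tclass [seq (- p.1, p.2) | p <- s].
Proof.
by apply/tclassP => P B bB; rewrite !fsumN // -!/(tlift B _) !tlift_class.
Qed.
Lemma tscaleE a s : tscale a (tclass s) = tclass [seq (a *: p.1, p.2) | p <- s].
Proof.
apply/tclassP => P B bB; rewrite !fsumZ -/(tlift _ _) tlift_class //.
exact: balancedZ.
Qed.

Fact taddA : associative tadd.
Proof.
move=> x y z; rewrite -(treprK x) -(treprK y) -(treprK z) !taddE.
by rewrite catA.
Qed.
Fact taddC : commutative tadd.
Proof.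
move=> x y; rewrite -(treprK x) -(treprK y) !taddE.
by apply/tclassP => P B bB; rewrite !fsum_cat addrC.
Qed.
Fact tadd0 : left_id (tclass [::]) tadd.
Proof. by move=> x; rewrite -(treprK x) taddE. Qed.
Fact taddN : left_inverse (tclass [::]) topp tadd.
Proof.
move=> x; rewrite -(treprK x) toppE taddE.
by apply/tclassP => P B bB; rewrite fsum_cat fsumN // addNr /fsum big_nil.
Qed.
HB.instance Definition _ := GRing.isZmodule.Build tens taddA taddC tadd0 taddN.

Fact tscaleA a b x : tscale a (tscale b x) = tscale (a * b) x.
Proof.
rewrite -(treprK x) !tscaleE; apply/tclassP => P B bB.
by rewrite !fsumZ; apply: eq_bigr => p _; rewrite scalerA.
Qed.
Fact tscale1 : left_id 1 tscale.
Proof.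
move=> x; rewrite -(treprK x) tscaleE; apply/tclassP => P B bB.
by rewrite !fsumZ; apply: eq_bigr => p _; rewrite scale1r.
Qed.
Fact tscaleDr : right_distributive tscale +%R.
Proof.
move=> a x y; rewrite -(treprK x) -(treprK y).
by rewrite /GRing.add /= !(taddE, tscaleE) map_cat.
Qed.
Fact tscaleDl x : {morph tscale^~ x : a b / a + b}.
Proof.
move=> a b; rewrite -(treprK x).
rewrite [in RHS]/GRing.add /= !(taddE, tscaleE).
apply/tclassP => P B [B1 B2 B3]; rewrite fsum_cat !fsumZ -big_split /=.
by apply: eq_bigr => p _; rewrite scalerDl B1.
Qed.
HB.instance Definition _ :=
  GRing.Zmodule_isLmodule.Build S tens tscaleA tscale1 tscaleDr tscaleDl.

Lemma tclass_cat s t : tclass (s ++ t) = tclass s + tclass t.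
Proof. by rewrite [in RHS]/GRing.add /= taddE. Qed.

Lemma tclass_sum s : tclass s = \sum_(p <- s) tpure p.1 p.2.
Proof.
elim: s => [|[m n] s IHs]; first by rewrite big_nil.
by rewrite big_cons -IHs -tclass_cat.
Qed.

Lemma tens_ind (Q : tens -> Prop) :
    Q 0 -> (forall m n, Q (tpure m n)) ->
    (forall x y, Q x -> Q y -> Q (x + y)) ->
  forall x, Q x.
Proof.
move=> Q0 Qp QD x; rewrite -(treprK x) tclass_sum.
by elim/big_ind: _ => // p _; exact: Qp.
Qed.

Lemma tpureZ a m n : a *: tpure m n = tpure (a *: m) n.
Proof. by rewrite [LHS]/GRing.scale /= tscaleE. Qed.

Lemma tpure_balanced : balanced tpure.
Proof.
split=> [m m' n|m n n'|r m n]; rewrite -?tclass_cat; apply/tclassP => P B;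
  by case=> B1 B2 B3; rewrite /fsum !big_cons !big_nil /= ?addr0 ?(B1, B2, B3).
Qed.

Lemma tliftE (P : zmodType) (B : M -> N -> P) m n :
  balanced B -> tlift B (tpure m n) = B m n.
Proof. by move=> bB; rewrite tlift_class // /fsum big_seq1. Qed.

Lemma tliftD (P : zmodType) (B : M -> N -> P) : balanced B ->
  {morph tlift B : x y / x + y}.
Proof.
move=> bB x y; rewrite -(treprK x) -(treprK y) -tclass_cat.
by rewrite !tlift_class // fsum_cat.
Qed.

End Tensor.

Definition tens_map (R S S' : comPzRingType) (phi : {rmorphism R -> S})
    (phi' : {rmorphism R -> S'}) (M : lmodType S) (M' : lmodType S')
    (N N' : lmodType R) (u : M -> M') (w : N -> N')
    (x : tens phi M N) : tens phi' M' N' :=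
  tlift (fun m n => tpure phi' (u m) (w n)) x.

(* The tensor product S (x)_R T of two commutative R-algebras. *)
Section TensorRing.
Variables (R S T : comPzRingType).
Variables (phi : {rmorphism R -> S}) (psi : {rmorphism R -> T}).

Definition tring : Type := tens phi (S^o : lmodType S) (res psi (T^o : lmodType T)).
HB.instance Definition _ := GRing.Zmodule.on tring.

Definition tmono (a : S) (b : T) : tring :=
  @tpure R S phi S^o (res psi T^o) a b.

Definition tbal (P : zmodType) (B : S -> T -> P) : Prop :=
  @balanced R S phi S^o (res psi T^o) P B.
Definition rlift (P : zmodType) (B : S -> T -> P) (x : tring) : P :=
  @tlift R S phi S^o (res psi T^o) P B x.

Lemma tbalP (P : zmodType) (B : S -> T -> P) :
    (forall a a' b, B (a + a') b = B a b + B a' b) ->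
    (forall a b b', B a (b + b') = B a b + B a b') ->
    (forall r a b, B (phi r * a) b = B a (psi r * b)) -> tbal B.
Proof. by move=> B1 B2 B3; split; [exact: B1|exact: B2|exact: B3]. Qed.

Lemma tmonoDl a a' b : tmono (a + a') b = tmono a b + tmono a' b.
Proof. by have [B1 _ _] := tpure_balanced phi S^o (res psi T^o); exact: B1. Qed.
Lemma tmonoDr a b b' : tmono a (b + b') = tmono a b + tmono a b'.
Proof. by have [_ B2 _] := tpure_balanced phi S^o (res psi T^o); exact: B2. Qed.
Lemma tmonoZ r a b : tmono (phi r * a) b = tmono a (psi r * b).
Proof. by have [_ _ B3] := tpure_balanced phi S^o (res psi T^o); exact: B3. Qed.

Lemma tring_ind (Q : tring -> Prop) :
    Q 0 -> (forall a b, Q (tmono a b)) ->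
    (forall x y, Q x -> Q y -> Q (x + y)) ->
  forall x, Q x.
Proof. exact: (@tens_ind R S phi S^o (res psi T^o) Q). Qed.

Lemma rliftE (P : zmodType) (B : S -> T -> P) a b :
  tbal B -> rlift B (tmono a b) = B a b.
Proof. exact: tliftE. Qed.
Lemma rliftD (P : zmodType) (B : S -> T -> P) : tbal B ->
  {morph rlift B : x y / x + y}.
Proof. exact: tliftD. Qed.
Lemma rlift0 (P : zmodType) (B : S -> T -> P) : tbal B -> rlift B 0 = 0.
Proof.
by move=> bB; apply: (addrI (rlift B 0)); rewrite -rliftD // !addr0.
Qed.

Definition tmull (a : S) (b : T) (y : tring) : tring :=
  rlift (fun a' b' => tmono (a * a') (b * b')) y.
Definition tmul (x y : tring) : tring := rlift (fun a b => tmull a b y) x.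

Fact tmull_bal a b : tbal (fun a' b' => tmono (a * a') (b * b')).
Proof.
apply: tbalP => [x y z|x y z|r x y].
- by rewrite mulrDr tmonoDl.
- by rewrite mulrDr tmonoDr.
- by rewrite mulrCA tmonoZ mulrCA.
Qed.

Lemma tmullE a b a' b' : tmull a b (tmono a' b') = tmono (a * a') (b * b').
Proof. exact/rliftE/tmull_bal. Qed.
Lemma tmullD a b y y' : tmull a b (y + y') = tmull a b y + tmull a b y'.
Proof. exact/rliftD/tmull_bal. Qed.
Lemma tmull0 a b : tmull a b 0 = 0.
Proof. exact/rlift0/tmull_bal. Qed.

Fact tmul_bal y : tbal (fun a b => tmull a b y).
Proof.
elim/tring_ind: y => [|a' b'|y y' [B1 B2 B3] [C1 C2 C3]].
- by apply: tbalP => *; rewrite !tmull0 ?addr0.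
- apply: tbalP => [x y z|x y z|r x y]; rewrite !tmullE.
  + by rewrite mulrDl tmonoDl.
  + by rewrite mulrDl tmonoDr.
  + by rewrite -mulrA tmonoZ mulrA.
- apply: tbalP => [u v z|u v z|r u v]; rewrite !tmullD.
  + by rewrite (B1 u v z) (C1 u v z) addrACA.
  + by rewrite (B2 u v z) (C2 u v z) addrACA.
  + by rewrite (B3 r u v) (C3 r u v).
Qed.

Lemma tmulE a b a' b' :
  tmul (tmono a b) (tmono a' b') = tmono (a * a') (b * b').
Proof. by rewrite /tmul rliftE ?tmullE //; exact: tmul_bal. Qed.

Fact tmulDl : left_distributive tmul +%R.
Proof. by move=> x y z; rewrite /tmul rliftD //; exact: tmul_bal. Qed.
Lemma tmul0l y : tmul 0 y = 0.
Proof. by rewrite /tmul rlift0 //; exact: tmul_bal. Qed.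

Fact tmulC : commutative tmul.
Proof.
have mul0r x : tmul x 0 = 0.
  elim/tring_ind: x => [|a b|x x' IH IH']; first exact: tmul0l.
    by rewrite /tmul rliftE ?tmull0 //; exact: tmul_bal.
  by rewrite tmulDl IH IH' addr0.
have mulDr x y z : tmul x (y + z) = tmul x y + tmul x z.
  elim/tring_ind: x => [|a b|x x' IH IH']; first by rewrite !tmul0l addr0.
    by rewrite /tmul !rliftE ?tmullD //; exact: tmul_bal.
  by rewrite !tmulDl IH IH' addrACA.
move=> x y; elim/tring_ind: x => [|a b|x x' IH IH'].
- by rewrite tmul0l mul0r.
- elim/tring_ind: y => [|a' b'|y y' IH IH'].
  + by rewrite tmul0l mul0r.
  + by rewrite !tmulE mulrC [b * _]mulrC.
  + by rewrite tmulDl mulDr IH IH'.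
- by rewrite tmulDl mulDr IH IH'.
Qed.

Fact tmulA : associative tmul.
Proof.
have mulDr x y z : tmul x (y + z) = tmul x y + tmul x z.
  by rewrite tmulC tmulDl !(tmulC x).
have mul0r x : tmul x 0 = 0 by rewrite tmulC tmul0l.
move=> x y z; elim/tring_ind: x => [|a b|x x' IH IH']; first by rewrite !tmul0l.
  elim/tring_ind: y => [|a' b'|y y' IH IH'].
  - by rewrite !(tmul0l, mul0r).
  - elim/tring_ind: z => [|c d|z z' IH IH']; first by rewrite !mul0r.
      by rewrite !tmulE !mulrA.
    by rewrite !mulDr IH IH'.
  - by rewrite !(mulDr, tmulDl) IH IH'.
by rewrite !tmulDl IH IH'.
Qed.

Fact tmul1 : left_id (tmono 1 1) tmul.
Proof.
move=> x; elim/tring_ind: x => [|a b|x x' IH IH'].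
- by rewrite tmulC tmul0l.
- by rewrite tmulE !mul1r.
- by rewrite tmulC tmulDl !(tmulC _ (tmono 1 1)) IH IH'.
Qed.

HB.instance Definition _ :=
  GRing.Zmodule_isComPzRing.Build tring tmulA tmulC tmul1 tmulDl.

Lemma tmonoM a b a' b' : tmono a b * tmono a' b' = tmono (a * a') (b * b').
Proof. exact: tmulE. Qed.

Definition tinl (a : S) : tring := tmono a 1.
Definition tinr (b : T) : tring := tmono 1 b.

Fact tinl_is_zmod_morphism : zmod_morphism tinl.
Proof.
by move=> a a'; apply/eqP; rewrite eq_sym subr_eq -tmonoDl subrK.
Qed.
Fact tinl_is_monoid_morphism : monoid_morphism tinl.
Proof. by split=> // a a'; rewrite tmonoM mulr1. Qed.
HB.instance Definition _ := GRing.isZmodMorphism.Build S tring tinl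
  tinl_is_zmod_morphism.
HB.instance Definition _ := GRing.isMonoidMorphism.Build S tring tinl
  tinl_is_monoid_morphism.

Fact tinr_is_zmod_morphism : zmod_morphism tinr.
Proof.
by move=> b b'; apply/eqP; rewrite eq_sym subr_eq -tmonoDr subrK.
Qed.
Fact tinr_is_monoid_morphism : monoid_morphism tinr.
Proof. by split=> // b b'; rewrite tmonoM mulr1. Qed.
HB.instance Definition _ := GRing.isZmodMorphism.Build T tring tinr
  tinr_is_zmod_morphism.
HB.instance Definition _ := GRing.isMonoidMorphism.Build T tring tinr
  tinr_is_monoid_morphism.

End TensorRing.

Section TensorRingMap.
Variables (R S T S' T' : comPzRingType).
Variables (phi : {rmorphism R -> S}) (psi : {rmorphism R -> T}).
Variables (phi' : {rmorphism R -> S'}) (psi' : {rmorphism R -> T'}).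
Variables (f : {rmorphism S -> S'}) (g : {rmorphism T -> T'}).
Hypotheses (fphi : forall r, f (phi r) = phi' r).
Hypotheses (gpsi : forall r, g (psi r) = psi' r).

(* a (x) b |-> f(a) (x) g(b) *)
Definition tring_map_fun (x : tring phi psi) : tring phi' psi' :=
  rlift (fun a b => tmono phi' psi' (f a) (g b)) x.

Fact tring_map_bal : tbal phi psi (fun a b => tmono phi' psi' (f a) (g b)).
Proof.
apply: tbalP => [a a' b|a b b'|r a b].
- by rewrite rmorphD tmonoDl.
- by rewrite rmorphD tmonoDr.
- by rewrite !rmorphM fphi gpsi tmonoZ.
Qed.

Lemma tring_map_mono a b :
  tring_map_fun (tmono phi psi a b) = tmono phi' psi' (f a) (g b).
Proof. exact/rliftE/tring_map_bal. Qed.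

Fact tring_map_is_zmod_morphism : zmod_morphism tring_map_fun.
Proof.
by move=> x y; apply/eqP; rewrite eq_sym subr_eq -(rliftD tring_map_bal) subrK.
Qed.

Fact tring_map_is_monoid_morphism : monoid_morphism tring_map_fun.
Proof.
have mD : {morph tring_map_fun : x y / x + y} := rliftD tring_map_bal.
have m0 : tring_map_fun 0 = 0 := rlift0 tring_map_bal.
split=> [|x y]; first by rewrite [LHS]tring_map_mono !rmorph1.
elim/tring_ind: x => [|a b|x x' IH IH']; first by rewrite m0 !mul0r m0.
  elim/tring_ind: y => [|a' b'|y y' IH IH']; first by rewrite m0 !mulr0 m0.
    by rewrite tmonoM !tring_map_mono tmonoM !rmorphM.
  by rewrite mulrDr !mD mulrDr IH IH'.
by rewrite mulrDl !mD mulrDl IH IH'.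
Qed.

HB.instance Definition _ := GRing.isZmodMorphism.Build
  (tring phi psi) (tring phi' psi') tring_map_fun tring_map_is_zmod_morphism.
HB.instance Definition _ := GRing.isMonoidMorphism.Build
  (tring phi psi) (tring phi' psi') tring_map_fun tring_map_is_monoid_morphism.

Definition tring_map : {rmorphism tring phi psi -> tring phi' psi'} :=
  tring_map_fun.

End TensorRingMap.

(* The localization M[1/g] is free of rank r over R[1/g]; after rescaling, a
   basis may be taken in the image of M, and denominators are cleared. *)
Definition free_away (R : comPzRingType) (M : lmodType R) (r : nat) (g : R) :=
  exists e : 'I_r -> M,
    (forall m, exists (n : nat) (a : 'I_r -> R),
       g ^+ n *: m = \sum_i a i *: e i) /\
    (forall a : 'I_r -> R, \sum_i a i *: e i = 0 ->
       exists n : nat, forall i, g ^+ n * a i = 0).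

(* Spec R is covered by the D(g), g in s, over which M is free of rank r. *)
Definition locally_free (R : comPzRingType) (M : lmodType R) (r : nat) :=
  exists s : seq R,
    span [set g : R^o | g \in s] = smodT /\
    forall g, g \in s -> free_away M r g.

(* Over an integral domain, [GRing.lreg a] means a <> 0. *)
Definition torsion_module (R : comPzRingType) (M : lmodType R) :=
  forall x : M, exists a : R, GRing.lreg a /\ a *: x = 0.

Definition annihilates (R : comPzRingType) (I : ideal R) (M : lmodType R) :=
  forall (a : R) (x : M), I a -> a *: x = 0.

(* lim_n R/v^n, as an R-module *)
Section Completion.
Variables (R : comPzRingType) (v : ideal R).

Let quo n := qmod (ideal_exp v n).

(* x_(n+1) maps to x_n under R/v^(n+1) -> R/v^n *)
Definition coherent (x : forall n, quo n) : Prop :=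
  forall n, exists a : R^o, x n = qclass _ a /\ x n.+1 = qclass _ a.

Record completion := Completion {
  compl_val : forall n, quo n;
  complP : coherent compl_val
}.

HB.instance Definition _ := gen_eqMixin completion.
HB.instance Definition _ := gen_choiceMixin completion.

Lemma compl_inj x y : (forall n, compl_val x n = compl_val y n) -> x = y.
Proof.
case: x y => [x cx] [y cy] /= xy.
have {xy} E : x = y by exact: functional_extensionality_dep.
by case: y / E cy => cy; congr Completion; exact: Prop_irrelevance.
Qed.

Fact cohD x y : coherent x -> coherent y -> coherent (fun n => x n + y n).
Proof.
move=> cx cy n; have [a [-> ->]] := cx n; have [b [-> ->]] := cy n.
by exists (a + b); rewrite !linearD.
Qed.
Fact coh0 : coherent (fun n => 0).
Proof. by move=> n; exists 0; rewrite !linear0. Qed.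
Fact cohZ a x : coherent x -> coherent (fun n => a *: x n).
Proof.
by move=> cx n; have [b [-> ->]] := cx n; exists (a *: b); rewrite !linearZ.
Qed.
Fact cohN x : coherent x -> coherent (fun n => - x n).
Proof.
by move=> cx n; have [b [-> ->]] := cx n; exists (- b); rewrite !linearN.
Qed.

Definition compl_add x y := Completion (cohD (complP x) (complP y)).
Definition compl_opp x := Completion (cohN (complP x)).
Definition compl_zero := Completion coh0.
Definition compl_scale a x := Completion (cohZ a (complP x)).

Fact compl_addA : associative compl_add.
Proof. by move=> x y z; apply: compl_inj => n; exact: addrA. Qed.
Fact compl_addC : commutative compl_add.
Proof. by move=> x y; apply: compl_inj => n; exact: addrC. Qed.
Fact compl_add0 : left_id compl_zero compl_add.
Proof. by move=> x; apply: compl_inj => n; exact: add0r. Qed.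
Fact compl_addN : left_inverse compl_zero compl_opp compl_add.
Proof. by move=> x; apply: compl_inj => n; exact: addNr. Qed.
HB.instance Definition _ := GRing.isZmodule.Build completion
  compl_addA compl_addC compl_add0 compl_addN.

Fact compl_scaleA a b x : compl_scale a (compl_scale b x) = compl_scale (a * b) x.
Proof. by apply: compl_inj => n; exact: scalerA. Qed.
Fact compl_scale1 : left_id 1 compl_scale.
Proof. by move=> x; apply: compl_inj => n; exact: scale1r. Qed.
Fact compl_scaleDr : right_distributive compl_scale +%R.
Proof. by move=> a x y; apply: compl_inj => n; exact: scalerDr. Qed.
Fact compl_scaleDl x : {morph compl_scale^~ x : a b / a + b}.
Proof. by move=> a b; apply: compl_inj => n; exact: scalerDl. Qed.
HB.instance Definition _ := GRing.Zmodule_isLmodule.Build R completion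
  compl_scaleA compl_scale1 compl_scaleDr compl_scaleDl.

End Completion.

(* A smooth projective curve over the perfect field Fq is given by its function
   field K; its closed points correspond to the valuation rings of K over Fq, and
   a point is represented by its local ring, a subset of K. *)

Section FunctionField.
Variables (Fq : finFieldType) (K : fieldType) (cst : {rmorphism Fq -> K}).

(* For some x transcendental over Fq, K is a finite extension of Fq(x);
   denominators are cleared in the spanning condition. *)
Definition function_field : Prop := exists x : K,
  (forall p : {poly Fq}, p != 0 -> (map_poly cst p).[x] != 0) /\
  exists (n : nat) (b : 'I_n -> K), forall y : K,
    exists (q : {poly Fq}) (p : 'I_n -> {poly Fq}),
      q != 0 /\ (map_poly cst q).[x] * y = \sum_i (map_poly cst (p i)).[x] * b i.

(* C_L is irreducible for every extension L of Fq.  As Fq is perfect, K (x) L is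
   always reduced, so this says that K (x) L is an integral domain. *)
Definition geometrically_integral : Prop :=
  forall (L : fieldType) (psi : {rmorphism Fq -> L}),
    (1 != 0 :> tring cst psi) /\
    forall x y : tring cst psi, x * y = 0 -> x = 0 \/ y = 0.

Record place (O : set K) : Prop := Place {
  place_cst : forall a, O (cst a);
  placeB : forall x y, O x -> O y -> O (x - y);
  placeM : forall x y, O x -> O y -> O (x * y);
  placeV : forall x, O x \/ O x^-1;
  place_proper : exists x, ~ O x
}.

Definition place_max (O : set K) : set K :=
  [set x | O x /\ (x = 0 \/ ~ O x^-1)].

(* The residue field of O is Fq. *)
Definition rational_place (O : set K) : Prop :=
  forall x, O x -> exists a : Fq, place_max O (x - cst a).

Definition uniformizer (O : set K) (t : K) : Prop :=
  place_max O t /\ forall x, place_max O x -> O (x / t).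

End FunctionField.

Record curve (Fq : finFieldType) := Curve {
  ffield : fieldType;
  cst : {rmorphism Fq -> ffield};
  curve_function_field : function_field cst;
  curve_geom_integral : geometrically_integral cst;
  infty : set ffield;
  infty_place : place cst infty;
  infty_rational : rational_place cst infty
}.

Arguments cst {Fq} c.
Arguments infty {Fq} c.

Section CoordinateRing.
Variables (Fq : finFieldType) (C : curve Fq).

Definition regular : {pred ffield C} :=
  fun x => `[< forall O, place (cst C) O -> O <> infty C -> O x >].

Fact regular_subring_closed : subring_closed regular.
Proof.
split=> [|x y /asboolP Ox /asboolP Oy|x y /asboolP Ox /asboolP Oy];
  apply/asboolP => O plO nO.
- by rewrite -(rmorph1 (cst C)); exact: (place_cst plO).
- by apply: (placeB plO); [exact: Ox | exact: Oy].
- by apply: (placeM plO); [exact: Ox | exact: Oy].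
Qed.
HB.instance Definition _ :=
  GRing.isSubringClosed.Build (ffield C) regular regular_subring_closed.

(* A = Gamma(C \ {infty}, O_C) *)
Definition coord_ring : Type := {x : ffield C | x \in regular}.
HB.instance Definition _ := SubChoice.on coord_ring.
HB.instance Definition _ := [SubChoice_isSubComNzRing of coord_ring by <:].

Fact cst_regular a : cst C a \in regular.
Proof. by apply/asboolP => O plO _; exact: place_cst. Qed.

Definition cstA (a : Fq) : coord_ring :=
  exist (fun x => x \in regular) _ (cst_regular a).

Fact cstA_is_zmod_morphism : zmod_morphism cstA.
Proof. by move=> a b; apply: val_inj; rewrite /= rmorphB. Qed.
Fact cstA_is_monoid_morphism : monoid_morphism cstA.
Proof.
by split=> [|a b]; apply: val_inj; rewrite /= ?rmorph1 ?rmorphM.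
Qed.
HB.instance Definition _ := GRing.isZmodMorphism.Build Fq coord_ring cstA
  cstA_is_zmod_morphism.
HB.instance Definition _ := GRing.isMonoidMorphism.Build Fq coord_ring cstA
  cstA_is_monoid_morphism.

End CoordinateRing.

Section Frobenius.
Variables (Fq : finFieldType) (L : fieldType) (psi : {rmorphism Fq -> L}).

Definition frob of {rmorphism Fq -> L} : L -> L := fun x => x ^+ #|Fq|.

Fact frob_is_zmod_morphism : zmod_morphism (frob psi).
Proof.
have [p _ pFq] := finPcharP Fq.
have pL : p \in [pchar L] by rewrite (fmorph_pchar psi).
have /and3P[] := abelian.fin_ring_pchar_abelem pFq.
rewrite /pgroup.pgroup finset.cardsT => pq _ _.
have cFq : [pchar L].-nat #|Fq| by rewrite (eq_pnat _ (pcharf_eq pL)).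
move=> x y; apply/eqP; rewrite eq_sym subr_eq /frob.
by rewrite -exprDn_pchar // subrK.
Qed.
Fact frob_is_monoid_morphism : monoid_morphism (frob psi).
Proof. by split=> [|x y]; rewrite /frob ?expr1n ?exprMn. Qed.
HB.instance Definition _ := GRing.isZmodMorphism.Build L L (frob psi)
  frob_is_zmod_morphism.
HB.instance Definition _ := GRing.isMonoidMorphism.Build L L (frob psi)
  frob_is_monoid_morphism.

Lemma frob_cst a : frob psi (psi a) = psi a.
Proof. by rewrite /frob -rmorphXn /= expf_card. Qed.

End Frobenius.

Section BaseChange.
Variables (Fq : finFieldType) (C : curve Fq).
Variables (L : fieldType) (psi : {rmorphism Fq -> L}).

Local Notation A := (coord_ring C).
Local Notation K := (ffield C).

Definition AL : comPzRingType := tring (cstA C) psi.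

(* sigma^* : a (x) b |-> a (x) b^q *)
Definition sigma : {rmorphism AL -> AL} :=
  @tring_map Fq A L A L (cstA C) psi (cstA C) psi idfun (frob psi)
    (fun=> erefl) (@frob_cst Fq L psi).

Definition iotaA : {rmorphism A -> AL} := @tinl Fq A L (cstA C) psi.
Definition iotaL : {rmorphism L -> AL} := @tinr Fq A L (cstA C) psi.

(* sigma^* M = M (x)_{AL, sigma} AL *)
Definition sigma_pull (M : lmodType AL) : lmodType AL :=
  tens sigma (AL^o : lmodType AL) M.

Definition sigma_pull_map (M M' : lmodType AL) (f : M -> M') :
    sigma_pull M -> sigma_pull M' :=
  tens_map (phi := sigma) sigma (M := AL^o) (M' := AL^o) idfun f.

(* K (x) L, an integral domain whose fraction field is the function field of
   C_L *)
Definition KL : Type := tring (cst C) psi.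
HB.instance Definition _ := GRing.ComPzRing.on KL.

Fact KL_oner_neq0 : 1 != 0 :> KL.
Proof. by have [] := @curve_geom_integral Fq C L psi. Qed.
HB.instance Definition _ := GRing.PzSemiRing_isNonZero.Build KL KL_oner_neq0.

Definition KL_unit : {pred KL} := fun x => `[< exists y : KL, y * x = 1 >].
Definition KL_inv (x : KL) : KL := xget x [set y | y * x = 1].

Fact KL_mulVr : {in KL_unit, left_inverse 1 KL_inv *%R}.
Proof.
move=> x /asboolP ex; rewrite /KL_inv; case: xgetP => // nex.
by case: ex => y /nex.
Qed.
Fact KL_unitP (x y : KL) : y * x = 1 -> KL_unit x.
Proof. by move=> yx; apply/asboolP; exists y. Qed.
Fact KL_invr_out : {in [predC KL_unit], KL_inv =1 id}.
Proof.
move=> x /negP nux; rewrite /KL_inv; case: xgetP => // y _ yx.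
by case: nux; exact: KL_unitP yx.
Qed.
HB.instance Definition _ := GRing.ComNzRing_hasMulInverse.Build KL
  KL_mulVr KL_unitP KL_invr_out.

Fact KL_integral (x y : KL) : x * y = 0 -> (x == 0) || (y == 0).
Proof.
have [_ H] := @curve_geom_integral Fq C L psi.
by case/H=> ->; rewrite eqxx ?orbT.
Qed.
HB.instance Definition _ := GRing.ComUnitRing_isIntegral.Build KL KL_integral.

Definition QL : fieldType := {fraction KL}.

Definition iotaAK : {rmorphism AL -> KL} :=
  @tring_map Fq A L K L (cstA C) psi (cst C) psi (val : A -> K) idfun
    (fun=> erefl) (fun=> erefl).
Definition iotaKQ : {rmorphism KL -> QL} := @tofrac KL.
Definition iotaQ : {rmorphism AL -> QL} := iotaKQ \o iotaAK.

(* the image of U (x) L in K (x) L, for an Fq-subspace U of K *)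
Definition tens_span (U : set K) : set KL :=
  [set z | exists (n : nat) (x : 'I_n -> K) (l : 'I_n -> L),
     (forall i, U (x i)) /\ z = \sum_i tmono (cst C) psi (x i) (l i)].

(* The local ring of C_L at infty: the localization of O_{C,infty} (x) L at the
   prime ideal m_{C,infty} (x) L. *)
Definition OL_infty : set QL :=
  [set z | exists b s : KL,
     [/\ tens_span (infty C) b, tens_span (infty C) s,
         ~ tens_span (place_max (infty C)) s & z = iotaKQ b / iotaKQ s]].

(* the stalk of M at the generic point of C_L *)
Definition generic_stalk (M : lmodType AL) : lmodType QL :=
  tens iotaQ (QL^o : lmodType QL) M.

Definition to_generic (M : lmodType AL) (m : M) : generic_stalk M :=
  tpure iotaQ (1 : QL^o) m.

Definition OL_span (V : lmodType QL) (r : nat) (e : 'I_r -> V) : set V :=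
  [set v | exists a : 'I_r -> QL,
     (forall i, OL_infty (a i)) /\ v = \sum_i a i *: e i].

(* A linear map sigma^* M -> M is given by the sigma-semilinear map
   m |-> tau (1 (x) m) on M; [T] is its extension to the generic stalk. *)
Definition generic_extension (M : lmodType AL)
    (tau : {linear sigma_pull M -> M})
    (T : generic_stalk M -> generic_stalk M) : Prop :=
  [/\ forall u v, T (u + v) = T u + T v,
      forall (a : AL) v, T (iotaQ a *: v) = iotaQ (sigma a) *: T v &
      forall m, T (to_generic m) = to_generic (tau (tpure sigma (1 : AL^o) m))].

(* An extension of the locally free sheaf M from Spec A_L to a locally free
   sheaf of rank r on C_L amounts to its stalk at infty, a free OL_infty-module
   of rank r spanning the generic stalk; e is a basis of it.  The stalk at
   infty of its twist by k.infty is t^(-k) times it, t a uniformizer at infty.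
   The map tau^l corresponds to the l-th iterate of the semilinear map T, and
   (sigma^* )^l of the stalk has the basis (sigma^* )^l e, whose images are the
   T^l (e i); a surjection between free modules of the same rank is bijective.
   *)
Definition pure (M : lmodType AL) (tau : {linear sigma_pull M -> M})
    (r : nat) : Prop :=
  exists (T : generic_stalk M -> generic_stalk M)
         (e : 'I_r -> generic_stalk M) (t : K) (k l : nat),
    [/\ generic_extension tau T, is_basis e, uniformizer (infty C) t,
        (0 < k)%N /\ (0 < l)%N &
        OL_span (fun i => iter l T (e i)) =
        [set v | OL_span e (iotaKQ (tmono (cst C) psi (t ^+ k) 1) *: v)]].

Variable (c : {rmorphism A -> L}).

Definition char_ideal : ideal AL :=
  span [set z : AL^o | exists a : A, z = iotaA a - iotaL (c a)].

End BaseChange.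

Section Motives.
Variables (Fq : finFieldType) (C : curve Fq).
Variables (L : fieldType) (psi : {rmorphism Fq -> L}).
Variable c : {rmorphism coord_ring C -> L}.

Local Notation A := (coord_ring C).
Local Notation AL := (AL C psi).

Record pure_motive (r d : nat) := PureMotive {
  mot_mod : lmodType AL;
  mot_tau : {linear sigma_pull mot_mod -> mot_mod};
  mot_locally_free : locally_free mot_mod r;
  mot_tau_inj : injective mot_tau;
  mot_coker_dim : has_dim (res (iotaL C psi) (coker mot_tau)) d;
  mot_coker_char : annihilates (ideal_exp (char_ideal psi c) d) (coker mot_tau);
  mot_pure : pure mot_tau r
}.

Section Isogeny.
Variables (r d r' d' : nat) (M : pure_motive r d) (M' : pure_motive r' d').
Variable f : {linear mot_mod M -> mot_mod M'}.

Definition motive_morphism : Prop :=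
  forall x : sigma_pull (mot_mod M),
    f (mot_tau M x) = mot_tau M' (sigma_pull_map f x).

Definition isogeny : Prop :=
  [/\ motive_morphism, injective f & torsion_module (coker f)].

(* K_v = coker f (x)_A A_v *)
Definition coker_at (v : ideal A) : lmodType AL :=
  tens (iotaA C psi) (coker f) (completion v).

Definition coker_dim_at (v : ideal A) : nat :=
  dimension (res (iotaL C psi) (coker_at v)).

(* [F_v : F_q] *)
Definition residue_degree (v : ideal A) : nat :=
  dimension (res (cstA C) (qmod v)).

(* The product ranges over the v for which the factor is not the unit ideal;
   for an isogeny these are finitely many, and the division is exact. *)
Definition degree : ideal A :=
  \big[@ideal_mul A / smodT]_(v \in [set v | maximal_ideal v])
    ideal_exp v (coker_dim_at v %/ residue_degree v).

End Isogeny.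
End Motives.

(* Main.v *)
(* Write K = coker f = M'/f(M), a finite-dimensional L-space, and filter it by the
   submodules v^i K, that is, by N_i = f(M) + v^i M' in M'.  The map tau' induces
   sigma^*(N_i/N_(i+1)) -> N_i/N_(i+1), whose kernel and cokernel are killed by a
   power of t (x) 1 - 1 (x) c(t) for every t in A: for the cokernel because this
   holds for tau and tau', for the kernel because moreover tau' is injective.
   Hence the minimal polynomial mu of t on N_i/N_(i+1) and its Frobenius twist
   divide each other up to a power of X - c(t); both are monic of the same degree,
   so they agree, and mu has coefficients in Fq.

   Applied to a generator t of the residue field of v, this shows that a non-zero
   layer N_i/N_(i+1) has L-dimension at least [F_v : Fq].  As K_v maps onto K/v^i K,
   the chain v^i K is stationary from i = dim K_v / [F_v : Fq] on.  Therefore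
   D = deg f satisfies v D K = D K for all maximal v.  If D K were non-zero, the
   annihilator in A of a simple quotient of D K would be a maximal ideal, because
   every t in A is algebraic over Fq on K, and this contradicts v D K = D K.

   The finiteness statements (dim K, dim K_v, the support of deg f) come from the
   filtration of A by the order of the pole at infty: its layers have dimension at
   most 1, so multiplication by a regular element has a finite-dimensional
   cokernel. *)

Require Import Defs.
From HB Require Import structures.
From mathcomp Require Import all_boot all_order all_algebra all_field.
From mathcomp Require Import all_classical.
From mathcomp Require Import ring zify.
From mathcomp Require cyclic.
(* [span], [cst] and others are shadowed by mathcomp. *)
Import Defs.

Set Implicit Arguments.
Unset Strict Implicit.
Unset Printing Implicit Defensive.

Import GRing.Theory.
Local Open Scope classical_set_scope.
Local Open Scope ring_scope.

(** * Linear algebra modulo a submodule *)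

(** The L-dimension n of a layer does not by itself bound [F_v : Fq]: multiplication by t always
    satisfies a polynomial of degree at most n, but with coefficients in L. Once they lie in Fq, the
    value p(t) is an element of A that kills the layer, hence lies in v. Injectivity of tau' serves
    to cancel tau' in j^D tau'(y) = tau'(z), where j = t (x) 1 - 1 (x) c(t); for this, layers are
    kept as pairs of submodules of M' containing f(M), and sigma^* of a submodule as its image in
    sigma^* M'. The exponent is D = d + d', so that j^D kills both coker tau and coker tau'.
    Finiteness has to be proved because default values hide its failure: [dimension] is 0 on an
    infinite-dimensional space, and a product with infinite support is the unit ideal. For K_v this
    takes a computation in the completion, which shows that K maps onto K_v. *)

Section SubmoduleTheory.
Variables (R : comPzRingType) (M : lmodType R).
Implicit Types (N : submodule M) (S : set M).

Lemma submodule_ext N N' : (forall x, N x <-> N' x) -> N = N'.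
Proof.
case: N N' => [s s0 sD sZ] [s' s0' sD' sZ'] /= E.
have {E} E : s = s' by apply/predeqP.
by case: s' / E s0' sD' sZ' => s0' sD' sZ'; congr Submodule; exact: Prop_irrelevance.
Qed.

Lemma smodB N x y : N x -> N y -> N (x - y).
Proof. by move=> Nx Ny; apply: smodD => //; exact: smodN. Qed.

Lemma smodDr N x y : N x -> N (x + y) -> N y.
Proof. by move=> Nx Nxy; rewrite -(addKr x y) addrC; exact: smodB. Qed.

Lemma smodBr N x y : N y -> N (x - y) -> N x.
Proof. by move=> Ny Nxy; rewrite -(subrK y x); exact: smodD. Qed.

Lemma smod_sum N (I : Type) (r : seq I) (P : pred I) (u : I -> M) :
  (forall i, P i -> N (u i)) -> N (\sum_(i <- r | P i) u i).
Proof.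
by move=> Nu; elim/big_ind: _ => //; [exact: smod0 | move=> *; exact: smodD].
Qed.

Lemma span_sub S : S `<=` span S.
Proof. by move=> x Sx N; exact. Qed.

Lemma span_min S N : S `<=` N -> span S `<=` N.
Proof. by move=> SN x; exact. Qed.

Lemma span_ind S (Q : M -> Prop) :
    Q 0 -> (forall x y, Q x -> Q y -> Q (x + y)) ->
    (forall a x, Q x -> Q (a *: x)) -> (forall x, S x -> Q x) ->
  forall x, span S x -> Q x.
Proof. by move=> Q0 QD QZ SQ x /(_ (Submodule Q0 QD QZ)); apply. Qed.

Lemma qclassZ N a x : a *: qclass N x = qclass N (a *: x).
Proof. exact: qscaleE. Qed.

Lemma qclass_eq0 N x : qclass N x = 0 <-> N x.
Proof. by split=> [/(qclassP N x 0)|Nx]; [|apply/(qclassP N x 0)]; rewrite subr0. Qed.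

End SubmoduleTheory.

Section RestrictSubmodule.
Variables (R S : comPzRingType) (phi : {rmorphism R -> S}) (M : lmodType S).

Lemma res_scaleE (a : R) (x : res phi M) : a *: x = (phi a *: (x : M)) :> M.
Proof. by []. Qed.

Definition res_smod (N : submodule M) : submodule (res phi M) :=
  @Submodule R (res phi M) N (smod0 N) (@smodD _ _ N)
    (fun a x => @smodZ _ _ N (phi a) x).

End RestrictSubmodule.

Section RelativeLinearAlgebra.
Variables (F : fieldType) (V : lmodType F).
Implicit Types (N P : submodule V) (I J : finType).

Definition indep_mod N I (u : I -> V) :=
  forall a : I -> F, N (\sum_i a i *: u i) -> forall i, a i = 0.

Definition in_span_mod N I (u : I -> V) (x : V) :=
  exists a : I -> F, N (x - \sum_i a i *: u i).

Definition spans_mod N I (u : I -> V) := forall x, in_span_mod N u x.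

Definition basis_mod N P I (u : I -> V) :=
  [/\ forall i, P (u i), indep_mod N u & forall x, P x -> in_span_mod N u x].

Definition sum_fam (T I J : Type) (u : I -> T) (w : J -> T) (k : I + J) : T :=
  match k with inl i => u i | inr j => w j end.

Lemma big_sum_fam I J (u : I -> V) (w : J -> V) (a : I + J -> F) :
  \sum_k a k *: sum_fam u w k =
  \sum_i a (inl i) *: u i + \sum_j a (inr j) *: w j.
Proof. by rewrite big_sumType. Qed.

Lemma sum_void (u : void -> V) : \sum_i u i = 0.
Proof. by rewrite big1 // => -[]. Qed.

Lemma sum_unit (u : unit -> V) : \sum_i u i = u tt.
Proof. by rewrite (big_pred1 tt) // => -[]. Qed.

Lemma in_span_mod0 N I (u : I -> V) x : N x -> in_span_mod N u x.
Proof.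
by move=> Nx; exists (fun=> 0); rewrite big1 ?subr0 // => i _; rewrite scale0r.
Qed.

Lemma in_span_modD N I (u : I -> V) x y :
  in_span_mod N u x -> in_span_mod N u y -> in_span_mod N u (x + y).
Proof.
move=> [a Na] [b Nb]; exists (fun i => a i + b i).
under eq_bigr do rewrite scalerDl.
by rewrite big_split opprD addrACA; exact: smodD.
Qed.

Lemma in_span_modZ N I (u : I -> V) c x :
  in_span_mod N u x -> in_span_mod N u (c *: x).
Proof.
move=> [a Na]; exists (fun i => c * a i).
under eq_bigr do rewrite -scalerA.
by rewrite -scaler_sumr -scalerBr; exact: smodZ.
Qed.

Lemma in_span_mod_fam N I (u : I -> V) i : in_span_mod N u (u i).
Proof.
exists (fun j => (j == i)%:R); rewrite (bigD1 i) //= eqxx scale1r big1 => [|j].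
  by rewrite addr0 subrr; exact: smod0.
by move=> /negPf ->; rewrite scale0r.
Qed.

Definition span_mod N I (u : I -> V) : submodule V :=
  Submodule (in_span_mod0 u (smod0 N)) (@in_span_modD N I u)
    (@in_span_modZ N I u).

Lemma spans_mod_sub N P I (u : I -> V) :
  N `<=` P -> spans_mod N u -> spans_mod P u.
Proof. by move=> NP su x; have [a /NP Pa] := su x; exists a. Qed.

(** If |J| > |I|, the matrix of coordinates of the [u j] in [w] has a non-zero left kernel vector,
    which is a relation between the [u j] modulo [N]. *)
Lemma steinitz N I J (w : I -> V) (u : J -> V) :
  indep_mod N u -> (forall j, in_span_mod N w (u j)) -> (#|J| <= #|I|)%N.
Proof.
move=> iu /choice[U NU].
pose A : 'M[F]_(#|J|, #|I|) := \matrix_(j, i) U (enum_val j) (enum_val i).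
rewrite leqNgt; apply/negP => IJ.
have /rowV0Pn[x /sub_kermxP xA x0] : kermx A != 0.
  rewrite -mxrank_eq0 mxrank_ker -lt0n subn_gt0.
  exact: leq_ltn_trans (rank_leq_col _) IJ.
suff: forall j, x 0 (enum_rank j) = 0.
  by move=> E; case/eqP: x0; apply/rowP => j; rewrite mxE -(enum_valK j) E.
apply: (iu (fun j => x 0 (enum_rank j))).
suff E : \sum_j x 0 (enum_rank j) *: (\sum_i U j i *: w i) = 0.
  apply: (@smodBr _ _ N _ (\sum_j x 0 (enum_rank j) *: \sum_i U j i *: w i)).
    by rewrite E; exact: smod0.
  rewrite -sumrB; apply: smod_sum => j _.
  by rewrite -scalerBr; exact: smodZ.
under eq_bigr do rewrite scaler_sumr.
rewrite exchange_big big1 //= => i _.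
under eq_bigr do rewrite scalerA.
rewrite -scaler_suml.
have /rowP/(_ (enum_rank i)) := xA; rewrite !mxE => Ei.
rewrite (reindex (fun j : 'I_#|J| => enum_val j)) /=; last first.
  by apply: onW_bij; exact: enum_val_bij.
suff -> : \sum_(j < #|J|) x 0 (enum_rank (enum_val j)) * U (enum_val j) i = 0.
  by rewrite scale0r.
by rewrite -[RHS]Ei; apply: eq_bigr => j _; rewrite !mxE enum_valK enum_rankK.
Qed.

Lemma indep_mod_reindex N I J (h : J -> I) (u : I -> V) :
  bijective h -> indep_mod N u -> indep_mod N (u \o h).
Proof.
move=> [g hK gK] iu a Na j; rewrite -(hK j).
apply: (iu (a \o g)); rewrite (reindex h) /=; last by exists g => ? _.
by under eq_bigr do rewrite hK.
Qed.

Lemma in_span_mod_reindex N I J (h : J -> I) (u : I -> V) x :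
  bijective h -> in_span_mod N u x -> in_span_mod N (u \o h) x.
Proof.
move=> [g hK gK] [a Na]; exists (a \o h).
by rewrite (reindex h) /= in Na; last by exists g => ? _.
Qed.

Lemma basis_mod_reindex N P I J (h : J -> I) (u : I -> V) :
  bijective h -> basis_mod N P u -> basis_mod N P (u \o h).
Proof.
move=> bh [Pu iu su]; split=> [j||x /su]; first exact: Pu.
- exact: indep_mod_reindex.
- exact: in_span_mod_reindex.
Qed.

Lemma indep_mod_add N P I J (u : I -> V) (w : J -> V) :
    (forall j, P (w j)) -> indep_mod N w -> N `<=` P -> indep_mod P u ->
  indep_mod N (sum_fam u w).
Proof.
move=> Pw iw NP iu a; rewrite big_sum_fam => Na.
have a0 i : a (inl i) = 0.
  apply: (iu (a \o inl)) => /=.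
  apply: (@smodDr _ _ P (\sum_j a (inr j) *: w j)).
    by apply: smod_sum => j _; exact: smodZ.
  by rewrite addrC; exact: NP.
case=> // j; apply: (iw (a \o inr)) => /=.
by move: Na; rewrite big1 ?add0r // => i _; rewrite a0 scale0r.
Qed.

(** A vector of [P] outside the span modulo [N] can be added to [u]; by [steinitz] this happens at
    most [#|I| - #|J|] times, and [z] collects the added vectors. *)
Lemma basis_mod_ext N P I J (w : I -> V) (u : J -> V) :
    (forall x, P x -> in_span_mod N w x) -> (forall j, P (u j)) -> indep_mod N u ->
  exists (K : finType) (z : K -> V), basis_mod N P (sum_fam u z).
Proof.
move=> sw; have [m] := ubnP (#|I| - #|J|).
elim: m J u => // m IHm J u le_m Pu iu.
have [su|] := pselect (forall x, P x -> in_span_mod N u x).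
  exists void, (of_void V); split=> [[//|[]]||x /su[a Na]].
    move=> a; rewrite big_sum_fam sum_void addr0.
    by move=> Na [|[]] j; exact: (iu (a \o inl)).
  exists (sum_fam a (of_void F)).
  by rewrite big_sum_fam sum_void addr0.
move=> /existsNP[x /not_implyP[Px nx]].
have iux : indep_mod N (sum_fam u (fun _ : unit => x)).
  move=> a; rewrite big_sum_fam sum_unit /= => Na.
  have ax : a (inr tt) = 0.
    apply: contra_notP nx => /eqP ax0.
    exists (fun j => - (a (inr tt))^-1 * a (inl j)).
    under eq_bigr do rewrite -scalerA.
    rewrite -scaler_sumr scaleNr opprK -{1}[x](scalerK ax0) -scalerDr addrC.
    exact: smodZ.
  case=> [j|[]] //; apply: (iu (a \o inl)) => /=.
  by rewrite ax scale0r addr0 in Na.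
have [|[j|[]]||K [z [Pz iz sz]]] := IHm _ (sum_fam u (fun _ : unit => x)) => //=.
  have := steinitz iux (fun k => sw _ (_ : P (sum_fam u (fun=> x) k))).
  rewrite card_sum card_unit addn1 => /(_ _)-JI; rewrite subnS.
  have {}JI : (#|J| < #|I|)%N by apply: JI => -[].
  by rewrite -ltnS prednK ?subn_gt0.
pose h (k : J + (unit + K)) : J + unit + K :=
  match k with inl j => inl (inl j) | inr (inl i) => inl (inr i)
  | inr (inr k) => inr k end.
exists (unit + K)%type, (sum_fam (fun=> x) z).
have -> : sum_fam u (sum_fam (fun=> x) z) =
          sum_fam (sum_fam u (fun=> x)) z \o h by apply/funext; case=> // -[].
apply: basis_mod_reindex; last by [].
exists (fun k : J + unit + K => match k with inl (inl j) => inl j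
  | inl (inr i) => inr (inl i) | inr k => inr (inr k) end); by do ?case.
Qed.

Lemma basis_mod_exists N P I (w : I -> V) :
    (forall x, P x -> in_span_mod N w x) ->
  exists n (u : 'I_n -> V), basis_mod N P u.
Proof.
move=> sw; have [||K [z bz]] := @basis_mod_ext N P I void w (of_void V) sw.
- by case.
- by move=> a _ [].
exists #|{: void + K}|, (sum_fam (of_void V) z \o enum_val).
by apply: basis_mod_reindex bz; exact: enum_val_bij.
Qed.

(** A coordinate of a basis of [V] modulo [N] extending [u]. Being defined on all of [V], it is
    linear without side conditions. *)
Lemma dual_functional N I J (w : I -> V) (u : J -> V) (j : J) :
    spans_mod N w -> indep_mod N u ->
  exists f : V -> F, [/\ forall x y, f (x + y) = f x + f y,
    forall a x, f (a *: x) = a * f x, forall x, N x -> f x = 0 &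
    forall i, f (u i) = (i == j)%:R].
Proof.
move=> sw iu.
have [//|K [z [_ ib sb]]] :=
  @basis_mod_ext N smodT I J w u (fun x _ => sw x) _ iu.
have /choice[c Hc] : forall x, exists a : J + K -> F,
    N (x - \sum_k a k *: sum_fam u z k) by move=> x; exact: sb.
have c_uniq x (a : J + K -> F) :
    N (x - \sum_k a k *: sum_fam u z k) -> forall k, c x k = a k.
  move=> Na k; apply/eqP; rewrite -subr_eq0; apply/eqP.
  apply: (ib (fun k => c x k - a k)).
  under eq_bigr do rewrite scalerBl.
  rewrite sumrB -(subrKA x) addrC -opprB.
  by apply: smodB => //; rewrite -opprB opprK; apply: smodN.
exists (fun x => c x (inl j)); split=> [x y|a x|x Nx|i].
- apply: (c_uniq (x + y) (fun k => c x k + c y k)).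
  under eq_bigr do rewrite scalerDl.
  by rewrite big_split opprD addrACA; exact: smodD.
- apply: (c_uniq (a *: x) (fun k => a * c x k)).
  under eq_bigr do rewrite -scalerA.
  by rewrite -scaler_sumr -scalerBr; exact: smodZ.
- apply: (c_uniq x (fun=> 0)).
  by rewrite big1 ?subr0 // => k _; rewrite scale0r.
- rewrite (c_uniq (u i) (fun k => (k == inl i)%:R)) //; first by rewrite eq_sym.
  rewrite (bigD1 (inl i)) //= eqxx scale1r big1 => [|k /negPf ->].
    by rewrite addr0 subrr; exact: smod0.
  by rewrite scale0r.
Qed.

Lemma spans_of_indep_bound N k :
    (forall J (u : J -> V), indep_mod N u -> (#|J| <= k)%N) ->
  exists n (w : 'I_n -> V), spans_mod N w.
Proof.
move=> bound; apply: contrapT => /forallNP nspan.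
suff ind m : exists (u : 'I_m -> V), indep_mod N u.
  have [u /bound] := ind k.+1; by rewrite card_ord ltnn.
elim: m => [|m [u iu]]; first by exists (fun=> 0) => a _ [].
have [x nx] : exists x, ~ in_span_mod N u x.
  by apply: contrapT => /forallNP sx; apply: (nspan m); exists u => x; apply: contrapT.
exists (fun i => oapp u x (unlift ord0 i)) => a.
rewrite big_ord_recl /= unlift_none /=.
under eq_bigr => i _ do rewrite liftK /=.
move=> Na; have ax : a ord0 = 0.
  apply: contra_notP nx => /eqP ax0.
  exists (fun j => - (a ord0)^-1 * a (lift ord0 j)).
  under eq_bigr do rewrite -scalerA.
  rewrite -scaler_sumr scaleNr opprK -{1}[x](scalerK ax0) -scalerDr.
  exact: smodZ.
move=> i; case: (unliftP ord0 i) => [j|] ->; last exact: ax.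
by apply: (iu (a \o lift ord0)) => /=; rewrite ax scale0r add0r in Na.
Qed.

End RelativeLinearAlgebra.

(** * Places of a function field *)

Section Chevalley.
Variables (Fq : finFieldType) (K : fieldType) (cst : {rmorphism Fq -> K}).
Variable u : K.
Implicit Types (B : set K) (p q : {poly K}).

Let good B := [/\ forall a, B (cst a), B u, forall x y, B x -> B y -> B (x - y),
  forall x y, B x -> B y -> B (x * y) & forall b, B b -> u * b <> 1].

Section GoodRing.
Variables (B : set K).
Hypothesis gB : good B.

Let B0 : B 0. Proof. by have [Bc _ _ _ _] := gB; rewrite -(rmorph0 cst). Qed.
Let B1 : B 1. Proof. by have [Bc _ _ _ _] := gB; rewrite -(rmorph1 cst). Qed.
Let BB x y : B x -> B y -> B (x - y).
Proof. by have [_ _ BB _ _] := gB; exact: BB. Qed.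
Let BM x y : B x -> B y -> B (x * y).
Proof. by have [_ _ _ BM _] := gB; exact: BM. Qed.
Let BD x y : B x -> B y -> B (x + y).
Proof. by move=> Bx By; rewrite -(opprK y) -(sub0r y); do !apply: BB. Qed.
Let BX x n : B x -> B (x ^+ n).
Proof. by move=> Bx; elim: n => // n IH; rewrite exprS; exact: BM. Qed.
Let Bsum (I : Type) (r : seq I) (P : pred I) (f : I -> K) :
  (forall i, P i -> B (f i)) -> B (\sum_(i <- r | P i) f i).
Proof. by move=> Bf; elim/big_ind: _. Qed.

Definition adjoin_set x : set K :=
  [set y | exists p, (forall i, B p`_i) /\ y = p.[x]].

Lemma good_adjoin x : (forall p, (forall i, B p`_i) -> u * p.[x] <> 1) ->
  good (adjoin_set x).
Proof.
have [Bc Bu _ _ _] := gB.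
have BC a : B a -> forall i, B (a%:P)`_i by move=> Ba [|i]; rewrite coefC.
move=> npx; split=> [a||y z [p [Bp ->]] [q [Bq ->]]|y z [p [Bp ->]] [q [Bq ->]]|].
- by exists (cst a)%:P; rewrite hornerC; split=> //; exact: BC.
- by exists u%:P; rewrite hornerC; split=> //; exact: BC.
- by exists (p - q); rewrite hornerD hornerN; split=> // i; rewrite coefB; exact: BB.
- exists (p * q); rewrite hornerM; split=> // i; rewrite coefM.
  by apply: Bsum => j _; exact: BM.
- by move=> _ [p [Bp ->]]; exact: npx.
Qed.

Hypothesis maxB : forall B', good B' -> B `<=` B' -> B' `<=` B.

(** By maximality [B[x]] is not good, which can only be because [u] becomes invertible in it. *)
Lemma max_adjoin x : ~ B x -> exists p, (forall i, B p`_i) /\ u * p.[x] = 1.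
Proof.
move=> nBx; apply: contrapT => /forallNP npx; apply: nBx.
apply: (maxB (B' := adjoin_set x)) => [|b Bb|].
- by apply: good_adjoin => p Bp px; exact: (npx p).
- by exists b%:P; rewrite hornerC; split=> // -[|i]; rewrite coefC.
- exists 'X; rewrite hornerX; split=> // i.
  by rewrite coefX; case: eqP.
Qed.

(** [u] lies in the Jacobson radical of [B]: if s = 1 - u a were not a unit, [max_adjoin] would give
    u p(s^-1) = 1; multiplied by a power of [s], which is 1 modulo [u], this would make [u]
    invertible in [B]. *)
Lemma max_good_unit a : B a -> B (1 - u * a)^-1.
Proof.
have [_ Bu _ _ nB1] := gB.
move=> Ba; set s := 1 - u * a; apply: contrapT => /max_adjoin[p [Bp up]].
have Bs : B s by apply: BB => //; exact: BM.
have s0 : s != 0.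
  by apply/negP; rewrite subr_eq0 eq_sym => /eqP; exact: nB1.
have [c [Bc Ec]] : exists c, B c /\ s ^+ size p = 1 - u * c.
  elim: (size p) => [|n [c [Bc Ec]]]; first by exists 0; rewrite mulr0 subr0.
  exists (a + c - u * a * c); split; first by do ?[apply: BB|apply: BM|apply: BD].
  by rewrite exprS Ec /s; ring.
apply: (nB1 (c + \sum_(i < size p) p`_i * s ^+ (size p - i))).
  by apply: BD => //; apply: Bsum => i _; apply: BM => //; exact: BX.
rewrite mulrDr; suff -> : u * (\sum_(i < size p) p`_i * s ^+ (size p - i)) = 1 - u * c.
  by rewrite addrC subrK.
rewrite -Ec -[RHS]mul1r -up -mulrA horner_coef; congr (_ * _).
rewrite mulr_suml; apply: eq_bigr => i _.
by rewrite -mulrA exprVn [_^-1 * _]mulrC -expfB_cond ?(negPf s0) //= ?add0n ltnW.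
Qed.

(** Suppose u p(y) = 1 and u q(y^-1) = 1 with p, q over [B]. The second relation times y^n expresses
    y^n through lower powers, since 1 - u q_0 is a unit of [B]; this lowers the degree of p if deg q
    <= deg p. Exchanging y and y^-1 ensures that inequality. *)
Lemma max_good_valuation x : B x \/ B x^-1.
Proof.
have [_ Bu _ _ nB1] := gB.
suff key N : forall y p q, (size p + size q <= N)%N -> y != 0 ->
    (forall i, B p`_i) -> (forall i, B q`_i) ->
    u * p.[y] = 1 -> u * q.[y^-1] <> 1.
  have [->|x0] := eqVneq x 0; first by left.
  apply: contrapT => /not_orP[/max_adjoin[p [Bp px]] /max_adjoin[q [Bq qx]]].
  exact: (key _ x p q).
elim: N => [|N IH] y p q szN y0 Bp Bq py qy.
  move: szN; rewrite leqn0 addn_eq0 size_poly_eq0 => /andP[/eqP p0 _].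
  by move/eqP: py; rewrite p0 horner0 mulr0 eq_sym oner_eq0.
wlog qp : y p q szN y0 Bp Bq py qy / (size q <= size p)%N.
  move=> wlg; have [|/ltnW pq] := leqP (size q) (size p); first exact: (wlg y p q).
  by apply: (wlg y^-1 q p) => //; rewrite ?invrK ?invr_eq0 1?addnC.
case Ep : (size p) => [|n].
  move/eqP: Ep; rewrite size_poly_eq0 => /eqP p0.
  by move/eqP: py; rewrite p0 horner0 mulr0 eq_sym oner_eq0.
set s := 1 - u * q`_0; have Bs : B s^-1 by exact: max_good_unit.
have s0 : s != 0.
  by apply/negP; rewrite subr_eq0 eq_sym => /eqP; exact: nB1.
have Eq : y ^+ n = u * s^-1 * \sum_(j < n) q`_(n - j) * y ^+ j.
  have : y ^+ n = u * \sum_(i < n.+1) q`_i * y ^+ (n - i).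
    rewrite -[LHS]mul1r -qy -mulrA; congr (_ * _).
    rewrite (@horner_coef_wide _ n.+1) -?Ep // mulr_suml Ep.
    apply: eq_bigr => i _; rewrite -mulrA exprVn [_^-1 * _]mulrC -expfB_cond //.
    by rewrite (negPf y0) add0n -ltnS.
  rewrite big_ord_recl subn0 mulrDr mulrA => /eqP.
  rewrite addrC -subr_eq -{1}[y ^+ n]mul1r -mulrBl -/s => /eqP Es.
  apply: (mulfI s0); rewrite Es mulrA mulrCA mulfV // mulr1; congr (_ * _).
  rewrite (reindex_inj rev_ord_inj) /=; apply: eq_bigr => i _.
  by rewrite /bump /= add1n subnSK ?subnS // subKn // ltnW.
pose p' := \poly_(j < n) (p`_j + p`_n * (u * s^-1) * q`_(n - j)).
apply: (IH y p' q) => //.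
- rewrite -ltnS; apply: leq_trans szN.
  by rewrite Ep addSn ltnS leq_add2r; exact: size_poly.
- move=> i; rewrite coef_poly; case: ifP => // _.
  by apply: BD => //; do !apply: BM.
rewrite -py; congr (_ * _).
rewrite horner_poly (@horner_coef_wide _ n.+1) ?Ep // big_ord_recr /=.
rewrite [X in _ = _ + _ * X]Eq.
under eq_bigr do rewrite mulrDl.
rewrite big_split /=; congr (_ + _).
rewrite mulrA mulr_sumr.
by apply: eq_bigr => j _; rewrite !mulrA.
Qed.

End GoodRing.

(* Chevalley's extension theorem: a proper ideal u Fq[u] is dominated by a
   valuation ring, a maximal subring in which u is not invertible. *)
Lemma place_avoiding (z : K) : z * u = 1 ->
    (forall p : {poly Fq}, u * (map_poly cst p).[u] <> 1) ->
  exists O, place cst O /\ ~ O z.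
Proof.
move=> zu npu.
pose P B := B = set0 \/ good B.
have goodP B : P B -> B !=set0 -> good B by case=> // -> [].
have [|A [PA maxA]] := @Zorn_bigcup K P.
  move=> F FP totF.
  have [[B0 FB0 B0n0]|nF] := pselect (exists2 B, F B & B !=set0); last first.
    left; apply/seteqP; split=> // x [B FB Bx].
    by case: nF; exists B => //; exists x.
  right; have gF B x : F B -> B x -> good B.
    by move=> FB Bx; apply: goodP; [exact: FP | exists x].
  have [Bc Bu _ _ _] : good B0 by apply: goodP => //; exact: FP.
  have two x y : (\bigcup_(X in F) X) x -> (\bigcup_(X in F) X) y ->
      exists B, [/\ F B, B x, B y & good B].
    move=> [B FB Bx] [B' FB' B'y].
    have [BB'|B'B] := totF _ _ FB FB'.
      by exists B'; split=> //; [exact: BB' | exact: gF B'y].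
    by exists B; split=> //; [exact: B'B | exact: gF Bx].
  split=> [a||x y Fx Fy|x y Fx Fy|b [B FB Bb]].
  - by exists B0.
  - by exists B0.
  - have [B [FB Bx By [_ _ BB _ _]]] := two _ _ Fx Fy.
    by exists B => //; exact: BB.
  - have [B [FB Bx By [_ _ _ BM _]]] := two _ _ Fx Fy.
    by exists B => //; exact: BM.
  - by have [_ _ _ _] := gF _ _ FB Bb; exact.
pose B0 : set K := [set y | exists p : {poly Fq}, y = (map_poly cst p).[u]].
have gB0 : good B0.
  split=> [a||_ _ [p ->] [q ->]|_ _ [p ->] [q ->]|_ [p ->]].
  - by exists a%:P; rewrite map_polyC hornerC.
  - by exists 'X; rewrite map_polyX hornerX.
  - by exists (p - q); rewrite rmorphB hornerD hornerN.
  - by exists (p * q); rewrite rmorphM hornerM.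
  - exact: npu.
have gA : good A.
  apply: goodP => //; apply/set0P/eqP => A0.
  apply: (maxA B0); last by right.
  by rewrite A0; split=> // /(_ u); apply; have [] := gB0.
have mA B' : good B' -> A `<=` B' -> B' `<=` A.
  move=> gB' AB'; apply: contrapT => nB'A.
  by apply: (maxA B'); [split | right].
have nAz : ~ A z.
  by have [_ _ _ _ nA1] := gA; move/nA1; rewrite mulrC.
exists A; split=> //; have [Ac _ AB AM _] := gA.
by split=> //; [exact: max_good_valuation | exists z].
Qed.

End Chevalley.

(** * Units and maximal ideal of a place *)

Section Valuation.
Variables (Fq : finFieldType) (K : fieldType) (cst : {rmorphism Fq -> K}).
Variables (O : set K).
Hypothesis plO : place cst O.

Local Notation m := (place_max O).

Lemma place0 : O 0. Proof. by rewrite -(rmorph0 cst); exact: place_cst. Qed.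
Lemma place1 : O 1. Proof. by rewrite -(rmorph1 cst); exact: place_cst. Qed.
Lemma placeN x : O x -> O (- x).
Proof. by move=> Ox; rewrite -sub0r; apply: (placeB plO) => //; exact: place0. Qed.
Lemma placeD x y : O x -> O y -> O (x + y).
Proof. by move=> Ox Oy; rewrite -(opprK y); apply/(placeB plO)/placeN. Qed.
Lemma placeX x n : O x -> O (x ^+ n).
Proof.
move=> Ox; elim: n => [|n IH]; first exact: place1.
by rewrite exprS; exact: (placeM plO).
Qed.
Lemma place_sum (I : Type) (r : seq I) (P : pred I) (f : I -> K) :
  (forall i, P i -> O (f i)) -> O (\sum_(i <- r | P i) f i).
Proof. by move=> Of; elim/big_ind: _ => //; [exact: place0|exact: placeD]. Qed.

Definition place_unit (w : K) := [/\ w != 0, O w & O w^-1].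

Lemma place_unitV w : place_unit w -> place_unit w^-1.
Proof. by case=> w0 Ow Ow'; split; rewrite ?invr_eq0 ?invrK. Qed.

Lemma place_unitM w z : place_unit w -> place_unit z -> place_unit (w * z).
Proof.
case=> w0 Ow Ow' [z0 Oz Oz']; split; first by rewrite mulf_neq0.
  exact: (placeM plO).
by rewrite invfM; exact: (placeM plO).
Qed.

Lemma place_unitX w n : place_unit w -> place_unit (w ^+ n).
Proof.
by case=> w0 Ow Ow'; split; rewrite ?expf_neq0 -?exprVn //; exact: placeX.
Qed.

Lemma place_unitP w : O w -> ~ m w -> place_unit w.
Proof.
move=> Ow nmw; have w0 : w != 0 by apply/eqP => w0; apply: nmw; split; [|left].
split=> //; apply: contrapT => nOw; apply: nmw; split=> //; by right.
Qed.

Lemma place_unit_notin_max w : place_unit w -> ~ m w.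
Proof. by case=> w0 _ Ow' [_ [/eqP|//]]; rewrite (negPf w0). Qed.

Lemma place_max0 : m 0. Proof. by split; [exact: place0 | left]. Qed.

Lemma place_maxM x y : O x -> m y -> m (x * y).
Proof.
move=> Ox [Oy [->|nOy]]; first by rewrite mulr0; exact: place_max0.
split; first exact: (placeM plO).
have [->|x0] := eqVneq x 0; first by left; rewrite mul0r.
right; rewrite invfM => Oxy; apply: nOy.
by rewrite -(mulVKf x0 y^-1); exact: (placeM plO).
Qed.

Lemma place_maxD x y : m x -> m y -> m (x + y).
Proof.
move=> mx my; have [->|x0] := eqVneq x 0; first by rewrite add0r.
have [->|y0] := eqVneq y 0; first by rewrite addr0.
have [Ox _] := mx; have [Oy _] := my.
have [Oxy|] := placeV plO (x / y).
  have -> : x + y = (x / y + 1) * y by rewrite mulrDl divfK ?mul1r.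
  apply: place_maxM => //.
  by apply: placeD => //; exact: place1.
rewrite invf_div => Oyx.
have -> : x + y = (1 + y / x) * x by rewrite mulrDl divfK ?mul1r.
by apply: place_maxM => //; apply: placeD => //; exact: place1.
Qed.

Lemma place_maxN x : m x -> m (- x).
Proof.
by move=> mx; rewrite -mulN1r; apply: place_maxM => //; apply/placeN/place1.
Qed.

Lemma place_max_sum (I : Type) (r : seq I) (P : pred I) (f : I -> K) :
  (forall i, P i -> m (f i)) -> m (\sum_(i <- r | P i) f i).
Proof.
by move=> Of; elim/big_ind: _ => //; [exact: place_max0|exact: place_maxD].
Qed.

Lemma place_maxV x : ~ O x -> m x^-1.
Proof.
move=> nOx; have [//|Ox'] := placeV plO x.
by split=> //; right; rewrite invrK.
Qed.

Lemma place_unitD w x : place_unit w -> m x -> place_unit (w + x).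
Proof.
move=> uw mx; apply: place_unitP.
  by apply: placeD; [case: uw | case: mx].
move=> mwx; apply: (place_unit_notin_max uw).
by rewrite -(addrK x w); apply: place_maxD => //; exact: place_maxN.
Qed.

Lemma place_unit_cst a : a != 0 -> place_unit (cst a).
Proof.
by move=> a0; split; rewrite ?fmorph_eq0 -?fmorphV //; exact: place_cst.
Qed.

Lemma place_horner (p : {poly Fq}) x : O x -> O (map_poly cst p).[x].
Proof.
move=> Ox; rewrite horner_coef; apply: place_sum => i _.
by rewrite coef_map; apply/(placeM plO)/placeX => //; exact: place_cst.
Qed.

(** At a pole the leading term dominates: the quotient is the leading coefficient, a unit, plus
    terms divisible by [x^-1]. *)
Lemma poly_value_pole x (p : {poly Fq}) : ~ O x -> p != 0 ->
  place_unit ((map_poly cst p).[x] / x ^+ (size p).-1).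
Proof.
move=> nOx p0.
have x0 : x != 0 by apply/eqP => x0; apply: nOx; rewrite x0; exact: place0.
case Es : (size p) => [|n]; first by move/eqP: Es; rewrite size_poly_eq0 (negPf p0).
rewrite horner_coef size_map_poly Es big_ord_recr /= mulrDl.
rewrite mulfK ?expf_neq0 // coef_map addrC; apply: place_unitD.
  by apply: place_unit_cst; rewrite -[n]/(n.+1.-1) -Es -lead_coefE lead_coef_eq0.
rewrite mulr_suml; apply: place_max_sum => i _; rewrite -mulrA.
have -> : x ^+ i / x ^+ n = (x^-1) ^+ (n - i.+1) * x^-1.
  have Ei : x ^+ n = x ^+ (n - i) * x ^+ i.
    by rewrite -exprD subnK // ltnW.
  rewrite -exprSr -subSn // subSS exprVn Ei invfM mulrCA mulfV ?mulr1 //.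
  exact: expf_neq0.
rewrite mulrA; apply: place_maxM; last exact: place_maxV.
rewrite coef_map; apply: (placeM plO); first exact: place_cst.
by apply: placeX; have [] := place_maxV nOx.
Qed.

Lemma poly_pole_neq0 x (p : {poly Fq}) : ~ O x -> p != 0 ->
  (map_poly cst p).[x] != 0.
Proof.
move=> nOx p0; have [] := poly_value_pole nOx p0.
by rewrite mulf_eq0 negb_or => /andP[].
Qed.

(* Otherwise z^-1 would lie in the maximal ideal of another place. *)
Lemma place_max_regular z : m z -> (forall O', place cst O' -> O' <> O -> O' z) ->
  z = 0.
Proof.
move=> mz regz; apply/eqP/negPn/negP => z0.
have nOz : ~ O z^-1 by case: mz => _ [/eqP|//]; rewrite (negPf z0).
(* [z^-1] has a pole at [O], so it is transcendental over Fq and generates a proper ideal of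
   Fq[z^-1]. *)
have [p|O' [plO' nO'z]] := @place_avoiding _ _ cst z^-1 z (mulfV z0).
  have q0 : 'X * p - 1 != 0.
    rewrite -lead_coef_eq0 lead_coef_eq0; apply/eqP => /polyP/(_ 0%N).
    rewrite coefB coefXM coef1 coef0 /= sub0r => /eqP.
    by rewrite oppr_eq0 oner_eq0.
  have := poly_pole_neq0 nOz q0.
  rewrite rmorphB rmorphM rmorph1 /= map_polyX hornerD hornerN hornerM hornerX.
  by rewrite hornerC subr_eq0 => /eqP.
apply: (nO'z); apply: (regz _ plO') => EO.
by apply: nO'z; rewrite EO; case: mz.
Qed.

End Valuation.

(** * Order of the pole at a rational place *)

Section RationalPlace.
Variables (Fq : finFieldType) (K : fieldType) (cst : {rmorphism Fq -> K}).
Variables (O : set K).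
Hypotheses (plO : place cst O) (ratO : rational_place cst O).
Hypothesis ffK : function_field cst.

Local Notation m := (place_max O).
Local Notation place_unit := (place_unit O).

(** At a pole of [x] take [y = 1/x]. Otherwise [y = x - a], where [a] in Fq is the residue of [x]:
    then [p] is a power of [X - a] times some [q] with [q(a) != 0], and [q(a)] is the residue of
    [q(x)]. *)
Lemma poly_value x : (forall p : {poly Fq}, p != 0 -> (map_poly cst p).[x] != 0) ->
  exists y, [/\ y != 0, m y & forall p : {poly Fq}, p != 0 ->
    exists j : int, place_unit ((map_poly cst p).[x] / y ^ j)].
Proof.
move=> trx; have [Ox|nOx] := pselect (O x); last first.
  exists x^-1; split=> [||p p0]; last first.
  - exists (- (size p).-1%:Z); rewrite -exprnN exprVn invrK.
    exact: poly_value_pole.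
  - exact: (place_maxV plO).
  - by rewrite invr_eq0; apply/eqP => x0; apply: nOx; rewrite x0; exact: place0 plO.
have [a ma] := ratO Ox; exists (x - cst a); split=> // [|p p0].
  have := trx ('X - a%:P).
  by rewrite map_polyXsubC hornerXsubC; apply; rewrite polyXsubC_eq0.
have [j [q rq Ep]] := multiplicity_XsubC p a.
exists j%:Z; rewrite -exprnP; have {rq} qa : q.[a] != 0 by rewrite p0 in rq.
rewrite Ep rmorphM rmorphXn /= map_polyXsubC hornerM horner_exp hornerXsubC.
rewrite mulfK; last first.
  apply: expf_neq0; rewrite -hornerXsubC -map_polyXsubC; apply: trx.
  by rewrite polyXsubC_eq0.
have /factor_theorem[q1 Eq] : root (q - q.[a]%:P) a.
  by rewrite rootE hornerD hornerN hornerC subrr.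
rewrite -(subrK q.[a]%:P q) Eq rmorphD rmorphM /= map_polyXsubC map_polyC /=.
rewrite hornerD hornerM hornerXsubC hornerC addrC; apply: (place_unitD plO).
  exact: (place_unit_cst plO).
by apply: (place_maxM plO) => //; exact: (place_horner plO).
Qed.

(* K/Fq(x) is finite, so the powers of w are dependent over Fq(x); two terms of
   the relation must have the same value. *)
Lemma value_torsion : exists (E : nat) (y : K),
  [/\ (0 < E)%N, y != 0, m y &
   forall w, w != 0 -> exists j : int, place_unit (w ^+ E / y ^ j)].
Proof.
have [x [trx [n [b genb]]]] := ffK.
have [y [y0 my valy]] := poly_value trx.
(* The exponent found for [w] is a difference of two indices in 0..n; n! is a multiple of all of
   them. *)
exists n`!, y; split=> // [|w w0]; first exact: fact_gt0.
pose ev (p : {poly Fq}) := (map_poly cst p).[x].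
have [q Hq] := choice (fun j : 'I_n.+1 => genb (w ^+ j)).
have {Hq} [P HP] := choice Hq.
(* There are n + 1 powers against n generators: a last column of zeros makes the matrix square, and
   its vanishing determinant gives the relation. *)
pose A : 'M[{poly Fq}]_n.+1 := \matrix_(j, i)
  if unlift ord_max i is Some i' then P j i' else 0.
have detA : \det A == 0.
  rewrite (expand_det_col _ ord_max) big1 // => j _.
  by rewrite mxE unlift_none mul0r.
have [c c0 cA] := det0P detA.
pose r j := c 0 j * q j.
have r0 : exists j, r j != 0.
  apply: contrapT => /forallNP nr; case/eqP: c0; apply/rowP => j; rewrite mxE.
  apply/eqP/negPn/negP => cj0; apply: (nr j); rewrite mulf_neq0 //.
  by have [] := HP j.
have evM p p' : ev (p * p') = ev p * ev p' by rewrite /ev rmorphM hornerM.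
have ev0 : ev 0 = 0 by rewrite /ev rmorph0 horner0.
have ev_sum (f : 'I_n.+1 -> {poly Fq}) : ev (\sum_j f j) = \sum_j ev (f j).
  by rewrite /ev rmorph_sum horner_sum.
pose T j := ev (r j) * w ^+ (j : 'I_n.+1).
have sumT : \sum_j T j = 0.
  transitivity (\sum_j \sum_i ev (c 0 j * P j i) * b i).
    apply: eq_bigr => j _; have [_ Hj] := HP j.
    rewrite /T evM -mulrA Hj mulr_sumr; apply: eq_bigr => i _.
    by rewrite evM mulrA.
  rewrite exchange_big big1 //= => i _; rewrite -mulr_suml -ev_sum.
  have /rowP/(_ (lift ord_max i)) := cA; rewrite !mxE.
  under eq_bigr do rewrite mxE liftK.
  by move=> ->; rewrite ev0 mul0r.
have T0 j : (T j != 0) = (r j != 0).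
  rewrite /T mulf_eq0 expf_eq0 (negPf w0) andbF orbF.
  by have [->|/trx] := eqVneq (r j) 0; rewrite ?ev0 ?eqxx // => /negPf ->.
(* [T j0] is a non-zero term of least value. *)
have [j0 [rj0 maxj]] : exists j0, r j0 != 0 /\ forall j, O (T j / T j0).
  have [j1 rj1] := r0.
  suff [j0 [rj0 Hj]] : exists j0, r j0 != 0 /\
      forall j, j \in enum 'I_n.+1 -> O (T j / T j0).
    by exists j0; split=> // j; apply: Hj; rewrite mem_enum.
  elim: (enum 'I_n.+1) => [|j s [j0 [rj0 Hj]]]; first by exists j1.
  have [Oj|] := placeV plO (T j / T j0).
    by exists j0; split=> // k; rewrite inE => /predU1P[->|/Hj].
  rewrite invf_div => Oj.
  have [rj|rj] := eqVneq (r j) 0.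
    exists j0; split=> // k; rewrite inE => /predU1P[->|/Hj//].
    by rewrite /T rj ev0 !mul0r; exact: place0 plO.
  exists j; split=> // k; rewrite inE => /predU1P[->|/Hj Ok].
    by rewrite mulfV ?T0 //; exact: place1 plO.
  have -> : T k / T j = T k / T j0 * (T j0 / T j) by rewrite mulrA divfK ?T0.
  exact: (placeM plO).
(* If no other term had the value of [T j0], the sum divided by [T j0] would be 1 plus elements of
   the maximal ideal, not 0. *)
have [j1 j10 uj1] : exists2 j1, j1 != j0 & place_unit (T j1 / T j0).
  apply: contrapT => /forall2NP nu.
  have u1 : place_unit 1.
    by split; rewrite ?oner_neq0 ?invr1 //; exact: place1 plO.
  suff : place_unit 0 by case; rewrite eqxx.
  rewrite -(mul0r (T j0)^-1) -sumT mulr_suml (bigD1 j0) //= mulfV ?T0 //.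
  apply: (place_unitD plO) => //; apply: (place_max_sum plO) => j jj0.
  apply: contrapT => nm; have [|] := nu j; first by rewrite jj0.
  by apply; apply: place_unitP.
have rj1 : r j1 != 0.
  by rewrite -T0; case: uj1; rewrite mulf_eq0 negb_or => /andP[].
have [e1 u1] := valy _ rj1; have [e0 u0] := valy _ rj0.
have key (i j : 'I_n.+1) (ei ej : int) : (i < j)%N ->
    place_unit (ev (r i) / y ^ ei) -> place_unit (ev (r j) / y ^ ej) ->
    place_unit (T j / T i) -> exists e : int, place_unit (w ^+ n`! / y ^ e).
  move=> ij ui uj uji.
  have ri0 : ev (r i) != 0 by case: ui; rewrite mulf_eq0 negb_or => /andP[].
  have rj0' : ev (r j) != 0 by case: uj; rewrite mulf_eq0 negb_or => /andP[].
  have uk : place_unit (w ^+ (j - i) / y ^ (ei - ej)).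
    have -> : w ^+ (j - i) / y ^ (ei - ej) =
        T j / T i * (ev (r i) / y ^ ei) * (ev (r j) / y ^ ej)^-1.
      have Ej : w ^+ j = w ^+ (j - i) * w ^+ i by rewrite -exprD subnK // ltnW.
      rewrite expfzDr // -invr_expz /T Ej.
      by field; rewrite ri0 rj0' !(expf_neq0, expfz_neq0).
    apply: (place_unitM plO); last exact: place_unitV.
    exact: (place_unitM plO).
  have /dvdnP[k Ek] : (j - i %| n`!)%N.
    by apply: dvdn_fact; rewrite subn_gt0 ij (leq_trans (leq_subr _ _)) ?leq_ord.
  exists ((ei - ej) * k%:Z); have := place_unitX plO k uk.
  by rewrite expr_div_n -exprM mulnC -Ek [(y ^ _) ^+ _]exprnP exprz_exp.
have [j10'|j01|E] := ltngtP j1 j0.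
- apply: (key j1 j0 e1 e0) => //.
  by rewrite -invf_div; exact: place_unitV.
- exact: (key j0 j1 e0 e1).
- by case/eqP: j10; exact: val_inj.
Qed.

Lemma place_root x n : O (x ^+ n.+1) -> O x.
Proof.
move=> Oxn; apply: contrapT => nOx.
have [_ [/eqP|]] : m (x^-1 ^+ n.+1).
- rewrite exprSr; apply: (place_maxM plO); last exact: (place_maxV plO).
  by apply: (placeX plO); have [] := place_maxV plO nOx.
- by rewrite expf_eq0 invr_eq0 => /eqP x0; apply: nOx; rewrite x0; exact: place0 plO.
- by rewrite exprVn invrK.
Qed.

(* With w^E of the same value as y^(v w), the set of the w with v w >= - N. *)
Lemma pole_filtration : exists V : nat -> set K,
  [/\ forall x, V 0%N x -> O x, forall a, V 0%N (cst a),
      forall N x z, V N x -> V N z -> V N (x + z),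
      forall N N' x z, V N x -> V N' z -> V (N + N')%N (x * z) &
   [/\ forall x, exists N, V N x,
      forall N N', (N <= N')%N -> V N `<=` V N' &
      forall N, exists2 x, V N.+1 x &
        forall z, V N.+1 z -> exists a, V N (z - cst a * x)]].
Proof.
have [E [y [E0 y0 my valy]]] := value_torsion.
case: E E0 valy => // E _ valy.
have Oy : O y by case: my.
have yz (j : int) : O (y ^ j) -> 0 <= j.
  case: j => // j; rewrite NegzE -exprnN => Oyj; exfalso.
  have : m (y ^+ j.+1).
    by rewrite exprSr; apply: (place_maxM plO) => //; exact: (placeX plO).
  by case=> _ [/eqP|//]; rewrite expf_eq0 (negPf y0) andbF.
have zy (j : int) : 0 <= j -> O (y ^ j).
  by case: j => // j _; exact: (placeX plO).
have unitO u w : place_unit u -> O (u * w) -> O w.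
  by case=> u0 _ Ou' Ouw; rewrite -(mulKf u0 w); exact: (placeM plO).
have valP w j i : place_unit (w ^+ E.+1 / y ^ j) ->
    O (w ^+ E.+1 * y ^ i) <-> 0 <= j + i.
  move=> uw; have -> : w ^+ E.+1 * y ^ i = w ^+ E.+1 / y ^ j * y ^ (j + i).
    by rewrite expfzDr // mulrA divfK ?expfz_neq0.
  split=> [/(unitO _ _ uw)/yz//|/zy Oji].
  by apply: (placeM plO) => //; case: uw.
exists (fun N => [set w | O (w ^+ E.+1 * y ^+ N)]).
split=> /= [x||N x z Vx Vz|N N' x z Vx Vz|].
- by rewrite mulr1; exact: place_root.
- by move=> a; rewrite mulr1; apply: (placeX plO); exact: (place_cst plO).
- have add u w : O (u / w) -> O (w ^+ E.+1 * y ^+ N) ->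
      w != 0 -> O ((u + w) ^+ E.+1 * y ^+ N).
    move=> Ouw Ow w0; have -> : u + w = (u / w + 1) * w.
      by rewrite mulrDl divfK ?mul1r.
    rewrite exprMn -mulrA; apply: (placeM plO) => //; apply: (placeX plO).
    by apply: (placeD plO) => //; exact: (place1 plO).
  have [->|x0] := eqVneq x 0; first by rewrite add0r.
  have [->|z0] := eqVneq z 0; first by rewrite addr0.
  have [|] := placeV plO (x / z); first by move/add; apply.
  by rewrite invf_div addrC => /add; apply.
- by rewrite exprMn exprD mulrACA; exact: (placeM plO).
split=> [x|N N' NN' x Vx|N].
- have [->|x0] := eqVneq x 0.
    by exists 0%N; rewrite expr0n mul0r; exact: (place0 plO).
  have [j uj] := valy _ x0; exists `|j|%N.
  by apply/(valP _ _ `|j|%N%:Z uj); lia.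
- rewrite /= -(subnK NN') exprD mulrCA; apply: (placeM plO) => //.
  exact: (placeX plO).
(* If V (N + 1) = V N, the spanning element is 0. *)
have [[x [Vx nVx]]|nx] := pselect (exists x, O (x ^+ E.+1 * y ^+ N.+1) /\
    ~ O (x ^+ E.+1 * y ^+ N)); last first.
  exists 0; first by rewrite expr0n mul0r; exact: (place0 plO).
  move=> z Vz; exists 0; rewrite mulr0 subr0; apply: contrapT => nVz.
  by apply: nx; exists z.
exists x => // z Vz.
have x0 : x != 0.
  by apply/eqP => x0; apply: nVx; rewrite x0 expr0n mul0r; exact: (place0 plO).
have [j uj] := valy _ x0.
have Ej : j = - (N.+1)%:Z.
  have h1 := (valP _ _ N.+1%:Z uj).1 Vx.
  have h2 : ~ (0 <= j + N%:Z) by move=> h; apply/nVx/(valP _ _ N%:Z uj).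
  lia.
have us : place_unit (x ^+ E.+1 * y ^+ N.+1).
  by move: uj; rewrite Ej -exprnN invrK.
(* [(z / x) ^+ E.+1] is in [O], which is integrally closed; the residue of [z / x] is the required
   coefficient. *)
have /ratO[a ma] : O (z / x).
  apply: (@place_root _ E); apply: (unitO _ _ us).
  rewrite mulrAC -exprMn [x * _]mulrC divfK //; exact: Vz.
exists a; have -> : z - cst a * x = x * (z / x - cst a).
  by rewrite mulrBr mulrCA mulfV // mulr1 [x * _]mulrC.
have [->|mu0] := eqVneq (z / x - cst a) 0.
  by rewrite mulr0 expr0n mul0r; exact: (place0 plO).
have [i ui] := valy _ mu0.
(* The value of [(z / x - a) ^+ E.+1] is a positive integer multiple [i] of that of [y], so [i] is
   at least 1: exactly the gain needed to pass from [N.+1] to [N]. *)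
have i1 : 1 <= i.
  have h0 : 0 <= i + 0.
    by apply/(valP _ _ 0 ui); rewrite mulr1; apply: (placeX plO); case: ma.
  suff : i != 0 by lia.
  apply/eqP => i0; move: ui; rewrite i0 expr0z divr1 => /place_unit_notin_max; apply.
  by rewrite exprSr; apply: (place_maxM plO) => //; apply: (placeX plO); case: ma.
rewrite exprMn.
have -> : x ^+ E.+1 * (z / x - cst a) ^+ E.+1 * y ^+ N =
    x ^+ E.+1 * y ^+ N.+1 * ((z / x - cst a) ^+ E.+1 * y ^ (-1)).
  by rewrite (exprSr y) -[y ^ (-1)]/(y^-1); field.
apply: (placeM plO) => //; apply/(valP _ _ (-1) ui); lia.
Qed.

End RationalPlace.

(** * Finiteness over the coordinate ring *)

Section Filtration.
Variables (F : fieldType) (S : comPzRingType) (phi : {rmorphism F -> S}).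
Local Notation SF := (res phi (S^o : lmodType S)).

Fact zero_smodD (M : lmodType F) (x y : M) : [set 0] x -> [set 0] y -> [set 0] (x + y).
Proof. by move=> /= -> ->; rewrite addr0. Qed.
Fact zero_smodZ (M : lmodType F) a (x : M) : [set 0] x -> [set 0] (a *: x).
Proof. by move=> /= ->; rewrite scaler0. Qed.
Definition zero_smod (M : lmodType F) : submodule M :=
  @Submodule F M [set 0] erefl (@zero_smodD M) (@zero_smodZ M).

Definition principal (s : S) : submodule (S^o : lmodType S) :=
  span [set s : S^o].

Lemma principalP s x : principal s x <-> exists y, x = y * s.
Proof.
split=> [|[y ->]]; last by apply: (@smodZ _ _ (principal s) y s); exact: span_sub.
move: x; apply: span_ind => [|x y [a ->] [b ->]|a x [b ->]|x ->].
- by exists 0; rewrite mul0r.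
- by exists (a + b); rewrite mulrDl.
- by exists (a * b); rewrite -mulrA.
- by exists 1; rewrite mul1r.
Qed.

Variable V : nat -> submodule SF.
Hypothesis V0 : exists (I : finType) (w : I -> SF),
  forall x, V 0 x -> in_span_mod (zero_smod SF) w x.
Hypothesis V_mono : forall N N', (N <= N')%N -> V N `<=` V N'.
Hypothesis V_mul : forall N N' (x y : S), V N x -> V N' y -> V (N + N')%N (x * y).
Hypothesis V_all : forall x, exists N, V N x.
Hypothesis V_step : forall N, exists2 x, V N.+1 x &
  forall z, V N.+1 z -> exists a : F, V N (z - a *: x).

Lemma filtration_span N k (I : finType) (w : I -> SF) :
    (forall x, V N x -> in_span_mod (zero_smod SF) w x) ->
  exists (J : finType) (u : J -> SF), #|J| = (#|I| + k)%N /\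
    forall x, V (N + k)%N x -> in_span_mod (zero_smod SF) u x.
Proof.
move=> sw; elim: k => [|k [J [u [cJ su]]]].
  by exists I, w; rewrite !addn0.
have [x Vx sx] := V_step (N + k).
exists (J + unit)%type, (sum_fam u (fun=> x)).
rewrite card_sum card_unit cJ addn1 !addnS; split=> // z /sx[a /su[b]] /= E.
exists (sum_fam b (fun=> a)); rewrite big_sum_fam sum_unit /=.
by rewrite opprD addrA addrAC.
Qed.

(* Multiplication by s is injective and maps V N into V (N + k), whose dimension
   is at most k larger; hence V (N + k) / s V N has dimension at most k. *)
Lemma principal_cofinite s : GRing.lreg s ->
  exists n (w : 'I_n -> SF), spans_mod (res_smod phi (principal s)) w.
Proof.
move=> reg_s; have [k Vs] := V_all s.
apply: (@spans_of_indep_bound F SF _ k) => J w iw.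
have [N Vw] : exists N, forall j, V (k + N)%N (w j).
  have [N HN] := choice (fun j => V_all (w j)).
  exists (\max_j N j)%N => j; apply: V_mono (HN j).
  by apply: leq_trans (leq_bigmax j) (leq_addl _ _).
have [I0 [w0 sw0]] := V0.
have [I1 [w1 [_ sw1]]] := filtration_span N sw0.
have [n [u [Vu iu su]]] := basis_mod_exists sw1.
have [I2 [w2 [c2 sw2]]] := filtration_span k su.
suff : (#|{: J + 'I_n}| <= #|I2|)%N.
  by rewrite card_sum c2 addnC leq_add2l.
apply: (@steinitz F SF (zero_smod SF) _ _ w2 (sum_fam w (fun i => s * u i : SF))).
  apply: (indep_mod_add (P := res_smod phi (principal s))) => //.
  - by move=> i; apply/principalP; exists (u i); rewrite mulrC.
  - move=> a /= sa; apply: iu => /=; apply: reg_s; rewrite mulr0 -[RHS]sa.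
    rewrite mulr_sumr; apply: eq_bigr => i _.
    by rewrite !res_scaleE [LHS]mulrCA.
  - by move=> x /= ->; exact: (smod0 (principal s)).
case=> [j|i] /=; apply: sw2; rewrite addnC add0n //.
exact: V_mul.
Qed.

End Filtration.

(** * Pole filtration of the coordinate ring *)

Section CoordinateRing.
Variables (Fq : finFieldType) (C : curve Fq).
Local Notation A := (coord_ring C).
Local Notation K := (ffield C).

(** Minus its residue at infty, the function lies in the maximal ideal there and is regular
    elsewhere, hence vanishes. *)
Lemma regular_integral_cst (a : A) : infty C (val a) -> exists c, a = cstA C c.
Proof.
move=> Oa; have [c mc] := infty_rational Oa; exists c; apply/val_inj/eqP => /=.
rewrite -subr_eq0; apply/eqP; apply: (place_max_regular (infty_place C) mc).
move=> O plO nO; apply: (placeB plO); last exact: (place_cst plO).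
by have /asboolP := valP a; apply.
Qed.

Variable V : nat -> set K.
Hypotheses (V0 : forall x, V 0%N x -> infty C x) (Vc : forall a, V 0%N (cst C a)).
Hypotheses (VD : forall N x z, V N x -> V N z -> V N (x + z))
  (VM : forall N N' x z, V N x -> V N' z -> V (N + N')%N (x * z)).
Hypotheses (V_all : forall x, exists N, V N x)
  (V_mono : forall N N', (N <= N')%N -> V N `<=` V N')
  (V_step : forall N, exists2 x, V N.+1 x &
      forall z, V N.+1 z -> exists a, V N (z - cst C a * x)).

(** The element given by [V_step] may fail to be regular. Any regular [x'] in [V N.+1] outside [V N]
    replaces it, being a non-zero constant multiple of it modulo [V N]. *)
Lemma regular_step N : exists2 x : A, V N.+1 (val x) &
  forall z : A, V N.+1 (val z) -> exists a, V N (val (z - cstA C a * x)).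
Proof.
have VB x z : V N x -> V N z -> V N (x - z).
  move=> Vx Vz; apply: VD => //; rewrite -mulN1r -(rmorph1 (cst C)) -rmorphN.
  by rewrite -[N]add0n; exact: VM.
have [x Vx sx] := V_step N.
have [[x' [Vx' nVx']]|nx] :=
  pselect (exists x' : A, V N.+1 (val x') /\ ~ V N (val x')).
  exists x' => // z /sx[b Vb]; have [a Va] := sx _ Vx'.
  have a0 : a != 0.
    by apply/eqP => a0; apply: nVx'; rewrite a0 rmorph0 mul0r subr0 in Va.
  exists (b / a) => /=; have -> : val z - cst C (b / a) * val x' =
      val z - cst C b * x - cst C (b / a) * (val x' - cst C a * x).
    by rewrite rmorphM fmorphV; field; rewrite fmorph_eq0.
  by apply: VB => //; rewrite -[N]add0n; exact: VM.
exists 0 => /=; first by rewrite -(rmorph0 (cst C)); apply: V_mono (Vc 0).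
move=> z Vz; exists 0; rewrite mulr0 subr0.
by apply: contrapT => nVz; apply: nx; exists z.
Qed.

Section Filtered.
Variables (F : fieldType) (S : comPzRingType) (phi : {rmorphism F -> S}).
Variables (iota : {rmorphism A -> S}) (psi : {rmorphism Fq -> F}).
Hypothesis iota_cst : forall a, iota (cstA C a) = phi (psi a).
Hypothesis genS :
  forall x, span (range (iota : A -> res phi (S^o : lmodType S))) x.
Local Notation SF := (res phi (S^o : lmodType S)).

Definition pole_span N : submodule SF :=
  span [set z : SF | exists2 a : A, V N (val a) & iota a = z].

(** Serves both A over Fq and A_L over L: the [F]-spans of the images of the regular elements of
    [V N] form a filtration to which [principal_cofinite] applies. *)
Lemma regular_principal_cofinite s : GRing.lreg s ->
  exists n (w : 'I_n -> SF), spans_mod (res_smod phi (principal s)) w.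
Proof.
apply: (@principal_cofinite F S phi pole_span).
- exists unit, (fun=> 1 : SF); apply: span_ind => [|||x [a /V0 Oa <-]].
  + exact/in_span_mod0.
  + exact: in_span_modD.
  + exact: in_span_modZ.
  + have [c ->] := regular_integral_cst Oa; exists (fun=> psi c).
    by rewrite sum_unit res_scaleE /= iota_cst [_ *: _]mulr1 subrr.
- move=> N N' NN'; apply: span_min => x [a Va <-]; apply: span_sub.
  by exists a => //; exact: V_mono NN' _ Va.
- move=> N N' x y Vx Vy; move: x Vx.
  apply: (@span_ind F SF _ (fun x => pole_span (N + N') ((x : S) * y)))
    => [|x x' Vx Vx'|a x Vx|x [a Va <-]].
  + by rewrite mul0r; exact: smod0.
  + by rewrite mulrDl; exact: smodD.
  + have -> : (a *: x : SF) * y = a *: (x * y : SF).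
      by rewrite !res_scaleE; exact: esym (mulrA _ _ _).
    exact: smodZ.
  move: y Vy.
  apply: (@span_ind F SF _ (fun y => pole_span (N + N') (iota a * (y : S))))
    => [|y y' Vy Vy'|b y Vy|y [b Vb <-]].
  + by rewrite mulr0; exact: smod0.
  + by rewrite mulrDr; exact: smodD.
  + have -> : iota a * (b *: y : SF) = b *: (iota a * y : SF).
      by rewrite !res_scaleE; exact: mulrCA.
    exact: smodZ.
  + by apply: span_sub; exists (a * b); rewrite ?rmorphM //; exact: VM.
- move=> x; move: (genS x); move: x.
  apply: span_ind => [|x y [N Vx] [N' Vy]|a x [N Vx]|x [a _ <-]].
  + by exists 0%N; exact: smod0.
  + have mono : forall N N', (N <= N')%N -> pole_span N `<=` pole_span N'.
      move=> N1 N2 NN'; apply: span_min => z [a Va <-]; apply: span_sub.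
      by exists a => //; exact: V_mono NN' _ Va.
    exists (N + N')%N; apply: smodD; first exact: mono (leq_addr _ _) _ Vx.
    exact: mono (leq_addl _ _) _ Vy.
  + by exists N; exact: smodZ.
  + by have [N Va] := V_all (val a); exists N; apply: span_sub; exists a.
- move=> N; have [x Vx sx] := regular_step N.
  exists (iota x); first by apply: span_sub; exists x.
  apply: span_ind => [|z z' [a Va] [b Vb]|b z [a Va]|z [a /sx[b Vb] <-]].
  + by exists 0; rewrite scale0r subr0; exact: smod0.
  + by exists (a + b); rewrite scalerDl opprD addrACA; exact: smodD.
  + by exists (b * a); rewrite -scalerA -scalerBr; exact: smodZ.
  + exists (psi b); apply: span_sub; exists (a - cstA C b * x) => //.
    by rewrite rmorphB rmorphM iota_cst.
Qed.

End Filtered.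
End CoordinateRing.

Section CoordinateRingCofinite.
Variables (Fq : finFieldType) (C : curve Fq).
Local Notation A := (coord_ring C).

Lemma coord_ring_cofinite (b : A) : b != 0 -> exists n (w : 'I_n -> A),
  spans_mod (res_smod (cstA C) (principal b))
    (w : 'I_n -> res (cstA C) (A^o : lmodType A)).
Proof.
move=> b0.
have [V [V0 Vc VD VM [Va Vm Vs]]] :=
  pole_filtration (infty_place C) (@infty_rational _ C) (@curve_function_field _ C).
apply: (regular_principal_cofinite V0 Vc VD VM Va Vm Vs (iota := idfun) (psi := idfun)).
- by [].
- by move=> x; apply: span_sub; exists x.
- move=> x y /(congr1 val) /= E; apply: val_inj; apply: mulfI E.
  by apply: contraNneq b0 => b0; apply/eqP/val_inj.
Qed.

Variables (L : fieldType) (psi : {rmorphism Fq -> L}).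

Lemma AL_span (x : AL C psi) : span (range (iotaA C psi : A -> res (iotaL C psi)
  ((AL C psi)^o : lmodType (AL C psi)))) x.
Proof.
elim/tring_ind: x => [|a l|x y]; [exact: smod0| |exact: smodD].
have -> : tmono (cstA C) psi a l = l *: (iotaA C psi a : res (iotaL C psi)
  ((AL C psi)^o : lmodType (AL C psi))).
  by rewrite res_scaleE [RHS]tmonoM mul1r mulr1.
by apply: smodZ; apply: span_sub; exists a.
Qed.

Lemma AL_cofinite (s : AL C psi) : GRing.lreg s -> exists n (w : 'I_n -> AL C psi),
  spans_mod (res_smod (iotaL C psi) (principal s))
    (w : 'I_n -> res (iotaL C psi) ((AL C psi)^o : lmodType (AL C psi))).
Proof.
have [V [V0 Vc VD VM [Va Vm Vs]]] :=
  pole_filtration (infty_place C) (@infty_rational _ C) (@curve_function_field _ C).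
apply: (regular_principal_cofinite V0 Vc VD VM Va Vm Vs
  (iota := iotaA C psi) (psi := psi)).
- by move=> a; rewrite /iotaA /iotaL /= /tinl /tinr -[cstA C a]mulr1 tmonoZ mulr1.
- exact: AL_span.
Qed.

End CoordinateRingCofinite.

(** * Radicals and generators of locally free modules *)

Section Radical.
Variable R : comPzRingType.
Implicit Types I : ideal R.

Lemma idealMl I (a x : R) : I x -> I (a * x).
Proof. exact: (@smodZ _ _ I a x). Qed.

Lemma idealMr I (a x : R) : I x -> I (x * a).
Proof. by rewrite mulrC; exact: idealMl. Qed.

Definition radical_set I : set (R^o) := [set x : R^o | exists n, I ((x : R) ^+ n)].

Fact radical0 I : radical_set I 0.
Proof. by exists 1%N; rewrite expr1; exact: smod0. Qed.
Fact radicalZ I (a : R) (x : R^o) : radical_set I x -> radical_set I (a *: x).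
Proof. by move=> [n In]; exists n; rewrite exprMn; exact: idealMl. Qed.
Fact radicalD I (x y : R^o) : radical_set I x -> radical_set I y -> radical_set I (x + y).
Proof.
move=> [n In] [p Ip]; exists (n + p)%N; rewrite exprDn.
apply: smod_sum => i _; rewrite -mulr_natl; apply: idealMl.
have [le_pi|lt_ip] := leqP p i.
  by rewrite -(subnK le_pi) exprD mulrA; exact: idealMl.
have -> : (n + p - i = n + (p - i))%N by rewrite addnBA // ltnW.
by rewrite exprD -mulrA; exact: idealMr.
Qed.
Definition radical I : ideal R :=
  @Submodule R (R^o) (radical_set I) (radical0 I) (@radicalD I) (@radicalZ I).

Lemma ideal_full I : I 1 -> forall x, I x.
Proof. by move=> I1 x; rewrite -[x]mulr1; exact: idealMl. Qed.

(** The radical of [I] is an ideal containing [s], hence 1. *)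
Lemma span_powers I (s : seq R) : span [set g : R^o | g \in s] = smodT ->
  (forall g, g \in s -> exists n, I (g ^+ n)) -> I 1.
Proof.
move=> spanT Is; have : (span [set g : R^o | g \in s]) 1 by rewrite spanT.
by case/(_ (radical I)) => [g /Is//|n]; rewrite expr1n.
Qed.

(** All local bases together generate: the [a] with [a *: x] in their span form an ideal, which
    contains a power of each [g]. *)
Lemma locally_free_fg (M : lmodType R) r : locally_free M r ->
  exists (I : finType) (w : I -> M), forall x, span (range w) x.
Proof.
move=> [s [spanT free_s]].
have [w Hw] := choice (fun j : 'I_(size s) => free_s _ (mem_nth 0 (ltn_ord j))).
exists ('I_(size s) * 'I_r)%type, (fun k => w k.1 k.2) => x.
set N := span _.
pose I := @Submodule R (R^o) [set a : R^o | N ((a : R) *: x)].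
have I0 : N (0 *: x) by rewrite scale0r; exact: smod0.
have ID (a b : R^o) : N ((a : R) *: x) -> N ((b : R) *: x) -> N ((a + b : R) *: x).
  by rewrite scalerDl; exact: smodD.
have IZ (a : R) (b : R^o) : N ((b : R) *: x) -> N ((a *: b : R^o) *: x).
  by rewrite -scalerA; exact: smodZ.
suff H : I I0 ID IZ 1 by rewrite -[x]scale1r; exact: H.
apply: (span_powers spanT) => g gs.
have lt_g : (index g s < size s)%N by rewrite index_mem.
have [/(_ x)[n [a Ea]] _] := Hw (Ordinal lt_g); exists n.
rewrite /= nth_index // in Ea; rewrite /= Ea.
apply: (smod_sum (N := N)) => i _; apply: (smodZ (s := N)).
by apply: span_sub; exists (Ordinal lt_g, i).
Qed.

End Radical.

Section TorsionFiniteDimensional.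
Variables (Fq : finFieldType) (C : curve Fq).
Variables (L : fieldType) (psi : {rmorphism Fq -> L}).
Local Notation AL := (AL C psi).
Local Notation rL := (res (iotaL C psi)).

(** [M / N] is a sum of images of the A_L / a_i, where the regular element a_i carries the generator
    [w i] into [N]; each A_L / a_i is finite-dimensional by [AL_cofinite]. *)
Lemma torsion_spans (M : lmodType AL) (N : submodule M) (I : finType) (w : I -> M) :
    (forall x, span (range w) x) ->
    (forall x, exists a : AL, GRing.lreg a /\ N (a *: x)) ->
  exists n (u : 'I_n -> rL M), spans_mod (res_smod (iotaL C psi) N) u.
Proof.
move=> genw torN; have [a Ha] := choice (fun i => torN (w i)).
have [n Hn] := choice (fun i => AL_cofinite (Ha i).1).
pose b i := sval (cid (Hn i)).
pose J := {i : I & 'I_(n i)}.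
pose u (j : J) : rL M := b (tag j) (tagged j) *: w (tag j).
suff su x : in_span_mod (res_smod (iotaL C psi) N) u x.
  exists #|{: J}|, (u \o enum_val) => x.
  by apply: in_span_mod_reindex; [exact: enum_val_bij | exact: su].
have su_gen i (l : AL) : in_span_mod (res_smod (iotaL C psi) N) u (l *: w i : M).
  have [c /principalP[y Ey]] := svalP (cid (Hn i)) l.
  have -> : l = \sum_j iotaL C psi (c j) * b i j + y * a i.
    by rewrite -Ey addrC subrK.
  rewrite scalerDl scaler_suml; apply: in_span_modD; last first.
    by apply: in_span_mod0; rewrite -scalerA; apply: smodZ; exact: (Ha i).2.
  apply: (smod_sum (N := span_mod (res_smod (iotaL C psi) N) u)) => j _.
  rewrite -scalerA; apply: (@in_span_modZ _ _ _ _ u (c j)).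
  exact: (@in_span_mod_fam _ _ _ _ u (Tagged (fun i => 'I_(n i)) j)).
pose P := [set x : M |
  forall l : AL, in_span_mod (res_smod (iotaL C psi) N) u (l *: x : M)].
have P0 : P 0 by move=> l; rewrite scaler0; exact/in_span_mod0/smod0.
have PD y z : P y -> P z -> P (y + z).
  by move=> Py Pz l; rewrite scalerDr; exact: in_span_modD (Py l) (Pz l).
have PZ (l : AL) y : P y -> P (l *: y) by move=> Py l'; rewrite scalerA; exact: Py.
have /(_ (Submodule P0 PD PZ)) H := genw x.
by rewrite -[x]scale1r; apply: H => _ [i _ <-].
Qed.

End TorsionFiniteDimensional.

(** * Frobenius-invariance of minimal polynomials *)

Section FrobeniusInvariantPolynomials.
Variables (Fq : finFieldType) (L : fieldType) (psi : {rmorphism Fq -> L}).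

Lemma frob_fixed (x : L) : frob psi x = x -> exists a, x = psi a.
Proof.
move=> Ex; have : (map_poly psi ('X^#|Fq| - 'X)).[x] = 0.
  rewrite rmorphB /= map_polyXn map_polyX hornerD hornerN hornerXn hornerX.
  by rewrite -/(frob psi x) Ex subrr.
rewrite finField_genPoly rmorph_prod horner_prod => /eqP /prodf_eq0[a _].
rewrite /= map_polyXsubC hornerXsubC subr_eq0 => /eqP ->; by exists a.
Qed.

Lemma frob_fixed_poly (p : {poly L}) : map_poly (frob psi) p = p ->
  exists q : {poly Fq}, p = map_poly psi q.
Proof.
move=> Ep; have /choice[c Hc] : forall i, exists a, p`_i = psi a.
  by move=> i; apply: frob_fixed; rewrite -[in RHS]Ep coef_map.
exists (\poly_(i < size p) c i); apply/polyP => i; rewrite coef_map coef_poly.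
case: ltnP => [_|le_pi]; first exact: Hc.
by rewrite raddf0; exact: nth_default.
Qed.

End FrobeniusInvariantPolynomials.

(** Away from [a] the two polynomials have the same factor; the multiplicities at [a] then agree
    because the degrees do. *)
Lemma eq_monic_mod_linear_power (F : fieldType) (p q : {poly F}) (a : F) (D : nat) :
    p \is monic -> q \is monic -> size p = size q ->
    p %| ('X - a%:P) ^+ D * q -> q %| ('X - a%:P) ^+ D * p -> p = q.
Proof.
have ndvd (r s : {poly F}) k l : ~~ root r a ->
    r * ('X - a%:P) ^+ k %| ('X - a%:P) ^+ D * (s * ('X - a%:P) ^+ l) -> r %| s.
  move=> ra /(dvdp_trans (dvdp_mulr _ (dvdpp r))).
  rewrite mulrCA -exprD Gauss_dvdpl // coprimep_expr //.
  by rewrite coprimep_XsubC.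
move=> mp mq spq; have [k [p1]] := multiplicity_XsubC p a.
have [l [q1]] := multiplicity_XsubC q a.
rewrite (monic_neq0 mp) (monic_neq0 mq) /= => rq Eq rp Ep.
move: mp mq spq; rewrite Ep Eq.
move=> mp mq spq /(ndvd _ _ _ _ rp) pq /(ndvd _ _ _ _ rq) qp.
have mX j : ('X - a%:P) ^+ j \is monic by rewrite monic_exp ?monicXsubC.
have E1 : p1 = q1.
  apply/eqP; rewrite -eqp_monic ?inE; first by rewrite /eqp pq qp.
    by rewrite -(monicMr _ (mX k)).
  by rewrite -(monicMr _ (mX l)).
have q10 : q1 != 0 by apply: contraNneq rq => ->; exact: root0.
move: spq; rewrite E1 !size_Mmonic // !size_exp_XsubC !addnS /=.
by move/addnI ->.
Qed.

(** * Minimal polynomial of a matrix intertwined with its twist *)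

Section TwistedMinimalPolynomial.
Variables (F : fieldType) (phi : {rmorphism F -> F}) (n : nat).
Variables (A B : 'M[F]_n.+1) (a : F) (D : nat).
Hypothesis BA : B *m A = map_mx phi A *m B.
Hypothesis imB : forall x : 'rV_n.+1, exists c, x *m (A - a%:M) ^+ D = c *m B.
Hypothesis kerB : forall x : 'rV_n.+1, x *m B = 0 ->
  x *m (map_mx phi A - a%:M) ^+ D = 0.

Let hornerXsubC_mx (M : 'M[F]_n.+1) :
  horner_mx M (('X - a%:P) ^+ D) = (M - a%:M) ^+ D.
Proof. by rewrite rmorphXn rmorphB /= horner_mx_X horner_mx_C. Qed.

Let intertwine p : B *m horner_mx A p = horner_mx (map_mx phi A) p *m B.
Proof.
elim/poly_ind: p => [|p c IH]; first by rewrite !rmorph0 mulmx0 mul0mx.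
rewrite !rmorphD !rmorphM /= !horner_mx_X !horner_mx_C mulmxDr mulmxDl.
by rewrite -!mulmxE mulmxA IH -!mulmxA BA scalar_mxC.
Qed.

(* If mu is the minimal polynomial of A, then phi(mu) is that of phi(A), and each
   of the two divides (X - a)^D times the other. *)
Lemma mxminpoly_twist : map_poly phi (mxminpoly A) = mxminpoly A.
Proof.
rewrite -mxminpoly_map; set A' := map_mx phi A.
apply: (@eq_monic_mod_linear_power _ _ _ a D).
- exact: mxminpoly_monic.
- exact: mxminpoly_monic.
- by rewrite mxminpoly_map size_map_poly.
- apply: mxminpoly_min; rewrite mulrC rmorphM /= hornerXsubC_mx -mulmxE.
  apply/row_matrixP => i; rewrite row_mul row0; apply: kerB.
  by rewrite -row_mul -intertwine mx_root_minpoly mulmx0 row0.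
- apply: mxminpoly_min; rewrite rmorphM /= hornerXsubC_mx -mulmxE.
  apply/row_matrixP => i; rewrite row_mul row0 rowE.
  have [c ->] := imB (delta_mx 0 i).
  by rewrite -mulmxA intertwine mx_root_minpoly mul0mx mulmx0.
Qed.

End TwistedMinimalPolynomial.

(** * The pullback by sigma *)

Section SemilinearReduction.
Variables (Fq : finFieldType) (C : curve Fq).
Variables (L : fieldType) (psi : {rmorphism Fq -> L}).
Local Notation A := (coord_ring C).
Local Notation AL := (AL C psi).
Local Notation iA := (iotaA C psi).
Local Notation iL := (iotaL C psi).
Local Notation rL := (res iL).
Local Notation sg := (sigma C psi).

Lemma AL_ind (Q : AL -> Prop) : Q 0 -> (forall a l, Q (iA a * iL l)) ->
  (forall x y, Q x -> Q y -> Q (x + y)) -> forall x, Q x.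
Proof.
move=> Q0 Qal QD; apply: tring_ind => // a l.
by have := Qal a l; rewrite tmonoM mulr1 mul1r.
Qed.

Lemma iota_cst a : iA (cstA C a) = iL (psi a).
Proof. by rewrite /= /tinl /tinr -[cstA C a]mulr1 tmonoZ mulr1. Qed.

Lemma sigma_mono a l :
  sg (tmono (cstA C) psi a l) = tmono (cstA C) psi a (frob psi l).
Proof.
exact: (@tring_map_mono Fq A L A L (cstA C) psi (cstA C) psi idfun (frob psi)
  (fun=> erefl) (frob_cst psi)).
Qed.

Lemma sigma_iotaA a : sg (iA a) = iA a.
Proof.
by rewrite [LHS]sigma_mono rmorph1.
Qed.

Lemma sigma_iotaL l : sg (iL l) = iL (frob psi l).
Proof. exact: sigma_mono. Qed.

Section Pullback.
Variable M : lmodType AL.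
Implicit Types (N : submodule M) (y : sigma_pull M).

Definition unit_tensor (m : M) : sigma_pull M := tpure sg (1 : AL^o) m.

Lemma unit_tensorD m m' : unit_tensor (m + m') = unit_tensor m + unit_tensor m'.
Proof.
by have [_ B2 _] := tpure_balanced sg (AL^o : lmodType AL) M; exact: B2.
Qed.

Lemma unit_tensorZ (s : AL) m : unit_tensor (s *: m) = sg s *: unit_tensor m.
Proof.
have [_ _ B3] := tpure_balanced sg (AL^o : lmodType AL) M.
by rewrite tpureZ; exact: esym (B3 s 1 m).
Qed.

Lemma unit_tensorA (a : A) m : unit_tensor (iA a *: m) = iA a *: unit_tensor m.
Proof. by rewrite unit_tensorZ sigma_iotaA. Qed.

Lemma unit_tensorL l m : unit_tensor (iL l *: m) = iL (frob psi l) *: unit_tensor m.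
Proof. by rewrite unit_tensorZ sigma_iotaL. Qed.

(* The image of sigma^* N in sigma^* M; the span over AL would be the same. *)
Definition pullback N : submodule (rL (sigma_pull M)) :=
  span [set y : rL (sigma_pull M) | exists2 m, N m & unit_tensor m = y].

Lemma pullback_unit N m : N m -> pullback N (unit_tensor m).
Proof. by move=> Nm; apply: span_sub; exists m. Qed.

Lemma pullback_ind N (Q : sigma_pull M -> Prop) :
    Q 0 -> (forall x y, Q x -> Q y -> Q (x + y)) ->
    (forall l x, Q x -> Q (iL l *: x)) -> (forall m, N m -> Q (unit_tensor m)) ->
  forall y, pullback N y -> Q y.
Proof.
move=> Q0 QD QZ QN; apply: (@span_ind L (rL (sigma_pull M))) => //.
by move=> y [m Nm <-]; exact: QN.
Qed.

(** An L-span is stable under A_L here because [sigma] fixes the elements of A, so that [iA a] moves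
    inside [unit_tensor]. *)
Lemma pullbackZ N (s : AL) y : pullback N y -> pullback N (s *: y).
Proof.
have PD u v : pullback N u -> pullback N v -> pullback N (u + v) by exact: smodD.
have P0 : pullback N 0 by exact: smod0.
have PZ l u : pullback N u -> pullback N (iL l *: u).
  exact: (@smodZ _ _ (pullback N) l u).
move: y; apply: pullback_ind => [|y z Py Pz|l y Py|m Nm].
- by rewrite scaler0.
- by rewrite scalerDr; exact: PD.
- by rewrite scalerA mulrC -scalerA; exact: PZ.
elim/AL_ind: s => [|a l|s s' IH IH']; first by rewrite scale0r.
  rewrite mulrC -scalerA -unit_tensorA; apply/PZ/pullback_unit.
  exact: smodZ.
by rewrite scalerDl; exact: PD.
Qed.

Lemma pullbackT y : pullback smodT y.
Proof.
elim/tens_ind: y => [|s m|x y]; [exact: smod0| |exact: smodD].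
have -> : tpure sg s m = s *: unit_tensor m by rewrite tpureZ [_ *: _]mulr1.
by apply: pullbackZ; exact: pullback_unit.
Qed.

(** The Frobenius twist of a linear form: it sends (a (x) l) (x) m to l f(a m)^q. Such forms give
    coordinates on sigma^* of a layer. *)
Lemma sigma_functional (f : M -> L) :
    (forall m m', f (m + m') = f m + f m') -> (forall l x, f (iL l *: x) = l * f x) ->
  exists g : sigma_pull M -> L, [/\ forall x y, g (x + y) = g x + g y,
    forall l x, g (iL l *: x) = l * g x & forall m, g (unit_tensor m) = frob psi (f m)].
Proof.
move=> fD fZ.
pose b m (a : A) (l : L) : L := l * frob psi (f (iA a *: m)).
have bal m : tbal (cstA C) psi (b m).
  apply: tbalP => [a a' l|a l l'|r a l]; rewrite /b.
  - by rewrite rmorphD scalerDl fD rmorphD mulrDr.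
  - by rewrite mulrDl.
  - by rewrite rmorphM iota_cst -scalerA fZ rmorphM /= frob_cst mulrCA mulrA.
pose B (s : AL^o) (m : M) : L := rlift (b m) s.
have BE m a l : B (iA a * iL l) m = l * frob psi (f (iA a *: m)).
  by rewrite /B tmonoM mulr1 mul1r rliftE.
have BD s s' m : B (s + s') m = B s m + B s' m by exact: rliftD.
have B0 m : B 0 m = 0 by exact: rlift0.
have BL l s m : B (iL l * s) m = l * B s m.
  elim/AL_ind: s => [|a l'|s s' IH IH']; first by rewrite mulr0 !B0 mulr0.
    by rewrite mulrCA -rmorphM !BE mulrA.
  by rewrite mulrDr !BD IH IH' mulrDr.
have BDr s m m' : B s (m + m') = B s m + B s m'.
  elim/AL_ind: s => [|a l|s s' IH IH']; first by rewrite !B0 addr0.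
    by rewrite !BE scalerDr fD rmorphD mulrDr.
  by rewrite !BD IH IH' addrACA.
have balB : balanced sg B.
  split=> // r s m.
  elim/AL_ind: r => [|a l|r r' IH IH'].
  - rewrite rmorph0 !scale0r B0; elim/AL_ind: s => [|a l|s s' IH IH'].
    + by rewrite B0.
    + by rewrite BE scaler0 -(scale0r 0) -(rmorph0 iL) fZ mul0r rmorph0 mulr0.
    + by rewrite BD -IH -IH' addr0.
  - elim/AL_ind: s => [|a' l'|s s' IH IH']; first by rewrite scaler0 !B0.
      rewrite rmorphM sigma_iotaA sigma_iotaL.
      have -> : (iA a * iL (frob psi l)) *: (iA a' * iL l' : AL^o) =
          iA (a * a') * iL (frob psi l * l') by rewrite !rmorphM [LHS]mulrACA.
      have E : iA a' *: ((iA a * iL l) *: m) = iL l *: (iA (a * a') *: m).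
        rewrite !scalerA; congr (_ *: _).
        by rewrite rmorphM mulrA mulrC [iA a' * _]mulrC.
      by rewrite !BE E fZ (rmorphM (frob psi)) mulrCA mulrA.
    by rewrite scalerDr !BD IH IH'.
  - by rewrite rmorphD scalerDl BD IH IH' scalerDl BDr.
exists (tlift B); split=> [y z|l y|m]; first exact: tliftD.
  elim/tens_ind: y => [|s m|y z IH IH'].
  - have t0 : tlift B (0 : sigma_pull M) = 0.
      apply: (addrI (tlift B 0)); rewrite addr0.
      exact: esym (etrans (congr1 (tlift B) (esym (addr0 0))) (tliftD balB 0 0)).
    by rewrite scaler0 t0 mulr0.
  - by rewrite tpureZ !tliftE // BL.
  - by rewrite scalerDr !tliftD // IH IH' mulrDr.
rewrite tliftE // -[1]mulr1 -[X in B (X * _)](rmorph1 iA).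
by rewrite -[X in B (_ * X)](rmorph1 iL) BE rmorph1 scale1r mul1r.
Qed.

End Pullback.

End SemilinearReduction.

(** * Minimal polynomials on a layer N / N' *)

Section SemilinearMinimalPolynomial.
Variables (Fq : finFieldType) (C : curve Fq).
Variables (L : fieldType) (psi : {rmorphism Fq -> L}).
Local Notation A := (coord_ring C).
Local Notation AL := (AL C psi).
Local Notation iA := (iotaA C psi).
Local Notation iL := (iotaL C psi).
Local Notation rL := (res iL).
Local Notation fr := (frob psi).

Variables (M : lmodType AL) (tau : {linear sigma_pull M -> M}).
Variables (N N' : submodule M) (I : finType) (w : I -> rL M).
Hypothesis spw : spans_mod (res_smod iL N') w.
Hypothesis tauN : forall x, N x -> N (tau (unit_tensor x)).
Hypothesis tauN' : forall x, N' x -> N' (tau (unit_tensor x)).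
Variables (t : A) (a : L) (D : nat).
Local Notation j := (iA t - iL a).
Hypothesis coker_tau : forall x, N x ->
  exists y, pullback N y /\ N' (j ^+ D *: x - tau y).
Hypothesis ker_tau : forall y, N' (tau y) -> pullback N' (j ^+ D *: y).

(** Positive dimension, so that square matrices form a non-zero ring. Modulo [N'], [t] has a matrix
    [mA] and the semilinear map [T] a matrix [mB]; [coker_tau] and [ker_tau] become the hypotheses
    [imB] and [kerB] of [mxminpoly_twist]. *)
Lemma semilinear_minpoly_succ n (e : 'I_n.+1 -> rL M) :
    basis_mod (res_smod iL N') (res_smod iL N) e ->
  exists p : {poly Fq}, [/\ p \is monic, (size p <= n.+2)%N &
    forall x, N x -> N' (iA (map_poly (cstA C) p).[t] *: x)].
Proof.
move=> [Ne ie se].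
have [f Hf] := choice (fun i => dual_functional i spw ie).
have fD i x y : f i (x + y) = f i x + f i y by have [fD _ _ _] := Hf i; exact: fD.
have fZ i l (x : M) : f i (iL l *: x) = l * f i x.
  by have [_ fZ _ _] := Hf i; exact: fZ.
have f0 i x : N' x -> f i x = 0 by have [_ _ f0 _] := Hf i; exact: f0.
have fe i k : f i (e k) = (k == i)%:R by have [_ _ _ fe] := Hf i; exact: fe.
(* Coordinates modulo [N'], additive on all of [M]; on [N] they vanish exactly on elements of
   [N']. *)
pose c x : 'rV[L]_n.+1 := \row_i f i x.
have cD x y : c (x + y) = c x + c y by apply/rowP => i; rewrite !mxE fD.
have c0 x : N' x -> c x = 0 by move=> N'x; apply/rowP => i; rewrite !mxE f0.
have cZ l (x : M) : c (iL l *: x) = l *: c x by apply/rowP => i; rewrite !mxE fZ.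
have cE i : c (e i) = delta_mx 0 i.
  by apply/rowP => k; rewrite !mxE fe eqxx eq_sym.
have cN x : c (- x) = - c x.
  apply: (addrI (c x)); rewrite -cD !subrr; apply: c0; exact: smod0.
have c_sum (g : 'I_n.+1 -> M) : c (\sum_i g i) = \sum_i c (g i).
  by apply: (big_morph c cD); apply: c0; exact: smod0.
pose vec (r : 'rV[L]_n.+1) : M := \sum_i iL (r 0 i) *: (e i : M).
have Nvec r : N (vec r).
  by apply: smod_sum => i _; apply: smodZ; exact: Ne.
have c_vec r : c (vec r) = r.
  rewrite c_sum [RHS]row_sum_delta; apply: eq_bigr => i _.
  by rewrite cZ cE.
have decomp x : N x -> N' (x - vec (c x)).
  move=> Nx; have [b N'b] := se _ Nx.
  suff -> : vec (c x) = \sum_i iL (b i) *: (e i : M) by [].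
  have -> : c x = c (\sum_i iL (b i) *: (e i : M)).
    by apply/eqP; rewrite -subr_eq0 -cN -cD; apply/eqP/c0.
  rewrite -[\sum_i _](_ : vec (\row_i b i) = _); last first.
    by apply: eq_bigr => i _; rewrite mxE.
  by rewrite c_vec.
have c_eq0 x : N x -> c x = 0 -> N' x.
  move=> /decomp + cx0; rewrite cx0 /vec big1 ?subr0 // => i _.
  by rewrite mxE rmorph0 scale0r.
pose T x := tau (unit_tensor x).
have TD x y : T (x + y) = T x + T y by rewrite /T unit_tensorD linearD.
have TL l x : T (iL l *: x) = iL (fr l) *: T x by rewrite /T unit_tensorL linearZ.
have TA b x : T (iA b *: x) = iA b *: T x by rewrite /T unit_tensorA linearZ.
pose mA : 'M[L]_n.+1 := \matrix_i c (iA t *: (e i : M)).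
pose mB : 'M[L]_n.+1 := \matrix_i c (T (e i)).
(* Used for multiplication by [t], with [h] the identity, and for [T], with [h] the Frobenius. *)
have c_vec_lin (g : M -> M) (h : L -> L) (x : M) :
    (forall y z, g (y + z) = g y + g z) ->
    (forall l y, g (iL l *: y) = iL (h l) *: g y) ->
    (forall y, N' y -> N' (g y)) -> N x ->
  c (g x) = (\row_i h (c x 0 i)) *m \matrix_i c (g (e i)).
Proof.
  move=> gD gZ gN' Nx.
  have g0 : N' (g 0) by apply: gN'; exact: smod0.
  have -> : c (g x) = c (g (vec (c x))).
    have -> : g x = g (vec (c x)) + g (x - vec (c x)) by rewrite -gD addrC subrK.
    by rewrite cD [X in _ + X]c0 ?addr0 //; apply/gN'/decomp.
  have g00 : g 0 = 0 by apply: (addrI (g 0)); rewrite -gD !addr0.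
  rewrite /vec (big_morph g gD g00) c_sum mulmx_sum_row.
  by apply: eq_bigr => i _; rewrite gZ cZ rowK !mxE.
have c_t x : N x -> c (iA t *: x) = c x *m mA.
  move=> Nx; rewrite (c_vec_lin (fun x => iA t *: x) id x) //.
  - by congr (_ *m _); apply/rowP => i; rewrite !mxE.
  - by move=> y z; rewrite scalerDr.
  - by move=> l y; rewrite !scalerA mulrC.
  - by move=> y; exact: smodZ.
have c_T x : N x -> c (T x) = map_mx fr (c x) *m mB.
  move=> Nx; rewrite (c_vec_lin T fr x) //.
  by congr (_ *m _); apply/rowP => i; rewrite !mxE.
have BA : mB *m mA = map_mx fr mA *m mB.
  apply/row_matrixP => i; rewrite !row_mul -map_row !rowK.
  rewrite -c_t; last by apply: tauN; exact: Ne.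
  by rewrite -TA c_T //; apply: smodZ; exact: Ne.
have c_j k x : N x -> c (j ^+ k *: x) = c x *m (mA - a%:M) ^+ k.
  elim: k x => [|k IH] x Nx; first by rewrite !expr0 scale1r mulmx1.
  rewrite exprSr -scalerA IH; last exact: smodZ.
  rewrite exprS -mulmxE mulmxA; congr (_ *m _).
  by rewrite scalerBl cD cN cZ c_t // mulmxBr mul_mx_scalar.
have imB (r : 'rV_n.+1) : exists s, r *m (mA - a%:M) ^+ D = s *m mB.
  have [y [Ny N'y]] := coker_tau (Nvec r).
  have [s Es] : exists s, c (tau y) = s *m mB.
    move: y Ny {N'y}; apply: pullback_ind => [|x y [s Es] [s' Es']|l x [s Es]|m Nm].
    - by exists 0; rewrite linear0 mul0mx c0 //; exact: smod0.
    - by exists (s + s'); rewrite linearD cD Es Es' mulmxDl.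
    - by exists (l *: s); rewrite linearZ cZ Es scalemxAl.
    - by exists (map_mx fr (c m)); exact: c_T.
  exists s; rewrite -Es -[in LHS](c_vec r) -c_j //.
  by apply/eqP; rewrite -subr_eq0 -cN -cD; apply/eqP/c0.
have kerB (r : 'rV_n.+1) : r *m mB = 0 -> r *m (map_mx fr mA - a%:M) ^+ D = 0.
  (* [y] is the tensor with coordinates [r]; since [r *m mB = 0], [tau y] lies in [N'] and [ker_tau]
     applies to it. *)
  move=> rB; pose y : sigma_pull M := \sum_i iL (r 0 i) *: unit_tensor (e i : M).
  have N'y : N' (tau y).
    have Ey : tau y = \sum_i iL (r 0 i) *: T (e i).
      by rewrite linear_sum; apply: eq_bigr => i _; rewrite linearZ.
    apply: c_eq0.
      by rewrite Ey; apply: smod_sum => i _; apply/smodZ/tauN; exact: Ne.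
    rewrite Ey c_sum -[RHS]rB mulmx_sum_row; apply: eq_bigr => i _.
    by rewrite cZ rowK.
  have [g Hg] := choice (fun i => sigma_functional (fD i) (fZ i)).
  (* Coordinates on the pullback: they vanish on [pullback N'], and on [pullback N] the action of
     [t] on them is given by [map_mx fr mA]. *)
  pose d y : 'rV[L]_n.+1 := \row_i g i y.
  have dD y1 y2 : d (y1 + y2) = d y1 + d y2.
    by apply/rowP => i; rewrite !mxE; have [-> _ _] := Hg i.
  have dZ l y1 : d (iL l *: y1) = l *: d y1.
    by apply/rowP => i; rewrite !mxE; have [_ -> _] := Hg i.
  have du m : d (unit_tensor m) = map_mx fr (c m).
    by apply/rowP => i; rewrite !mxE; have [_ _ ->] := Hg i.
  have d0 : d 0 = 0 by apply: (addrI (d 0)); rewrite -dD !addr0.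
  have dN y1 : d (- y1) = - d y1 by apply: (addrI (d y1)); rewrite -dD !subrr.
  have dN' : forall y1, pullback N' y1 -> d y1 = 0.
    apply: pullback_ind => // [y1 y2 E1 E2|l y1 E1|m N'm].
    - by rewrite dD E1 E2 addr0.
    - by rewrite dZ E1 scaler0.
    - by rewrite du c0 // map_mx0.
  have dt : forall y1, pullback N y1 -> d (iA t *: y1) = d y1 *m map_mx fr mA.
    apply: pullback_ind => [|y1 y2 E1 E2|l y1 E1|m Nm].
    - by rewrite scaler0 d0 mul0mx.
    - by rewrite scalerDr !dD E1 E2 mulmxDl.
    - have E : iA t *: (iL l *: y1) = iL l *: (iA t *: y1).
        by rewrite !scalerA mulrC.
      apply: etrans (congr1 d E) _; apply: etrans (dZ _ _) _.
      apply: etrans (congr1 ( *:%R l) E1) _; apply: etrans (scalemxAl _ _ _) _.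
      congr (_ *m _); exact: esym (dZ _ _).
    - by rewrite -unit_tensorA !du c_t // map_mxM.
  have Py : pullback N y.
    apply: smod_sum => i _; apply: pullbackZ; apply: pullback_unit; exact: Ne.
  have dj k y1 : pullback N y1 ->
      d (j ^+ k *: y1) = d y1 *m (map_mx fr mA - a%:M) ^+ k.
    elim: k y1 => [|k IH] y1 Py1; first by rewrite !expr0 scale1r mulmx1.
    rewrite exprSr -scalerA IH; last exact: pullbackZ.
    rewrite exprS -mulmxE mulmxA; congr (_ *m _).
    apply: etrans (congr1 d (scalerBl _ _ _)) _; apply: etrans (dD _ _) _.
    rewrite mulmxBr mul_mx_scalar; apply: congr2; first exact: dt.
    by apply: etrans (dN _) _; apply: congr1; exact: dZ.
  have dy : d y = r.
    rewrite /y (big_morph d dD d0) [RHS]row_sum_delta; apply: eq_bigr => i _.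
    by rewrite dZ du cE map_delta_mx.
  by rewrite -dy -dj //; apply/dN'/ker_tau.
have /frob_fixed_poly[p Ep] : map_poly fr (mxminpoly mA) = mxminpoly mA.
  exact: (mxminpoly_twist BA imB kerB).
exists p; split.
- by rewrite -(map_monic psi) -Ep; exact: mxminpoly_monic.
- rewrite -(size_map_poly psi) -Ep; apply: leq_trans (_ : size (char_poly mA) <= _)%N.
    by apply: dvdp_leq (mxminpoly_dvd_char _); rewrite monic_neq0 ?char_poly_monic.
  by rewrite size_char_poly.
move=> x Nx; apply: c_eq0; first exact: smodZ.
have c_p (q : {poly Fq}) :
    c (iA (map_poly (cstA C) q).[t] *: x) = c x *m horner_mx mA (map_poly psi q).
  elim/poly_ind: q => [|q b IH].
    by rewrite !rmorph0 horner0 rmorph0 scale0r mulmx0 c0 //; exact: smod0.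
  rewrite !rmorphD !rmorphM /= !map_polyX !map_polyC /= hornerD hornerM hornerX.
  rewrite hornerC horner_mx_X horner_mx_C rmorphD rmorphM scalerDl mulrC -scalerA.
  rewrite cD iota_cst cZ c_t; last exact: smodZ.
  by rewrite IH mulmxDr -mulmxE mulmxA mul_mx_scalar.
by rewrite c_p -Ep mx_root_minpoly mulmx0.
Qed.

(* [p] is the minimal polynomial of t on N / N', an L-space of dimension n; the
   point is that its coefficients are in Fq. *)
Lemma semilinear_minpoly n (e : 'I_n -> rL M) :
    basis_mod (res_smod iL N') (res_smod iL N) e ->
  exists p : {poly Fq}, [/\ p \is monic, (size p <= n.+1)%N &
    forall x, N x -> N' (iA (map_poly (cstA C) p).[t] *: x)].
Proof.
case: n e => [|n] e be; last exact: (semilinear_minpoly_succ be).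
exists 1; rewrite monic1 size_poly1 rmorph1 hornerC rmorph1; split=> // x Nx.
have [_ _ /(_ x Nx)[b]] := be.
by rewrite big_ord0 subr0 scale1r.
Qed.

End SemilinearMinimalPolynomial.

(** * Ideals and residue fields *)

Section IdealTheory.
Variable R : comPzRingType.
Implicit Types I J v : ideal R.

Lemma ideal_mulP I J x y : I x -> J y -> ideal_mul I J (x * y).
Proof. by move=> Ix Jy; apply: span_sub; exists x, y. Qed.

(** [span_ind] would ask [Q] to be stable under scalars as well; here a scalar is absorbed by the
    factor in [I]. *)
Lemma ideal_mul_ind I J (Q : R -> Prop) :
    Q 0 -> (forall x y, Q x -> Q y -> Q (x + y)) ->
    (forall x y, I x -> J y -> Q (x * y)) ->
  forall z, ideal_mul I J z -> Q z.
Proof.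
move=> Q0 QD Qm.
pose P := [set z : R^o | forall a : R, Q (a * (z : R))].
have P0 : P 0 by move=> a; rewrite mulr0.
have PD (x y : R^o) : P x -> P y -> P (x + y).
  by move=> Px Py a; rewrite mulrDr; exact: QD (Px a) (Py a).
have PZ (a : R) (x : R^o) : P x -> P (a *: x).
  by move=> Px b; rewrite mulrA; exact: Px.
move=> z /(_ (Submodule P0 PD PZ)) Iz; rewrite -[z]mul1r; apply: Iz.
move=> _ [x [y [Ix Jy ->]]] a; rewrite mulrA; apply: Qm => //.
exact: idealMl.
Qed.

Lemma ideal_expS I n x y : I x -> ideal_exp I n y -> ideal_exp I n.+1 (x * y).
Proof. exact: ideal_mulP. Qed.

Lemma ideal_exp_mono I n : ideal_exp I n.+1 `<=` ideal_exp I n.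
Proof.
apply: ideal_mul_ind => [|x y|x y _]; [exact: smod0|exact: smodD|].
exact: idealMl.
Qed.

Lemma ideal_expX I n x : I x -> ideal_exp I n (x ^+ n).
Proof. by move=> Ix; elim: n => // n IH; rewrite exprS; exact: ideal_expS. Qed.

(** The ideal v + (x) is larger than [v], hence contains 1. *)
Lemma maximal_ideal_unit v : maximal_ideal v ->
  forall x, ~ v x -> exists c, v (1 - c * x).
Proof.
move=> [vT vmax] x nvx.
pose J := @Submodule R (R^o) [set y : R^o | exists c : R, v ((y : R) - c * x)].
have J0 : exists c : R, v (0 - c * x) by exists 0; rewrite mul0r subr0; exact: smod0.
have JD (y z : R^o) : (exists c : R, v ((y : R) - c * x)) ->
    (exists c : R, v ((z : R) - c * x)) -> exists c : R, v ((y + z : R) - c * x).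
  by move=> [c vc] [d vd]; exists (c + d); rewrite mulrDl opprD addrACA; exact: smodD.
have JZ (a : R) (y : R^o) : (exists c : R, v ((y : R) - c * x)) ->
    exists c : R, v ((a *: y : R) - c * x).
  by move=> [c vc]; exists (a * c); rewrite -mulrA -mulrBr; exact: idealMl.
have [y vy|JE|JE] := vmax (J J0 JD JZ).
- by exists 0; rewrite mul0r subr0.
- exfalso; apply: nvx; rewrite -JE; exists 1; rewrite mul1r subrr; exact: smod0.
- by have : J J0 JD JZ 1 by rewrite JE.
Qed.

Lemma maximal_ideal_proper v : maximal_ideal v -> ~ v 1.
Proof.
move=> [vT _] v1; apply: vT; apply: submodule_ext => x; split=> // _.
exact: ideal_full.
Qed.

End IdealTheory.

Section ResidueField.
Variables (R : comNzRingType) (v : ideal R).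

(** A copy of [qmod v] indexed by the proof of maximality, to carry a field structure. *)
Definition residue of maximal_ideal v : Type := qmod v.

Hypothesis vmax : maximal_ideal v.
Local Notation k := (residue vmax).

HB.instance Definition _ := GRing.Zmodule.on k.

Definition residue_class (x : R) : k := qclass v x.

Lemma residue_classP x y : residue_class x = residue_class y <-> v (x - y).
Proof. exact: qclassP. Qed.

Definition residue_one : k := residue_class 1.
Definition residue_mul (x y : k) : k := residue_class ((qrepr x : R) * (qrepr y : R)).

Lemma residue_mulE x y :
  residue_mul (residue_class x) (residue_class y) = residue_class (x * y).
Proof.
apply/residue_classP.
have vx := qrepr_class v x; have vy := qrepr_class v y.
set x' := qrepr _ in vx *; set y' := qrepr _ in vy *.
have -> : (x' : R) * (y' : R) - x * y = (x' - x) * y' + x * (y' - y).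
  by rewrite mulrBl mulrBr addrA subrK.
by apply: smodD; [exact: idealMr | exact: idealMl].
Qed.

Lemma residue_classK (x : k) : residue_class (qrepr x) = x.
Proof. exact: qreprK. Qed.

Lemma residue_classD x y : residue_class (x + y) = residue_class x + residue_class y.
Proof. exact: (raddfD (qclass v)). Qed.

Fact residue_mulA : associative residue_mul.
Proof.
move=> x y z; rewrite -(residue_classK x) -(residue_classK y) -(residue_classK z).
by rewrite !residue_mulE mulrA.
Qed.
Fact residue_mulC : commutative residue_mul.
Proof.
move=> x y; rewrite -(residue_classK x) -(residue_classK y).
by rewrite !residue_mulE mulrC.
Qed.
Fact residue_mul1 : left_id residue_one residue_mul.
Proof. by move=> x; rewrite -(residue_classK x) residue_mulE mul1r. Qed.
Fact residue_mulDl : left_distributive residue_mul +%R.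
Proof.
move=> x y z; rewrite -(residue_classK x) -(residue_classK y) -(residue_classK z).
by rewrite -residue_classD !residue_mulE mulrDl residue_classD.
Qed.
Fact residue_one_neq0 : residue_one != 0.
Proof.
apply/eqP => E; apply: (maximal_ideal_proper vmax).
have /residue_classP : residue_class 1 = residue_class 0.
  by rewrite [LHS]E; apply: esym; exact: (raddf0 (qclass v)).
by rewrite subr0.
Qed.
HB.instance Definition _ := GRing.Zmodule_isComNzRing.Build k
  residue_mulA residue_mulC residue_mul1 residue_mulDl residue_one_neq0.

Definition residue_inv (x : k) : k := xget 0 [set y | y * x = 1].

Fact residue_mulV x : x != 0 -> residue_inv x * x = 1.
Proof.
move=> x0; rewrite /residue_inv; case: xgetP => // nx; exfalso.
have nvx : ~ v (qrepr x).
  move=> vx; case/eqP: x0; rewrite -(residue_classK x) -[RHS](raddf0 (qclass v)).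
  by apply/residue_classP; rewrite subr0.
have [c vc] := maximal_ideal_unit vmax nvx.
apply: (nx (residue_class c)); rewrite /= -(residue_classK x).
rewrite [LHS]residue_mulE; apply/residue_classP.
by rewrite -opprB; exact: smodN.
Qed.
Fact residue_inv0 : residue_inv 0 = 0.
Proof.
rewrite /residue_inv; case: xgetP => // y _ /eqP.
by rewrite mulr0 eq_sym oner_eq0.
Qed.
HB.instance Definition _ := GRing.ComNzRing_isField.Build k residue_mulV residue_inv0.

Lemma residue_classM x y : residue_class (x * y) = residue_class x * residue_class y.
Proof. by rewrite [RHS]residue_mulE. Qed.

Lemma residue_classX x n : residue_class (x ^+ n) = residue_class x ^+ n.
Proof.
elim: n => [|n IH]; first by rewrite !expr0.
by rewrite !exprS residue_classM IH.
Qed.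

(* The units of a finite residue field form a cyclic group. *)
Lemma residue_primitive (s : seq R) : (forall x, exists2 r, r \in s & v (x - r)) ->
  exists g, forall x, v x \/ exists i, v (x - g ^+ i).
Proof.
move=> reps.
pose rs : seq k := [seq y <- undup (map residue_class s) | y != 0].
have all_rs y : y != 0 -> y \in rs.
  move=> y0; rewrite mem_filter y0 mem_undup.
  have [r rs' vr] := reps (qrepr y); apply/mapP; exists r => //.
  by rewrite -[y]residue_classK; exact/residue_classP.
have urs : uniq rs by rewrite filter_uniq ?undup_uniq.
have rs0 y : y \in rs -> y != 0 by rewrite mem_filter => /andP[].
pose n := size rs.
have n0 : (0 < n)%N.
  by rewrite /n lt0n size_eq0; apply: contraTneq (all_rs _ (oner_neq0 k)) => ->.
(* Multiplication by [y] permutes the non-zero classes [rs]; comparing the products gives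
   [y ^+ n = 1]. *)
have unity : all n.-unity_root rs.
  apply/allP => y /rs0 y0; rewrite unity_rootE.
  have P0 : \prod_(z <- rs) z != 0 by rewrite prodf_seq_neq0; apply/allP => z /rs0.
  apply/eqP/(mulIf P0); rewrite mul1r.
  have -> : y ^+ n * \prod_(z <- rs) z = \prod_(z <- map ( *%R y) rs) z.
    rewrite big_map /n; move: (rs : seq k); elim=> [|z t IH].
      by rewrite !big_nil mulr1.
    by rewrite !big_cons /= exprS mulrACA IH.
  apply: perm_big; apply: uniq_perm => // [|z].
    by rewrite map_inj_uniq //; exact: mulfI.
  apply/mapP/idP => [[u /rs0 u0 ->]|/rs0 z0].
    by apply: all_rs; rewrite mulf_neq0.
  exists (y^-1 * z); last by rewrite mulVKf.
  by apply: all_rs; rewrite mulf_neq0 ?invr_eq0.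
have /hasP[g _ pg] := cyclic.has_prim_root n0 unity urs (leqnn n).
exists (qrepr g) => x; have [vx|nvx] := pselect (v x); [by left | right].
have /all_rs /(allP unity) : residue_class x != 0.
  apply/eqP; rewrite -[0](raddf0 (qclass v)) => /residue_classP.
  by rewrite subr0.
rewrite unity_rootE => /eqP /(prim_rootP pg)[i Ei]; exists i.
by apply/residue_classP; rewrite residue_classX residue_classK.
Qed.

End ResidueField.

(** * The cokernel of an isogeny *)

Section Isogeny.
Variables (Fq : finFieldType) (C : curve Fq).
Variables (L : fieldType) (psi : {rmorphism Fq -> L}).
Local Notation A := (coord_ring C).
Local Notation AL := (AL C psi).
Local Notation iA := (iotaA C psi).
Local Notation iL := (iotaL C psi).
Local Notation rL := (res iL).
Local Notation sg := (sigma C psi).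
Variable c : {rmorphism A -> L}.

Lemma motive_coker_power r d (M : pure_motive psi c r d) (t : A) D x : (d <= D)%N ->
  exists y, (iA t - iL (c t)) ^+ D *: x = mot_tau M y.
Proof.
move=> dD; set j := iA t - iL (c t).
have Jj : char_ideal psi c j by apply: span_sub; exists t.
have := mot_coker_char (qclass (imm (mot_tau M)) x) (ideal_expX d Jj).
rewrite qclassZ => /qclass_eq0[y _ Ey].
by exists (j ^+ (D - d) *: y); rewrite linearZ Ey /= scalerA -exprD subnK.
Qed.

Variables (r d r' d' : nat) (M : pure_motive psi c r d) (M' : pure_motive psi c r' d').
Variable f : {linear mot_mod M -> mot_mod M'}.
Hypothesis isog : isogeny f.
Local Notation P := (mot_mod M').
Local Notation tau := (mot_tau M').

Lemma pull_map_balanced :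
  balanced sg (fun (s : AL^o) (m : mot_mod M) => tpure sg (idfun s) (f m)).
Proof.
have [B1 B2 B3] := tpure_balanced sg (AL^o : lmodType AL) P.
by split=> [s s' m|s m m'|a s m]; rewrite ?linearD ?linearZ;
  [exact: B1|exact: B2|exact: B3].
Qed.

Lemma pull_mapD x y :
  sigma_pull_map f (x + y) = sigma_pull_map f x + sigma_pull_map f y.
Proof. exact: tliftD pull_map_balanced _ _. Qed.

Lemma pull_map_unit m : sigma_pull_map f (unit_tensor m) = unit_tensor (f m).
Proof. exact: tliftE pull_map_balanced. Qed.

Lemma pull_map0 : sigma_pull_map f 0 = 0.
Proof.
by apply: (addrI (sigma_pull_map f 0)); rewrite -pull_mapD !addr0.
Qed.

Lemma pull_mapZ s x : sigma_pull_map f (s *: x) = s *: sigma_pull_map f x.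
Proof.
elim/tens_ind: x => [|s' m|x y IH IH']; first by rewrite scaler0 pull_map0 scaler0.
  rewrite tpureZ; have E a : sigma_pull_map f (tpure sg a m) = tpure sg a (f m).
    exact: tliftE pull_map_balanced.
  by rewrite !E tpureZ.
by rewrite scalerDr !pull_mapD IH IH' scalerDr.
Qed.

Lemma tau_f m : tau (unit_tensor (f m)) = f (mot_tau M (unit_tensor m)).
Proof. by have [-> _ _] := isog; rewrite pull_map_unit. Qed.

(* range f + I M' *)
Definition thick (I : set A) : submodule P :=
  span [set x | range f x \/ exists a m, I a /\ x = iA a *: m].

Lemma thick_f I m : thick I (f m).
Proof. by apply: span_sub; left; exists m. Qed.

Lemma thick_scale I a m : I a -> thick I (iA a *: m).
Proof. by move=> Ia; apply: span_sub; right; exists a, m. Qed.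

Lemma thick_ind I (Q : P -> Prop) :
    (forall x y, Q x -> Q y -> Q (x + y)) -> (forall m, Q (f m)) ->
    (forall a m, I a -> Q (iA a *: m)) ->
  forall x, thick I x -> Q x.
Proof.
move=> QD Qf Qa x.
have Q0 : Q 0 by rewrite -(linear0 f).
pose S := [set x | forall s : AL, Q (s *: x)].
have S0 : S 0 by move=> s; rewrite scaler0.
have SD y z : S y -> S z -> S (y + z).
  by move=> Sy Sz s; rewrite scalerDr; exact: QD (Sy s) (Sz s).
have SZ (s : AL) y : S y -> S (s *: y) by move=> Sy s'; rewrite scalerA; exact: Sy.
move=> /(_ (Submodule S0 SD SZ)) H; rewrite -[x]scale1r; apply: H => y.
move=> [[m _ <-]|[a [m [Ia ->]]]] s; first by rewrite -linearZ.
by rewrite scalerA mulrC -scalerA; exact: Qa.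
Qed.

Lemma thick_sub I I' : I `<=` I' -> thick I `<=` thick I'.
Proof.
move=> II' x; apply: thick_ind => [y z|m|a m Ia]; first exact: smodD.
- exact: thick_f.
- by apply: thick_scale; exact: II'.
Qed.

(** With [set0] and [setT] at the two ends, coker f itself becomes a layer, to which [thick_minpoly]
    applies. *)
Lemma thick_set0 x : thick set0 x <-> imm f x.
Proof.
split=> [|[m _ <-]]; last exact: thick_f.
by move: x; apply: thick_ind => [y z|m|//]; [exact: smodD | exists m].
Qed.

Lemma thickT x : thick setT x.
Proof. by rewrite -[x]scale1r -(rmorph1 iA); exact: thick_scale. Qed.

Lemma thick_tau I x : thick I x -> thick I (tau (unit_tensor x)).
Proof.
move: x; apply: thick_ind => [x y|m|a m Ia].
- by rewrite unit_tensorD linearD; exact: smodD.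
- by rewrite tau_f; exact: thick_f.
- by rewrite unit_tensorA linearZ; exact: thick_scale.
Qed.

Section Power.
Variable t : A.
Local Notation D := (d + d')%N.
Local Notation j := (iA t - iL (c t)).

(** On the image of [f] the power of [j] is in the image of the tau of [M], on [I M'] in that of
    [M']; in both cases the preimage can be kept in the pullback. *)
Lemma thick_coker I x : thick I x ->
  exists y, pullback (thick I) y /\ j ^+ D *: x = tau y.
Proof.
move: x; apply: thick_ind => [x x' [y [Py Ey]] [y' [Py' Ey']]|m|a m Ia].
- exists (y + y'); split; first exact: smodD.
  by rewrite scalerDr Ey Ey' linearD.
- have [u Eu] := @motive_coker_power _ _ M t D m (leq_addr _ _).
  exists (sigma_pull_map f u); split; last first.
    by have [fM _ _] := isog; rewrite -fM -Eu linearZ.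
  move: (pullbackT u); move: u {Eu}; apply: pullback_ind => [|u v|l u|n _].
  + by rewrite pull_map0; exact: smod0.
  + by rewrite pull_mapD; exact: smodD.
  + by rewrite pull_mapZ => Pu; exact: pullbackZ.
  + by rewrite pull_map_unit; apply: pullback_unit; exact: thick_f.
- have [u Eu] := @motive_coker_power _ _ M' t D m (leq_addl _ _).
  exists (iA a *: u); split; last first.
    by rewrite scalerA mulrC -scalerA Eu linearZ.
  move: (pullbackT u); move: u {Eu}; apply: pullback_ind => [|u v|l u|n _].
  + by rewrite scaler0; exact: smod0.
  + by rewrite scalerDr; exact: smodD.
  + by rewrite scalerA mulrC -scalerA => Pu; exact: pullbackZ.
  + by rewrite -unit_tensorA; apply: pullback_unit; exact: thick_scale.
Qed.

(** By [thick_coker], [j ^+ D *: tau y] is [tau z] with [z] in the pullback, and [tau] is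
    injective. *)
Lemma thick_ker I y : thick I (tau y) -> pullback (thick I) (j ^+ D *: y).
Proof.
move=> /thick_coker[z [Pz Ez]]; have -> // : j ^+ D *: y = z.
by apply: (mot_tau_inj (p := M')); rewrite linearZ.
Qed.

End Power.

Lemma coker_spans : exists n (w : 'I_n -> rL P), spans_mod (res_smod iL (imm f)) w.
Proof.
have [J [w genw]] := locally_free_fg (mot_locally_free M').
apply: (torsion_spans genw) => x; have [_ _ tors] := isog.
have [a [rega Ea]] := tors (qclass (imm f) x); exists a; split=> //.
by apply/qclass_eq0; rewrite -qclassZ.
Qed.

Lemma thick_spans I : exists n (w : 'I_n -> rL P),
  spans_mod (res_smod iL (thick I)) w.
Proof.
have [n [w sw]] := coker_spans; exists n, w; apply: spans_mod_sub sw => x /= fx.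
by apply: (thick_sub (@sub0set _ I)); exact/thick_set0.
Qed.

Lemma thick_basis I I' : exists n (e : 'I_n -> rL P),
  basis_mod (res_smod iL (thick I')) (res_smod iL (thick I)) e.
Proof. by have [n [w sw]] := thick_spans I'; apply: basis_mod_exists. Qed.

Lemma thick_minpoly I I' n (e : 'I_n -> rL P) (t : A) :
    basis_mod (res_smod iL (thick I')) (res_smod iL (thick I)) e ->
  exists p : {poly Fq}, [/\ p \is monic, (size p <= n.+1)%N &
    forall x, thick I x -> thick I' (iA (map_poly (cstA C) p).[t] *: x)].
Proof.
move=> be; have [k [w sw]] := thick_spans I'.
apply: (semilinear_minpoly sw (@thick_tau I) (@thick_tau I')
  (a := c t) (D := (d + d')%N) _ (@thick_ker t I') be) => x /(thick_coker t).
by move=> [y [Py ->]]; exists y; rewrite subrr; split=> //; exact: smod0.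
Qed.

(* If A = Fq, then b = 0 is allowed: A itself is finite. *)
Lemma coker_annihilator : exists b : A, (forall x, imm f (iA b *: x)) /\
  exists s : seq A, forall x, exists2 y, y \in s & principal b (x - y).
Proof.
have [const|] := pselect (forall a : A, infty C (val a)).
  exists 0; split=> [x|]; first by rewrite rmorph0 scale0r; exact: smod0.
  exists [seq cstA C a | a <- enum Fq] => x.
  have [a ->] := regular_integral_cst (const x); exists (cstA C a).
    by apply: map_f; rewrite mem_enum.
  by rewrite subrr; exact: smod0.
move=> /existsNP[t nOt].
(* This layer is coker f; [b] is the value at [t] of a polynomial over Fq that kills it, non-zero
   because [t] has a pole at infty. *)
have [n [e be]] := thick_basis setT set0.
have [p [mp _ Hp]] := thick_minpoly t be.
exists (map_poly (cstA C) p).[t]; split=> [x|].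
  by apply/thick_set0/Hp/thickT.
have b0 : (map_poly (cstA C) p).[t] != 0.
  have := poly_pole_neq0 (infty_place C) nOt (monic_neq0 mp).
  apply: contraNneq => /(congr1 (val : A -> ffield C)).
  rewrite -(horner_map (val : A -> ffield C)) -map_poly_comp => E.
  by apply/eqP; exact: E.
(* A / b is finite-dimensional over the finite field Fq, so finitely many combinations represent
   it. *)
have [k [w sw]] := coord_ring_cofinite b0.
exists [seq \sum_i cstA C (a i) * w i |
  a : {ffun 'I_k -> Fq} <- enum {ffun 'I_k -> Fq}] => x.
have [a Ha] := sw x; exists (\sum_i cstA C (finfun a i) * w i).
  by apply: map_f; rewrite mem_enum.
by under eq_bigr do rewrite ffunE.
Qed.

End Isogeny.

Section Dimension.
Variables (F : fieldType) (V : lmodType F).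

Lemma basis_has_dim n (e : 'I_n -> V) :
  basis_mod (zero_smod V) smodT e -> is_basis e.
Proof.
move=> [_ ie se] x; have [a /= /eqP] := se x I; rewrite subr_eq0 => /eqP Ea.
exists (finfun a); split=> [|b Eb].
  by rewrite Ea; apply: eq_bigr => i _; rewrite ffunE.
apply/ffunP => i; rewrite ffunE; apply/eqP; rewrite -subr_eq0; apply/eqP.
apply: (ie (fun i => a i - b i)) => /=; under eq_bigr do rewrite scalerBl.
by rewrite sumrB -Ea -Eb subrr.
Qed.

Lemma is_basis_basis_mod n (e : 'I_n -> V) :
  is_basis e -> basis_mod (zero_smod V) smodT e.
Proof.
move=> be; split=> // [a /= Ea i|x _].
  have [b [_ ub]] := be 0.
  have Eb0 : b = [ffun=> 0].
    by apply: ub; rewrite big1 // => k _; rewrite ffunE scale0r.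
  have : b = finfun a.
    by apply: ub; rewrite -[LHS]Ea; apply: eq_bigr => k _; rewrite ffunE.
  by rewrite Eb0 => /ffunP/(_ i); rewrite !ffunE.
by have [a [Ea _]] := be x; exists a; rewrite /= [x in x - _]Ea subrr.
Qed.

Lemma has_dim_indep n (J : finType) (u : J -> V) :
  has_dim V n -> indep_mod (zero_smod V) u -> (#|J| <= n)%N.
Proof.
move=> [e /is_basis_basis_mod[_ _ se]] iu.
by rewrite -[n]card_ord; apply: steinitz iu _ => j; exact: se.
Qed.

Lemma has_dim_dimension n : has_dim V n -> dimension V = n.
Proof.
move=> Vn; rewrite /dimension; case: xgetP => [m _ /= Vm|/(_ n)//].
have key k l : has_dim V k -> has_dim V l -> (k <= l)%N.
  move=> [e /is_basis_basis_mod[_ ie _]] Vl.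
  by have := has_dim_indep Vl ie; rewrite card_ord.
by apply/eqP; rewrite eqn_leq !key.
Qed.

Lemma spans_has_dim (J : finType) (w : J -> V) : spans_mod (zero_smod V) w ->
  exists2 n, has_dim V n & (n <= #|J|)%N.
Proof.
move=> sw; have [n [e be]] := basis_mod_exists (fun x (_ : smodT x) => sw x).
exists n; first by exists e; exact: basis_has_dim.
have [_ ie _] := be; rewrite -[n]card_ord; apply: steinitz ie _ => j.
exact: sw.
Qed.

End Dimension.

(** * Layers of the filtration by powers of v *)

Section Layers.
Variables (Fq : finFieldType) (C : curve Fq).
Variables (L : fieldType) (psi : {rmorphism Fq -> L}).
Local Notation A := (coord_ring C).
Local Notation AL := (AL C psi).
Local Notation iA := (iotaA C psi).
Local Notation iL := (iotaL C psi).
Local Notation rL := (res iL).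
Variable c : {rmorphism A -> L}.
Variables (r d r' d' : nat) (M : pure_motive psi c r d) (M' : pure_motive psi c r' d').
Variable f : {linear mot_mod M -> mot_mod M'}.
Hypothesis isog : isogeny f.
Local Notation P := (mot_mod M').
Local Notation thick := (thick f).
Implicit Types I J v : ideal A.

Lemma thick_mul I J a x : I a -> thick J x -> thick (ideal_mul I J) (iA a *: x).
Proof.
move=> Ia; move: x; apply: thick_ind => [x y|m|b m Jb].
- by rewrite scalerDr; exact: smodD.
- by rewrite -linearZ; exact: thick_f.
- by rewrite scalerA -rmorphM; apply: thick_scale; exact: ideal_mulP.
Qed.

Lemma ideal_mulC I J : ideal_mul I J = ideal_mul J I.
Proof.
have key I' J' x : ideal_mul I' J' x -> ideal_mul J' I' x.
  move: x; apply: ideal_mul_ind => [|x y|x y Ix Jy]; [exact: smod0|exact: smodD|].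
  by rewrite mulrC; exact: ideal_mulP.
by apply: submodule_ext => x; split; exact: key.
Qed.

Definition stable v J := thick J `<=` thick (ideal_mul v J).

(** With K = coker f, multiplying v J K = J K by [I] gives v I J K = I J K. *)
Lemma stable_mull v I J : stable v J -> stable v (ideal_mul I J).
Proof.
move=> vJ x; apply: thick_ind => [y z|m|a m]; [exact: smodD|exact: thick_f|].
move: a; apply: ideal_mul_ind => [|a b Pa Pb|a b Ia Jb].
- by rewrite rmorph0 scale0r; exact: smod0.
- by rewrite rmorphD scalerDl; exact: smodD.
rewrite rmorphM -scalerA; have /vJ : thick J (iA b *: m) by exact: thick_scale.
move: (_ *: m); apply: thick_ind => [y z|n|w n].
- by rewrite scalerDr; exact: smodD.
- by rewrite -linearZ; exact: thick_f.
rewrite scalerA -rmorphM; move: w; apply: ideal_mul_ind => [|w z Pw Pz|p q vp Jq].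
- by rewrite mulr0 rmorph0 scale0r; exact: smod0.
- by rewrite mulrDr rmorphD scalerDl; exact: smodD.
- by rewrite mulrCA; apply: thick_scale; do ?apply: ideal_mulP.
Qed.

Lemma stable_mulr v I J : stable v I -> stable v (ideal_mul I J).
Proof. by rewrite ideal_mulC; exact: stable_mull. Qed.

Section MaximalIdeal.
Variable v : ideal A.
Hypothesis vmax : maximal_ideal v.

(** If [a] were a unit modulo [v], then x = (1 - z a) x + z a x would lie in the next step of the
    filtration. *)
Lemma layer_annihilator i a : ~ stable v (ideal_exp v i) ->
    (forall x, thick (ideal_exp v i) x -> thick (ideal_exp v i.+1) (iA a *: x)) ->
  v a.
Proof.
move=> nst ax; apply: contrapT => /(maximal_ideal_unit vmax)[z vz].
apply: nst => x Px.
have -> : x = iA (1 - z * a) *: x + iA z *: (iA a *: x).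
  by rewrite scalerA -scalerDl -rmorphM -rmorphD subrK rmorph1 scale1r.
apply: smodD; first exact: thick_mul.
by apply: smodZ; exact: ax.
Qed.

(* A generator g of the residue field satisfies a polynomial over Fq of degree at
   most the dimension n of the layer. *)
Lemma layer_dim i n (e : 'I_n -> rL P) : ~ stable v (ideal_exp v i) ->
    basis_mod (res_smod iL (thick (ideal_exp v i.+1)))
      (res_smod iL (thick (ideal_exp v i))) e ->
  (0 < residue_degree v <= n)%N.
Proof.
move=> nst be.
have [b [fb [s Hs]]] := coker_annihilator isog.
(* Hence A / v is a quotient of the finite ring A / b, and its unit group has a generator [g]. *)
have vb : v b.
  apply: (layer_annihilator nst) => x _.
  by apply: (thick_sub (@sub0set _ _)); apply/thick_set0; exact: fb.
have [g Hg] : exists g : A, forall x : A, v x \/ exists i, v (x - g ^+ i).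
  apply: (residue_primitive vmax (s := s)) => x; have [y ys xy] := Hs x.
  by exists y => //; apply: span_min xy => _ ->.
have [p [mp szp Hp]] := thick_minpoly isog g be.
have vp : v (map_poly (cstA C) p).[g] by apply: (layer_annihilator nst) => x /Hp.
(* Division by [p], whose value at [g] lies in [v], shows that the first n powers of [g] span A /
   v. *)
pose w (k : 'I_n) : res (cstA C) (qmod v) := qclass v (g ^+ k).
have sw : spans_mod (zero_smod _) w.
  move=> x0; rewrite -(qreprK x0); set x : A := qrepr x0.
  have [q vq] : exists q : {poly Fq}, v (x - (map_poly (cstA C) q).[g]).
    have [vx|[k vk]] := Hg x; first by exists 0; rewrite rmorph0 horner0 subr0.
    by exists 'X^k; rewrite map_polyXn hornerXn.
  exists (fun k : 'I_n => (q %% p)`_k) => /=; apply/eqP; rewrite subr_eq0; apply/eqP.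
  have -> : \sum_(i < n) (q %% p)`_i *: w i =
      qclass v (\sum_(i < n) cstA C (q %% p)`_i * g ^+ i : A^o).
    rewrite raddf_sum; apply: eq_bigr => k _.
    exact: qclassZ.
  apply/qclassP; have -> : \sum_(i < n) cstA C (q %% p)`_i * g ^+ i =
      (map_poly (cstA C) (q %% p)).[g].
    rewrite (@horner_coef_wide _ n); first by under [RHS]eq_bigr do rewrite coef_map.
    apply: leq_trans (size_poly _ _) _; rewrite -ltnS; apply: leq_trans szp.
    by rewrite ltn_modp monic_neq0.
  move: vq; rewrite {1}(divp_eq q p) rmorphD rmorphM hornerD hornerM /= => vq.
  set h := (map_poly (cstA C) (q %/ p)).[g] in vq *.
  rewrite -[_ - _](subrK (h * (map_poly (cstA C) p).[g])).
  apply: smodD; last exact: idealMl.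
  by rewrite -addrA -opprD addrC [in X in - X]addrC addrC.
have [k Vk kn] := spans_has_dim sw; rewrite card_ord in kn.
rewrite /residue_degree (has_dim_dimension Vk) kn andbT lt0n; apply/eqP => k0.
have [e' be'] := Vk; move: e' be' {Vk kn}; rewrite k0 => e' be'.
have [a [+ _]] := be' (qclass v 1); rewrite big_ord0 => /qclass_eq0.
exact: maximal_ideal_proper.
Qed.

(** By [stable_mull], if the power [m] is unstable then so are all lower ones; the m + 1 layers up
    to it contribute at least [residue_degree v] each. *)
Lemma unstable_indep m : ~ stable v (ideal_exp v m) -> (0 < residue_degree v)%N /\
  exists (J : finType) (u : J -> rL P),
    indep_mod (res_smod iL (thick (ideal_exp v m.+1))) u /\
    (m.+1 * residue_degree v <= #|J|)%N.
Proof.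
elim: m => [|m IH] nst.
  have [n [e be]] := thick_basis isog (ideal_exp v 0) (ideal_exp v 1).
  have /andP[k0 kn] := layer_dim nst be; split=> //; exists 'I_n, e.
  by rewrite card_ord mul1n; split=> //; case: be.
have [|k0 [J [u [iu cJ]]]] := IH; first by move=> st; apply: nst; exact: stable_mull.
have [n [e be]] := thick_basis isog (ideal_exp v m.+1) (ideal_exp v m.+2).
have /andP[_ kn] := layer_dim nst be; split=> //.
exists (J + 'I_n)%type, (sum_fam u e); split; last first.
  by rewrite card_sum card_ord mulSn addnC leq_add.
have [Pe ie _] := be; apply: (indep_mod_add Pe ie _ iu).
by apply: thick_sub; exact: ideal_exp_mono.
Qed.

End MaximalIdeal.
End Layers.

(** * Completions *)

Section CompletionTheory.
Variables (R : comPzRingType) (v : ideal R).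
Local Notation Rv := (completion v).

Definition compl_of (a : R) : Rv :=
  @Completion R v (fun n => qclass (ideal_exp v n) a)
    (fun n => ex_intro _ a (conj erefl erefl)).

Lemma compl_valD (x y : Rv) n : compl_val (x + y) n = compl_val x n + compl_val y n.
Proof. by []. Qed.

Lemma compl_valZ a (x : Rv) n : compl_val (a *: x) n = a *: compl_val x n.
Proof. by []. Qed.

Lemma compl_val_sum (I : finType) (x : I -> Rv) n :
  compl_val (\sum_i x i) n = \sum_i compl_val (x i) n.
Proof. exact: (big_morph (fun x : Rv => compl_val x n)). Qed.

Lemma compl_reprs (x : Rv) : exists b : nat -> R,
  (forall n, compl_val x n = qclass (ideal_exp v n) (b n)) /\
  (forall n, ideal_exp v n.+1 (b n.+1 - b n)).
Proof.
have [b Hb] := choice (complP x).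
exists b; split=> [n|n]; first by have [-> _] := Hb n.
have [E _] := Hb n.+1; have [_ E'] := Hb n.
by apply/qclassP; rewrite -E -E'.
Qed.

Lemma coherent_partial_sums (h : nat -> R) : (forall n, ideal_exp v n (h n)) ->
  coherent (fun n => qclass (ideal_exp v n) (\sum_(i < n) h i : R)).
Proof.
move=> vh n; exists (\sum_(i < n.+1) h i); split=> //; apply/qclassP.
by rewrite big_ord_recr /= opprD addrA subrr sub0r; exact: smodN.
Qed.

(** The geometric series of [u = 1 - s] converges and inverts [s] on the completion. *)
Lemma compl_divisible (s : R) : v (1 - s) -> forall x : Rv, exists y, x = s *: y.
Proof.
move=> vs x; have [b [xb vb]] := compl_reprs x.
set u := 1 - s in vs; have Es : s = 1 - u by rewrite /u opprB addrC subrK.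
have cy : coherent (fun n => (\sum_(i < n) u ^+ i : R) *: compl_val x n).
  move=> n; exists ((\sum_(i < n.+1) u ^+ i) * b n).
  have -> : compl_val x n.+1 = qclass (ideal_exp v n.+1) (b n).
    rewrite xb; apply/qclassP; exact: vb.
  rewrite xb !qclassZ; split=> //; apply/qclassP.
  rewrite big_ord_recr /= mulrDl opprD addrA subrr sub0r.
  by apply: smodN; apply: idealMr; exact: ideal_expX.
exists (Completion cy); apply: compl_inj => n /=.
rewrite xb (qclassZ (ideal_exp v n) _ (b n)) qclassZ; apply/qclassP.
suff H : ideal_exp v n (b n - s * ((\sum_(i < n) u ^+ i) * b n)) by exact: H.
have -> : s * ((\sum_(i < n) u ^+ i) * b n) = b n - u ^+ n * b n.
  by rewrite mulrA Es -[1 - u]opprB mulNr -subrX1 opprB mulrBl mul1r.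
by rewrite opprB addrC subrK; apply: idealMr; exact: ideal_expX.
Qed.

Lemma ideal_mul_gens p (g : 'I_p -> R) (J : ideal R) :
    (forall x, v x -> exists a, x = \sum_i a i * g i) ->
  forall x, ideal_mul v J x -> exists h, (forall i, J (h i)) /\ x = \sum_i g i * h i.
Proof.
move=> gens.
apply: ideal_mul_ind => [|x y [h [Jh ->]] [k [Jk ->]]|x y /gens[a ->] Jy].
- exists (fun=> 0); split=> [i|]; first exact: smod0.
  by rewrite big1 // => i _; rewrite mulr0.
- exists (fun i => h i + k i); split=> [i|]; first exact: smodD.
  by rewrite -big_split; apply: eq_bigr => i _; rewrite mulrDr.
- exists (fun i => a i * y); split=> [i|]; first exact: idealMl.
  by rewrite mulr_suml; apply: eq_bigr => i _; rewrite mulrAC mulrC mulrCA mulrC.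
Qed.

(** The difference [b n.+1 - b n] is a combination of the [g i] with coefficients in v^n; these
    coefficients sum to the [z i], and telescoping leaves [b 0] as [a]. *)
Lemma compl_gens p (g : 'I_p -> R) :
    (forall x, v x -> exists a, x = \sum_i a i * g i) ->
  forall x : Rv, exists (a : R) (z : 'I_p -> Rv), x = compl_of a + \sum_i g i *: z i.
Proof.
move=> gens x; have [b [xb vb]] := compl_reprs x.
have [h Hh] := choice (fun n => ideal_mul_gens gens (vb n)).
have cz i := coherent_partial_sums (fun n => (Hh n).1 i).
exists (b 0%N), (fun i => Completion (cz i)); apply: compl_inj => n.
rewrite compl_valD compl_val_sum xb.
have -> : \sum_i compl_val (g i *: Completion (cz i)) n =
    qclass (ideal_exp v n) (\sum_i g i * \sum_(k < n) h k i : R).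
  by rewrite raddf_sum; apply: eq_bigr => i _; exact: qclassZ.
have -> : \sum_i g i * \sum_(k < n) h k i = b n - b 0%N.
  rewrite -telescope_sumr // big_mkord.
  under eq_bigr do rewrite mulr_sumr.
  by rewrite exchange_big; apply: eq_bigr => k _; rewrite -(Hh k).2.
by rewrite [RHS]qaddE addrC subrK.
Qed.

End CompletionTheory.

(** * The natural map from K to its tensor product with a completion *)

Section TensorCompletion.
Variables (R S : comPzRingType) (phi : {rmorphism R -> S}) (K : lmodType S).
Variable v : ideal R.
Local Notation Kv := (tens phi K (completion v)).
Local Notation pure := (@tpure R S phi K (completion v)).

Let B := tpure_balanced phi K (completion v).

Lemma tpureDl k k' x : pure (k + k') x = pure k x + pure k' x.
Proof. by have [B1 _ _] := B; exact: B1. Qed.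
Lemma tpureDr k x x' : pure k (x + x') = pure k x + pure k x'.
Proof. by have [_ B2 _] := B; exact: B2. Qed.
Lemma tpure_scale r k x : pure (phi r *: k) x = pure k (r *: x).
Proof. by have [_ _ B3] := B; exact: B3. Qed.
Lemma tpure0l x : pure 0 x = 0.
Proof. by apply: (addrI (pure 0 x)); rewrite -tpureDl !addr0. Qed.
Lemma tpure0r k : pure k 0 = 0.
Proof. by apply: (addrI (pure k 0)); rewrite -tpureDr !addr0. Qed.

(** A multiple of [b] is 1 modulo [v], hence acts surjectively on the completion, while it kills
    [K]. *)
Lemma tens_compl_trivial b : (forall k : K, phi b *: k = 0) ->
  (exists c, v (1 - c * b)) -> forall y : Kv, y = 0.
Proof.
move=> bK [c vc] y; elim/tens_ind: y => [//|k x|x y -> ->]; last by rewrite addr0.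
have [y ->] := compl_divisible vc x.
by rewrite -tpure_scale rmorphM -scalerA bK scaler0 tpure0l.
Qed.

Lemma pure_compl_of_sum (I : finType) (y : I -> Kv) :
    (forall i, exists k, y i = pure k (compl_of v 1)) ->
  exists k, \sum_i y i = pure k (compl_of v 1).
Proof.
move=> Hy; elim/big_ind: _ => [|z z' [k ->] [k' ->]|i _]; last exact: Hy.
- by exists 0; rewrite tpure0l.
- by exists (k + k'); rewrite tpureDl.
Qed.

(* Induction on the total exponent: v annihilates a smaller power of each
   generator times k. *)
Lemma pure_nilpotent p (g : 'I_p -> R) (N : 'I_p -> nat) (k : K) x :
    (forall x, v x -> exists a, x = \sum_i a i * g i) ->
    (forall i, phi (g i ^+ N i) *: k = 0) ->
  exists k', pure k x = pure k' (compl_of v 1).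
Proof.
move=> gens; have [m] := ubnP (\sum_i N i).
elim: m N k x => // m IHm N k x le_m Nk.
have [a [z ->]] := compl_gens gens x; rewrite tpureDr.
have Ea : compl_of v a = a *: compl_of v 1.
  by apply: compl_inj => n; rewrite compl_valZ qclassZ [_ *: _]mulr1.
rewrite Ea -tpure_scale.
have [k' Ek'] : exists k', \sum_i pure k (g i *: z i) = pure k' (compl_of v 1).
  apply: pure_compl_of_sum => i; rewrite -tpure_scale.
  case ENi : (N i) => [|n].
    have -> : k = 0 by have := Nk i; rewrite ENi expr0 rmorph1 scale1r.
    by exists 0; rewrite scaler0 !tpure0l.
  apply: (IHm (fun l => if l == i then n else N l)) => [|l].
    rewrite -ltnS; apply: leq_trans le_m; rewrite ltnS.
    rewrite (bigD1 i) //= eqxx [X in (_ < X)%N](bigD1 i) //= ENi addSn ltnS.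
    by rewrite leq_add2l; apply: leq_sum => l /negPf ->.
  case: eqP => [->|_].
    by rewrite scalerA -rmorphM -exprSr -ENi.
  by rewrite scalerA mulrC -scalerA Nk scaler0.
exists (phi a *: k + k'); rewrite tpureDl -Ek'; congr (_ + _).
by apply: (big_morph (pure k)) => [y y'|]; [exact: tpureDr | exact: tpure0r].
Qed.

Variables (b : R) (s : seq R).
Hypothesis reps : forall x, exists2 y, y \in s & principal b (x - y).
Hypothesis bK : forall k : K, phi b *: k = 0.
Hypothesis vb : v b.

Lemma principal_sub_ideal x : principal b x -> v x.
Proof. by apply: span_min => _ ->. Qed.

(** Generators are [b] and the representatives of R / b that lie in [v]. *)
Lemma ideal_gens : exists p (g : 'I_p -> R),
  (forall i, v (g i)) /\ forall x, v x -> exists a, x = \sum_i a i * g i.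
Proof.
pose G := b :: [seq y <- s | `[< v y >]].
have vG y : y \in G -> v y.
  by rewrite inE mem_filter => /predU1P[->//|/andP[/asboolP]].
exists (size G), (fun i => nth 0 G i); split=> [i|x vx]; first exact/vG/mem_nth.
have delta y : y \in G -> exists a, y = \sum_(i < size G) a i * nth 0 G i.
  move=> Gy; have lt_y : (index y G < size G)%N by rewrite index_mem.
  exists (fun i => (i == Ordinal lt_y)%:R).
  rewrite (bigD1 (Ordinal lt_y)) //= eqxx mul1r nth_index // big1 ?addr0 //.
  by move=> i /negPf ->; rewrite mul0r.
have [y sy /principalP[z Ez]] := reps x.
have vy : v y.
  rewrite -(subKr x y) Ez; apply: smodB => //; exact: idealMl.
have [a Ea] : exists a, y = \sum_(i < size G) a i * nth 0 G i.
  apply: delta; rewrite inE mem_filter sy andbT orbC.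
  by apply/orP; left; apply/asboolP.
have [c Ec] := delta b (mem_head _ _).
exists (fun i => a i + z * c i); rewrite -[LHS](subrK y) Ez addrC Ea {1}Ec.
rewrite mulr_sumr -big_split; apply: eq_bigr => i _ /=.
by rewrite mulrDl mulrA.
Qed.

(** Two powers g^i, g^j with i < j have the same representative modulo [b]; then u = 1 - g^(j -
    i). *)
Lemma power_cycle (g : R) : v g ->
  exists (N : nat) (u : R), v (1 - u) /\ principal b (u * g ^+ N).
Proof.
move=> vg.
have [r Hr] := choice (fun n : nat => (let: ex_intro2 y sy py := reps (g ^+ n) in
  ex_intro (fun y => y \in s /\ principal b (g ^+ n - y)) y (conj sy py))).
have [i [j [ij Eij]]] : exists i j, (i < j)%N /\ r i = r j.
  pose h (i : 'I_(size s).+1) : 'I_(size s) :=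
    Ordinal (etrans (index_mem (r i) s) (Hr i).1).
  have : ~ injective h by move=> /leq_card; rewrite !card_ord ltnn.
  move=> /existsNP[i /existsNP[j /not_implyP[Eh ij]]].
  have Er : r i = r j.
    have /(congr1 (fun k : 'I_(size s) => nth 0 s k)) := Eh.
    by rewrite /= !nth_index //; [exact: (Hr j).1 | exact: (Hr i).1].
  have [lt|lt|E] := ltngtP i j; first by exists i, j.
    by exists j, i.
  by case: ij; exact: val_inj.
exists i, (1 - g ^+ (j - i)); split.
  rewrite subKr -(prednK (_ : 0 < j - i)%N) ?subn_gt0 // exprS.
  exact: idealMr.
rewrite mulrBl mul1r -exprD subnK 1?ltnW //.
have -> : g ^+ i - g ^+ j = (g ^+ i - r i) - (g ^+ j - r j).
  by rewrite Eij opprB addrA subrK.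
by apply: smodB; [exact: (Hr i).2 | exact: (Hr j).2].
Qed.

(** This says that [K] maps onto K_v. The product [w] of the [u i] is 1 modulo [v], so every element
    of the completion is divisible by it; moved to the left factor, it makes that factor killed by
    powers of all generators of [v]. *)
Lemma tens_compl_pure (y : Kv) : exists k, y = pure k (compl_of v 1).
Proof.
have [p [g [vg gens]]] := ideal_gens.
have [N HN] := choice (fun i => power_cycle (vg i)).
have {HN} [u Hu] := choice HN.
pose w := \prod_i u i.
have vw : v (1 - w).
  rewrite /w; elim/big_ind: _ => [|x z vx vz|i _]; last exact: (Hu i).1.
    by rewrite subrr; exact: smod0.
  have -> : 1 - x * z = (1 - x) + x * (1 - z) by rewrite mulrBr mulr1 addrA subrK.
  by apply: smodD => //; exact: idealMl.
have nilw (k : K) i : phi (g i ^+ N i) *: (phi w *: k) = 0.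
  rewrite scalerA -rmorphM /w (bigD1 i) //= mulrCA mulrA.
  have [_ /principalP[z ->]] := Hu i.
  by rewrite mulrAC rmorphM -scalerA bK scaler0.
elim/tens_ind: y => [|k x|x z [k ->] [k' ->]].
- by exists 0; rewrite tpure0l.
- have [x' ->] := compl_divisible vw x; rewrite -tpure_scale.
  exact: pure_nilpotent gens (nilw k).
- by exists (k + k'); rewrite tpureDl.
Qed.

End TensorCompletion.

(** * The degree ideal *)

Section FiniteSupport.
Variables (R : comPzRingType) (b : R) (s : seq R).
Hypothesis reps : forall x, exists2 y, y \in s & principal b (x - y).

(** An ideal containing [b] is determined by the representatives in [s] that it contains. *)
Lemma finitely_many_ideals : finite_set [set v : ideal R | v b].
Proof.
pose code (v : ideal R) : {ffun 'I_(size s) -> bool} :=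
  [ffun i : 'I_(size s) => `[< v (nth 0 s i) >]].
have code_inj (v v' : ideal R) : v b -> v' b -> code v = code v' -> v `<=` v'.
  move=> vb v'b E x vx; have [y sy bxy] := reps x.
  have lt_y : (index y s < size s)%N by rewrite index_mem.
  have := congr1 (fun g : {ffun 'I_(size s) -> bool} => g (Ordinal lt_y)) E.
  rewrite !ffunE /= nth_index // => Ey.
  have v'y : v' y.
    apply/asboolP; rewrite -Ey; apply/asboolP.
    by rewrite -(subKr x y); apply: smodB => //; exact: principal_sub_ideal bxy.
  by rewrite -(subrK y x); apply: smodD => //; exact: principal_sub_ideal bxy.
pose decode g := xget smodT [set v : ideal R | v b /\ code v = g].
apply: (@sub_finite_set _ _ (range decode)); last exact/finite_image/finite_finset.
move=> v /= vb; exists (code v) => //; rewrite /decode.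
case: xgetP => [v' _ /= [v'b E]|/(_ v) /=]; last by case.
by apply: submodule_ext => x; split; apply: code_inj.
Qed.

End FiniteSupport.

Section Degree.
Variables (Fq : finFieldType) (C : curve Fq).
Variables (L : fieldType) (psi : {rmorphism Fq -> L}).
Local Notation A := (coord_ring C).
Local Notation AL := (AL C psi).
Local Notation iA := (iotaA C psi).
Local Notation iL := (iotaL C psi).
Local Notation rL := (res iL).
Variable c : {rmorphism A -> L}.
Variables (r d r' d' : nat) (M : pure_motive psi c r d) (M' : pure_motive psi c r' d').
Variable f : {linear mot_mod M -> mot_mod M'}.
Hypothesis isog : isogeny f.
Local Notation P := (mot_mod M').
Local Notation thick := (thick f).
Implicit Types I J v : ideal A.

Section LocalDimension.
Variable v : ideal A.
Local Notation Kv := (coker_at f v).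
Local Notation pure := (@tpure A AL iA (coker f) (completion v)).

(* The map K_v -> M' / (range f + v^n M'). *)
Lemma coker_at_reduction n : exists rho : Kv -> qmod (thick (ideal_exp v n)),
  [/\ forall y z, rho (y + z) = rho y + rho z,
      forall l y, rho (iL l *: y) = iL l *: rho y &
      forall m, rho (pure (qclass (imm f) m) (compl_of v 1)) = qclass _ m].
Proof.
set N := thick (ideal_exp v n).
pose B (k : coker f) (x : completion v) : qmod N :=
  qclass N (iA (qrepr (compl_val x n)) *: qrepr k).
have fN m : imm f m -> N m by move=> /thick_set0; exact: (thick_sub (@sub0set _ _)).
have BE m (x : completion v) (a : A) :
    compl_val x n = qclass (ideal_exp v n) a ->
  B (qclass (imm f) m) x = qclass N (iA a *: m).
  move=> xa; apply/qclassP; set a' := qrepr (compl_val x n); set k := qrepr _.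
  have -> : iA a' *: k - iA a *: m = iA a' *: (k - m) + iA (a' - a) *: m.
    by rewrite scalerBr rmorphB scalerBl addrA subrK.
  apply: smodD; first by apply/smodZ/fN; exact: qrepr_class.
  by apply: thick_scale; rewrite /a' xa; exact: qrepr_class.
have xE (x : completion v) :
    compl_val x n = qclass (ideal_exp v n) (qrepr (compl_val x n)).
  by rewrite qreprK.
have BE' (k : coker f) (x : completion v) (a : A) :
    compl_val x n = qclass (ideal_exp v n) a ->
    B k x = qclass N (iA a *: qrepr k).
  by rewrite -[in B k x](qreprK k); exact: BE.
have bB : balanced iA B.
  split=> [k k' x|k x x'|a k x].
  - rewrite -[k]qreprK -[k']qreprK [in LHS]/GRing.add /= qaddE.
    by rewrite !(BE _ _ _ (xE x)) scalerDr [RHS]qaddE.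
  - rewrite (BE' k (x + x') (qrepr (compl_val x n) + qrepr (compl_val x' n))).
      by rewrite !(BE' _ _ _ (xE _)) rmorphD scalerDl [RHS]qaddE.
    by rewrite compl_valD {1}(xE x) {1}(xE x') [LHS]qaddE.
  - rewrite -[k]qreprK qclassZ (BE _ _ _ (xE x)) scalerA -rmorphM.
    have E : compl_val (a *: x) n =
        qclass (ideal_exp v n) (a * (qrepr (compl_val x n) : A)).
      by rewrite compl_valZ {1}(xE x); exact: qclassZ.
    by rewrite (BE _ _ _ E) mulrC.
exists (tlift B); split=> [y z|l y|m]; first exact: tliftD.
  elim/tens_ind: y => [|k x|y z IH IH'].
  - have t0 : tlift B (0 : Kv) = 0.
      apply: (addrI (tlift B 0)); rewrite addr0.
      exact: esym (etrans (congr1 (tlift B) (esym (addr0 0))) (tliftD bB 0 0)).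
    by rewrite scaler0 t0 scaler0.
  - rewrite tpureZ !tliftE // -[k]qreprK qclassZ !(BE _ _ _ (xE x)) qclassZ.
    by rewrite !scalerA mulrC.
  - by rewrite scalerDr !tliftD // IH IH' scalerDr.
by rewrite tliftE // (BE _ _ 1) // rmorph1 scale1r.
Qed.

(** A relation between the images in K_v is carried by [rho] to one modulo
    [thick (ideal_exp v n)]. *)
Lemma coker_dim_at_lower n nv (J : finType) (u : J -> rL P) :
    has_dim (rL Kv) nv -> indep_mod (res_smod iL (thick (ideal_exp v n))) u ->
  (#|J| <= nv)%N.
Proof.
move=> Knv iu; have [rho [rhoD rhoZ rhoE]] := coker_at_reduction n.
pose w j : rL Kv := pure (qclass (imm f) (u j)) (compl_of v 1).
apply: (has_dim_indep Knv (u := w)) => a /= Ea; apply: iu.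
suff : thick (ideal_exp v n) (\sum_j iL (a j) *: (u j : P)) by [].
apply/qclass_eq0.
have rho0 : rho 0 = 0 by apply: (addrI (rho 0)); rewrite -rhoD !addr0.
have := congr1 rho Ea; rewrite rho0 (big_morph rho rhoD rho0) => E.
apply: etrans E.
rewrite (raddf_sum (qclass _)); apply: eq_bigr => j _.
have -> : rho (a j *: w j) = iL (a j) *: rho (w j) by exact: rhoZ.
by rewrite rhoE qclassZ.
Qed.

Variable b : A.
Hypothesis fb : forall x, imm f (iA b *: x).

Lemma coker_killed (k : coker f) : iA b *: k = 0.
Proof. by rewrite -[k]qreprK qclassZ; apply/qclass_eq0. Qed.

Lemma coker_dim_at_trivial : maximal_ideal v -> ~ v b -> coker_dim_at f v = 0%N.
Proof.
move=> vmax nvb; apply: has_dim_dimension; exists (fun i : 'I_0 => 0) => y.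
exists [ffun=> 0]; split=> [|a _]; last by apply/ffunP => -[].
rewrite big_ord0; apply: (tens_compl_trivial coker_killed).
exact: maximal_ideal_unit.
Qed.

Lemma coker_at_finite (s : seq A) : v b ->
    (forall x, exists2 y, y \in s & principal b (x - y)) ->
  exists n, has_dim (rL Kv) n.
Proof.
move=> vb reps; have [n [w sw]] := coker_spans isog.
have [k Kk _] : exists2 k, has_dim (rL Kv) k & (k <= #|'I_n|)%N; last by exists k.
apply: (@spans_has_dim _ _ _
  (fun j => pure (qclass (imm f) (w j)) (compl_of v 1) : rL Kv)).
move=> y; have [k ->] := tens_compl_pure reps coker_killed vb y.
have [a Ha] := sw (qrepr k); exists a => /=; apply/eqP; rewrite subr_eq0; apply/eqP.
rewrite -[in LHS](qreprK k).
have -> : qclass (imm f) (qrepr k) = \sum_j iL (a j) *: qclass (imm f) (w j).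
  under eq_bigr do rewrite qclassZ.
  by rewrite -(raddf_sum (qclass (imm f))); apply/qclassP.
rewrite (big_morph (pure^~ (compl_of v 1)) (id1 := 0) (op1 := +%R)) //.
- by apply: eq_bigr => j _; rewrite -tpureZ.
- by move=> x z; exact: tpureDl.
- exact: tpure0l.
Qed.

End LocalDimension.

(** Let e be dim K_v / [F_v : Fq], rounded down. If v^e were unstable, [unstable_indep] would give
    (e + 1) [F_v : Fq] independent elements, more than dim K_v. Stability then passes from v^e to
    the product. *)
Lemma stable_degree v : maximal_ideal v -> stable f v (degree f).
Proof.
have [b [fb [s reps]]] := coker_annihilator isog.
move=> vmax; rewrite /degree.
set F := fun v : ideal A => ideal_exp v (coker_dim_at f v %/ residue_degree v).
have stF : stable f v (F v).
  apply: contrapT => nst; have [e0 [J [u [iu leJ]]]] := unstable_indep isog vmax nst.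
  have vb : v b.
    apply: (layer_annihilator vmax nst) => x _.
    by apply: (thick_sub (@sub0set _ _)); apply/thick_set0; exact: fb.
  have [n Kn] := coker_at_finite fb vb reps.
  have := leq_trans leJ (coker_dim_at_lower Kn iu).
  by rewrite /coker_dim_at (has_dim_dimension Kn) leqNgt ltn_ceil.
(* A maximal ideal not containing [b] has exponent 0, so the support lies among the finitely many
   ideals containing [b]. *)
have finF : finite_set ([set v | maximal_ideal v] `&` F @^-1` [set~ smodT]).
  apply: sub_finite_set (finitely_many_ideals reps) => u [/= umax Fu].
  apply: contrapT => nub; apply: Fu.
  by rewrite /F (coker_dim_at_trivial fb umax nub) div0n.
have [vs|nvs] := boolP (v \in finite_support smodT [set v | maximal_ideal v] F).
  elim: (finite_support _ _ _) vs => // u t IH; rewrite inE big_cons.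
  by move=> /predU1P[<-|/IH]; [exact: stable_mulr | exact: stable_mull].
(* Outside the support the factor is the unit ideal; its stability means v K = K and passes to every
   ideal. *)
have FvT : F v = smodT.
  move: nvs; rewrite in_finite_support // => nvs.
  apply: contrapT => nF; case/negP: nvs; rewrite inE; by split.
rewrite FvT in stF.
by elim/big_rec: _ => // u I _; exact: stable_mull.
Qed.

(* A maximal proper submodule Q of N = thick (degree f) over range f would have
   the maximal annihilator p = (Q : N), and N = p N + range f would lie in Q. *)
Lemma thick_degree x : thick (degree f) x -> imm f x.
Proof.
set D := degree f; move: x; apply: contrapT => nD.
have [n [w sw]] := coker_spans isog.
pose Qok (Q : submodule P) := [/\ imm f `<=` Q, Q `<=` thick D & ~ (thick D `<=` Q)].
(* A maximal [Q] is found as one with the most elements independent modulo the image of [f]; their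
   number is at most [n]. *)
pose ex_indep k := exists Q, Qok Q /\ exists u : 'I_k -> rL P,
  (forall i, Q (u i)) /\ indep_mod (res_smod iL (imm f)) u.
have fD : imm f `<=` thick D.
  by move=> x /thick_set0; exact: (thick_sub (@sub0set _ _)).
have ex0 : exists k, `[< ex_indep k >].
  exists 0%N; apply/asboolP; exists (imm f); split; first by split.
  by exists (fun=> 0); split=> [[]|a _ []].
have bound k : `[< ex_indep k >] -> (k <= n)%N.
  move=> /asboolP[Q [_ [u [_ iu]]]]; rewrite -[k]card_ord -[n]card_ord.
  by apply: steinitz iu _ => j; exact: sw.
have [k /asboolP[Q [[fQ QD nDQ] [u [Qu iu]]]] kmax] := ex_maxnP ex0 bound.
have Qmax (Q' : submodule P) : Q `<=` Q' -> Q' `<=` thick D -> ~ (Q' `<=` Q) ->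
    thick D `<=` Q'.
  move=> QQ' Q'D nQ'Q; apply: contrapT => nDQ'.
  have [x Q'x nQx] : exists2 x, Q' x & ~ Q x.
    apply: contrapT => nx; apply: nQ'Q => x Q'x.
    by apply: contrapT => nQx; apply: nx; exists x.
  suff /kmax : `[< ex_indep k.+1 >] by rewrite ltnn.
  apply/asboolP; exists Q'; split; first by split=> // y /fQ/QQ'.
  have iux : indep_mod (res_smod iL (imm f)) (sum_fam (fun _ : 'I_1 => x : rL P) u).
    apply: (@indep_mod_add _ _ _ (res_smod iL Q)) => // a.
    rewrite big_ord1 => /= Qax i; rewrite (ord1 i); apply/eqP/negPn/negP => a0.
    apply: nQx; rewrite -[x]scale1r -(rmorph1 iL) -(mulVf a0) rmorphM -scalerA.
    exact: smodZ.
  pose h (i : 'I_k.+1) : 'I_1 + 'I_k := fintype.split (i : 'I_(1 + k)).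
  have bh : bijective h.
    exists (@fintype.unsplit 1 k); first exact: fintype.splitK.
    exact: fintype.unsplitK.
  exists (sum_fam (fun=> x : rL P) u \o h); split; last exact: indep_mod_reindex.
  by move=> i /=; case: (h i) => [j|j] //=; exact: QQ'.
pose p := @Submodule A (A^o) [set a : A^o | forall x, thick D x -> Q (iA a *: x)].
have p0 x : thick D x -> Q (iA 0 *: x) by rewrite rmorph0 scale0r => _; exact: smod0.
have pD (a a' : A^o) : (forall x, thick D x -> Q (iA a *: x)) ->
    (forall x, thick D x -> Q (iA a' *: x)) ->
  forall x, thick D x -> Q (iA (a + a') *: x).
  move=> pa pa' x Dx; rewrite rmorphD scalerDl.
  by apply: smodD; [exact: pa | exact: pa'].
have pZ (a : A) (a' : A^o) : (forall x, thick D x -> Q (iA a' *: x)) ->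
    forall x, thick D x -> Q (iA (a *: a' : A^o) *: x).
  by move=> pa' x Dx; rewrite rmorphM -scalerA; apply/smodZ/pa'.
set pI : ideal A := p p0 pD pZ.
have pmax : maximal_ideal pI.
  split=> [pT|J pJ].
    have p1 : pI 1 by rewrite pT.
    by apply: nDQ => x /p1; rewrite rmorph1 scale1r.
  have [Jp|nJp] := pselect (J `<=` pI).
    by left; apply: submodule_ext => x; split; [exact: Jp | exact: pJ].
  right; have [a Ja npa] : exists2 a, J a & ~ pI a.
    apply: contrapT => na; apply: nJp => a Ja.
    by apply: contrapT => npa; apply: na; exists a.
  (* This is Q + a N for N = [thick D]; by maximality of [Q] it is all of N, so [a] acts
     surjectively on N / Q. *)
  pose Q' := @Submodule AL P [set x | exists y, thick D y /\ Q (x - iA a *: y)].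
  have Q'0 : exists y, thick D y /\ Q (0 - iA a *: y).
    by exists 0; rewrite scaler0 subr0; split; exact: smod0.
  have Q'D x x' : (exists y, thick D y /\ Q (x - iA a *: y)) ->
      (exists y, thick D y /\ Q (x' - iA a *: y)) ->
      exists y, thick D y /\ Q (x + x' - iA a *: y).
    move=> [y [Dy Qy]] [y' [Dy' Qy']]; exists (y + y'); split; first exact: smodD.
    by rewrite scalerDr opprD addrACA; exact: smodD.
  have Q'Z (l : AL) x : (exists y, thick D y /\ Q (x - iA a *: y)) ->
      exists y, thick D y /\ Q (l *: x - iA a *: y).
    move=> [y [Dy Qy]]; exists (l *: y); split; first exact: smodZ.
    by rewrite scalerA mulrC -scalerA -scalerBr; exact: smodZ.
  have DQ' : thick D `<=` Q' Q'0 Q'D Q'Z.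
    apply: Qmax => [x Qx|x [y [Dy Qy]]|Q'Q].
    - by exists 0; rewrite scaler0 subr0; split=> //; exact: smod0.
    - by rewrite -(subrK (iA a *: y) x); apply: smodD; [exact: QD | exact: smodZ].
    - apply: npa => x Dx; apply: Q'Q; exists x; split=> //.
      by rewrite subrr; exact: smod0.
  have DX j x : thick D x -> exists y, thick D y /\ Q (x - iA (a ^+ j) *: y).
    elim: j x => [|j IH] x Dx.
      by exists x; rewrite expr0 rmorph1 scale1r subrr; split=> //; exact: smod0.
    have [y [/DQ'[z [Dz Qz]] Qy]] := IH x Dx; exists z; split=> //.
    rewrite -(subrKA (iA (a ^+ j) *: y)); apply: smodD => //.
    by rewrite exprSr rmorphM -scalerA -scalerBr; exact: smodZ.
  have [l [e be]] := thick_basis isog setT set0.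
  have [q [mq _ Hq]] := thick_minpoly isog a be.
  (* Write q = q1 X^j with q1(0) non-zero. As q(a) kills coker f and a^j is surjective on N / Q,
     q1(a) lies in [pI]; since [a] is in [J], so is the constant q1(0). *)
  have [j [q1 q10 Eq]] := multiplicity_XsubC q 0.
  rewrite (monic_neq0 mq) /= in q10.
  pose ev (g : {poly Fq}) : A := (map_poly (cstA C) g).[a].
  have pq1 : pI (ev q1).
    move=> x Dx; have [y [Dy Qy]] := DX j x Dx.
    rewrite -(subrK (iA (a ^+ j) *: y) x) scalerDr; apply: smodD; first exact: smodZ.
    rewrite scalerA -rmorphM; have -> : ev q1 * a ^+ j = ev q.
      rewrite /ev Eq subr0 rmorphM rmorphXn /= map_polyX.
      by rewrite hornerM hornerXn.
    by apply: fQ; apply/thick_set0/Hq/thickT.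
  have /factor_theorem[q2 Eq2] : root (q1 - q1.[0]%:P) 0.
    by rewrite rootE hornerD hornerN hornerC subrr.
  have Jc : J (cstA C q1.[0]).
    have -> : cstA C q1.[0] = ev q1 - ev q2 * a.
      rewrite /ev -[q1 in map_poly _ q1](subrK q1.[0]%:P) Eq2 subr0.
      rewrite rmorphD rmorphM /= map_polyX map_polyC /= hornerD hornerMX hornerC.
      by rewrite addrC addKr.
    by apply: smodB; [exact: pJ | exact: idealMl].
  apply: submodule_ext => z; split=> // _; apply: ideal_full.
  rewrite -(rmorph1 (cstA C)) -(mulVf (_ : q1.[0] != 0)) ?rmorphM.
    exact: idealMl.
  by rewrite -rootE.
apply: nDQ => x /(stable_degree pmax); move: x; apply: thick_ind => [x y|m|z m].
- exact: smodD.
- by apply: fQ; exists m.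
move: z; apply: ideal_mul_ind => [|y z Py Pz|y z py Dz].
- by rewrite rmorph0 scale0r; exact: smod0.
- by rewrite rmorphD scalerDl; exact: smodD.
- by rewrite rmorphM -scalerA; apply: py; exact: thick_scale.
Qed.

End Degree.

Theorem proposition2p10
  (Fq : finFieldType) (C : curve Fq)
  (L : fieldType) (psi : {rmorphism Fq -> L})
  (c : {rmorphism coord_ring C -> L})
  (c_psi : forall a : Fq, c (cstA C a) = psi a)
  (r d r' d' : nat)
  (M : pure_motive psi c r d) (M' : pure_motive psi c r' d')
  (f : {linear mot_mod M -> mot_mod M'}) :
  isogeny f ->
  annihilates (degree f) (res (iotaA C psi) (coker f)).
Proof.
move=> isog a k Da; rewrite res_scaleE -[k]qreprK qclassZ.
by apply/qclass_eq0/(thick_degree isog); exact: thick_scale.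
Qed.
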